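(* Let $p$ be a prime, let $S$ be a finite $p$-group, and let $\mathcal F$ be a saturated fusion system on $S$. Then the dimension homomorphism $$\mathrm{Dim}\colon R_{\mathbb R}(\mathcal F)\to C_{ba}(\mathcal F)$$ is surjective.
   Context: A fusion system $\mathcal F$ on a finite $p$-group $S$ is a category whose objects are the subgroups of $S$ and whose morphism sets $\mathcal F(P,Q)$ satisfy: $\mathrm{Hom}_S(P,Q)\subseteq \mathcal F(P,Q)\subseteq \mathrm{Inj}(P,Q)$, where $\mathrm{Inj}(P,Q)$ is the set of injective group homomorphisms and $\mathrm{Hom}_S(P,Q)$ the set of homomorphisms induced by conjugation by elements of $S$; and every $\varphi\in\mathcal F(P,Q)$ factors in $\mathcal F$ as $P\xrightarrow{\varphi}\varphi P\hookrightarrow Q$ with $\varphi^{-1}\colon\varphi P\to P$ also in $\mathcal F$. Subgroups (or elements) are $\mathcal F$-conjugate if connected by an isomorphism in $\mathcal F$. $P\le S$ is fully $\mathcal F$-centralized (resp. fully $\mathcal F$-normalized) if $|C_S(P)|\ge|C_S(P')|$ (resp. $|N_S(P)|\ge|N_S(P')|$) for all $P'$ $\mathcal F$-conjugate to $P$. $\mathcal F$ is saturated if: (1) every fully $\mathcal F$-normalized $P$ is fully $\mathcal F$-centralized and $\mathrm{Aut}_S(P)$ is a Sylow $p$-subgroup of $\mathrm{Aut}_{\mathcal F}(P)$; (2) if $\varphi\in\mathcal F(P,S)$ has fully $\mathcal F$-centralized image, then $\varphi$ extends to some $\tilde\varphi\in\mathcal F(N_\varphi,S)$, where $N_\varphi=\{x\in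 N_S(P)\mid \exists y\in N_S(\varphi P)\colon \varphi\circ c_x=c_y\circ\varphi\}$. $R_{\mathbb R}(S)$ is the ring of virtual finite-dimensional real representations of $S$. A (virtual) $S$-representation $V$ is $\mathcal F$-stable if $\mathrm{res}_\varphi V=\mathrm{res}^S_P V$ for all $P\le S$ and $\varphi\in\mathcal F(P,S)$, where $\mathrm{res}_\varphi V$ is $V$ with $P$ acting by $x\cdot v=\varphi(x)v$. $R_{\mathbb R}(\mathcal F)\subseteq R_{\mathbb R}(S)$ is the subring of $\mathcal F$-stable virtual representations. For $X=V-W$, $\mathrm{Dim}(X)$ is the function on subgroups of $S$ given by $\mathrm{Dim}(X)(H)=\dim_{\mathbb R}V^H-\dim_{\mathbb R}W^H$. For a finite group $G$, a super class function on $G$ is a function from the set of subgroups of $G$ to $\mathbb Z$ that is constant on $G$-conjugacy classes. It is a Borel-Smith function if: (i) whenever $L\lhd H\le G$, $H/L\cong\mathbb Z/q$ with $q$ an odd prime, $f(L)-f(H)$ is even; (ii) whenever $L\lhd H\le G$, $H/L\cong\mathbb Z/q\times\mathbb Z/q$ with $q$ prime, and $H_i/L$ ($0\le i\le q$) are all the subgroups of order $q$ of $H/L$, $f(L)-f(H)=\sum_{i=0}^q (f(H_i)-f(H))$; (iii) whenever $L\lhd H\lhd N\le N_G(L)$ and $H/L\cong\mathbb Z/2$, $f(L)-f(H)$ is even if $N/L\cong\mathbb Z/4$, and $f(L)-f(H)$ is divisible by $4$ if $N/L$ is the quaternion group $Q_8$ of order $8$. $C_{ba}(\mathcal F)$ is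 the group of Borel-Smith functions $f$ on $S$ that are constant on $\mathcal F$-conjugacy classes of subgroups of $S$ and satisfy: whenever $L\lhd H\le S$ with $H/L\cong\mathbb Z/p$, and $\varphi\in\mathrm{Aut}_{\mathcal F}(H)$ satisfies $\varphi(L)=L$ and the induced automorphism of $H/L$ has order $m$, then $f(L)\equiv f(H)\pmod m$. *)

(* Defs.v *)
From HB Require Import structures.
From mathcomp Require Import all_boot all_order all_algebra all_fingroup.
From mathcomp Require Import all_solvable mxrepresentation character.
From mathcomp Require Import reals.

Set Implicit Arguments.
Unset Strict Implicit.
Unset Printing Implicit Defensive.

Import Order.TTheory GRing.Theory Num.Theory.

Local Open Scope group_scope.

Section FusionSystems.

Variable gT : finGroupType.
Implicit Types (P Q T S H L K N : {group gT}) (f g : gT -> gT).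

(* The generated group is only there to have a {group gT} at hand: for f a
   homomorphism on P, it is the image of P (see fimgE).                       *)
Definition fimg f P : {group gT} := [group of <<f @: P>>].

(* A group homomorphism P -> Q is represented by any function gT -> gT that
   restricts to it: only the values on P matter (fs_ext), so restricting to a
   smaller source or enlarging the target leaves the function unchanged, and
   inclusions are represented by id. Composing is composing functions, and
   fs_conj at x = 1 provides the identities. With mathcomp's conventions
   y ^ x = x^-1 * y * x, and P :^ x is the corresponding conjugate of P.      *)
Record fusion_system S := FusionSystem {
  fs_hom :> {group gT} -> {group gT} -> pred (gT -> gT);
  fs_ext : forall P Q f g, {in P, f =1 g} -> fs_hom P Q f = fs_hom P Q g;
  fs_obj : forall P Q f, fs_hom P Q f -> P \subset S /\ Q \subset S;
  fs_inj : forall P Q f, fs_hom P Q f ->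
    [/\ {in P &, {morph f : x y / x * y}}, {in P &, injective f}
      & f @: P \subset Q];
  fs_conj : forall P Q x, P \subset S -> Q \subset S -> x \in S ->
    P :^ x \subset Q -> fs_hom P Q (conjg^~ x);
  fs_comp : forall P Q T f g,
    fs_hom P Q f -> fs_hom Q T g -> fs_hom P T (g \o f);
  fs_factor : forall P Q f, fs_hom P Q f ->
    fs_hom P (fimg f P) f /\
    exists2 g, {in P, cancel f g} & fs_hom (fimg f P) P g
}.

Section Saturation.

Variables (S : {group gT}) (F : fusion_system S).

Lemma fimgE P Q f : F P Q f -> fimg f P = f @: P :> {set gT}.
Proof.
case/fs_inj=> fM _ _; apply: gen_set_id; apply/group_setP; split.
  apply/imsetP; exists 1 => //.
  by apply: (mulgI (f 1)); rewrite mulg1 -fM // mulg1.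
move=> _ _ /imsetP[x Px ->] /imsetP[y Py ->].
by rewrite -fM // imset_f ?groupM.
Qed.

Definition fs_iso P Q f : Prop :=
  F P Q f /\
  exists g, [/\ F Q P g, {in P, cancel f g} & {in Q, cancel g f}].

Definition fs_conjugate P Q : Prop := exists f, fs_iso P Q f.

Definition fully_centralized P : Prop :=
  P \subset S /\ forall Q, fs_conjugate P Q -> #|'C_S(Q)| <= #|'C_S(P)|.

Definition fully_normalized P : Prop :=
  P \subset S /\ forall Q, fs_conjugate P Q -> #|'N_S(Q)| <= #|'N_S(P)|.

Definition fs_Aut P : {set {perm gT}} := [set a in Aut P | F P P a].

Lemma fs_Aut_group_set P : P \subset S -> group_set (fs_Aut P).
Proof.
move=> sPS; apply/group_setP; split.
  have e1: {in P, (1 : {perm gT}) =1 conjg^~ 1}.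
    by move=> x _; rewrite perm1 conjg1.
  by rewrite inE group1 (fs_ext F P e1); apply: fs_conj; rewrite ?conjsg1.
move=> a b /setIdP[Aa Fa] /setIdP[Ab Fb]; apply/setIdP.
have eM: {in P, a * b =1 b \o a} by move=> x _; rewrite permM.
by split; [apply: groupM | rewrite (fs_ext F P eM); apply: fs_comp Fa Fb].
Qed.

Definition S_Aut P : {set {perm gT}} := conj_aut P @* 'N_S(P).

(* N_phi, for phi represented by f on P. *)
Definition ext_dom P f : {set gT} :=
  [set x in 'N_S(P) | [exists y in 'N_S(fimg f P),
     [forall u in P, f (u ^ x) == f u ^ y]]].

Lemma ext_dom_group_set P f : group_set (ext_dom P f).
Proof.
apply/group_setP; split.
  apply/setIdP; split; first exact: group1.
  apply/exists_inP; exists 1; first exact: group1.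
  by apply/forall_inP=> u _; rewrite !conjg1.
move=> x1 x2 /setIdP[Nx1 /exists_inP[y1 Ny1 e1]].
case/setIdP=> Nx2 /exists_inP[y2 Ny2 e2].
apply/setIdP; split; first exact: groupM.
apply/exists_inP; exists (y1 * y2); first exact: groupM.
apply/forall_inP=> u Pu; rewrite !conjgM.
have Pux : u ^ x1 \in P by case/setIP: Nx1 => _ /memJ_norm ->.
by rewrite (eqP (forall_inP e2 _ Pux)) (eqP (forall_inP e1 _ Pu)).
Qed.

Canonical ext_dom_group P f := Group (ext_dom_group_set P f).

Definition saturated (p : nat) : Prop :=
  (forall P, fully_normalized P ->
     fully_centralized P /\ p.-Sylow(fs_Aut P) (S_Aut P)) /\
  (forall P f, F P S f -> fully_centralized (fimg f P) ->
     exists2 f', F (ext_dom_group P f) S f' & {in P, f' =1 f}).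

End Saturation.

End FusionSystems.

Section VirtualRepresentations.

Variables (R : realType) (gT : finGroupType).
Implicit Types (S G P : {group gT}).

(* The formal difference V - W; equality in the Grothendieck group is veq.    *)
Record virtual_repr G := VirtualRepr {
  vpos : representation R G;
  vneg : representation R G
}.

Definition veq G (X Y : virtual_repr G) : Prop :=
  exists Z : representation R G,
    mx_rsim (dadd_grepr (dadd_grepr (vpos X) (vneg Y)) Z)
            (dadd_grepr (dadd_grepr (vpos Y) (vneg X)) Z).

Definition Dim G (X : virtual_repr G) (H : {group gT}) : int :=
  ((\rank (rfix_mx (vpos X) H))%:Z - (\rank (rfix_mx (vneg X) H))%:Z)%R.

Section Restriction.

Variables (S : {group gT}) (F : fusion_system S) (P : {group gT}).
Variables (f : gT -> gT) (Ff : F P S f).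

Lemma res_mx_repr (V : representation R S) : mx_repr P (fun x => V (f x)).
Proof.
have [fM _ /subsetP sfPS] := fs_inj Ff.
split=> [|x y Px Py]; last by rewrite fM // repr_mxM // sfPS ?imset_f.
suff ->: f 1 = 1 by rewrite repr_mx1.
by apply: (mulgI (f 1)); rewrite mulg1 -fM // mulg1.
Qed.

Definition res_repr (V : representation R S) : representation R P :=
  Representation (MxRepresentation (res_mx_repr V)).

Definition res_virtual (X : virtual_repr S) : virtual_repr P :=
  VirtualRepr (res_repr (vpos X)) (res_repr (vneg X)).

End Restriction.

Definition sub_virtual S P (sPS : P \subset S) (X : virtual_repr S) :
    virtual_repr P :=
  VirtualRepr (Representation (subg_repr (vpos X) sPS))
              (Representation (subg_repr (vneg X) sPS)).

Definition F_stable S (F : fusion_system S) (X : virtual_repr S) : Prop :=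
  forall P f (sPS : P \subset S) (Ff : F P S f),
    veq (res_virtual Ff X) (sub_virtual sPS X).

Lemma rank_rfix_rsim G (V W : representation R G) (H : {group gT}) :
  H \subset G -> mx_rsim V W ->
  \rank (rfix_mx V H) = \rank (rfix_mx W H).
Proof.
move=> sHG.
suff le (V1 V2 : representation R G) : mx_rsim V1 V2 ->
    \rank (rfix_mx V1 H) <= \rank (rfix_mx V2 H).
  by move=> VW; apply/eqP; rewrite eqn_leq !le //; exact: mx_rsim_sym VW.
case=> B _ freeB homB; rewrite -(mxrankMfree _ freeB); apply: mxrankS.
apply/rfix_mxP=> x Hx; have Gx := subsetP sHG x Hx.
by rewrite -mulmxA -homB // mulmxA rfix_mx_id.
Qed.

Lemma rank_rfix_dadd G (V W : representation R G) (H : {group gT}) :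
  H \subset G -> \rank (rfix_mx (dadd_grepr V W) H) =
  (\rank (rfix_mx V H) + \rank (rfix_mx W H))%N.
Proof.
move=> sHG; rewrite -rank_diag_block_mx; apply/eqP.
rewrite eqn_leq; apply/andP; split; apply: mxrankS; last first.
  apply/rfix_mxP=> x Hx /=.
  by rewrite mulmx_block !(mulmx0, mul0mx, addr0, add0r) !rfix_mx_id.
set U := rfix_mx _ H; have UJ x: x \in H ->
    row_mx (lsubmx U *m V x) (rsubmx U *m W x) = row_mx (lsubmx U) (rsubmx U).
  move=> Hx; transitivity (U *m dadd_grepr V W x)%R.
    rewrite -[U in RHS]hsubmxK /= mul_row_block.
    by rewrite !mulmx0 addr0 add0r.
  by rewrite rfix_mx_id // hsubmxK.
have /submxP[A defA] : (lsubmx U <= rfix_mx V H)%MS.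
  by apply/rfix_mxP=> x /UJ/eq_row_mx[].
have /submxP[B defB] : (rsubmx U <= rfix_mx W H)%MS.
  by apply/rfix_mxP=> x /UJ/eq_row_mx[].
apply/submxP; exists (row_mx A B).
by rewrite mul_row_block !mulmx0 addr0 add0r -defA -defB hsubmxK.
Qed.

(* Dim is well defined on the Grothendieck group.                             *)
Lemma Dim_veq G (X Y : virtual_repr G) (H : {group gT}) :
  H \subset G -> veq X Y -> Dim X H = Dim Y H.
Proof.
move=> sHG [Z /(rank_rfix_rsim sHG)]; rewrite !rank_rfix_dadd // => /addIn.
move/(congr1 Posz); rewrite !PoszD /Dim => e.
by apply/eqP; rewrite subr_eq addrAC eq_sym subr_eq e.
Qed.

End VirtualRepresentations.

Section BorelSmith.

Variable gT : finGroupType.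
Implicit Types (G S H L N : {group gT}) (f : {group gT} -> int).

(* Only the values of f on the subgroups of G are constrained.                *)
Definition super_class_function G f : Prop :=
  forall H x, H \subset G -> x \in G -> f (H :^ x)%G = f H.

Record Borel_Smith G f : Prop := BorelSmith {
  BS_class : super_class_function G f;
  BS_odd : forall L H q, L <| H -> H \subset G -> prime q -> odd q ->
    H / L \isog Zp q -> (2 %| (f L - f H)%R)%Z;
  BS_sum : forall L H q, L <| H -> H \subset G -> prime q ->
    H / L \isog setX (Zp q) (Zp q) ->
    (f L - f H = \sum_(K : {group gT} |
                   [&& L \subset K, K \subset H & #|(K / L)%g| == q])
                 (f K - f H))%R;
  BS_four : forall L H N, L <| H -> H <| N -> N \subset 'N_G(L) ->
    H / L \isog Zp 2 -> N / L \isog Zp 4 -> (2 %| (f L - f H)%R)%Z;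
  BS_quaternion : forall L H N, L <| H -> H <| N -> N \subset 'N_G(L) ->
    H / L \isog Zp 2 -> N / L \isog 'Q_8 -> (4 %| (f L - f H)%R)%Z
}.

(* In Cba_artin, b is the automorphism of H / L induced by a.                 *)
Record Cba (p : nat) S (F : fusion_system S) f : Prop := InCba {
  Cba_Borel_Smith : Borel_Smith S f;
  Cba_conjugate : forall P Q, fs_conjugate F P Q -> f P = f Q;
  Cba_artin : forall L H (a : {perm gT}) (b : {perm coset_of L}),
    L <| H -> H \subset S -> H / L \isog Zp p ->
    a \in fs_Aut F H -> a @: L = L ->
    b \in Aut (H / L) -> {in H, forall x, b (coset L x) = coset L (a x)} ->
    (f L = f H %[mod #[b]])%Z
}.

End BorelSmith.

(* Main.v *)
Require Import Defs.
From mathcomp Require Import all_boot all_order all_algebra all_fingroup.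
From mathcomp Require Import all_solvable mxrepresentation character.
From mathcomp Require Import boolp reals ring lra trigo.

(** The dimension of the fixed points of a subgroup H is the average over H of
    the character, and representations with the same character are isomorphic
    ([rank_rfix_trace], [rsim_trace]). The task is therefore to find a virtual
    real character psi of S that is invariant under the morphisms of F and has
    the averages prescribed by f. Grouping the elements of H according to the
    cyclic subgroup that they generate, only the sums of psi over the
    generators of each cyclic subgroup C, written gsum psi C, matter
    ([eq_fixdim_gsum]).

    Without fusion, every Borel-Smith function f on a p-group comes from a
    virtual character chi ([Borel_Smith_realizable], a theorem of Dotzel and
    Hamrick). The proof is by induction on the order of S, all proper quotients
    of subgroups being known. If S has a normal elementary abelian subgroup E of
    rank 2, then the Borel-Smith condition for elementary abelian sections of
    rank 2 expresses f through functions inflated from quotients of S when E is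
    central ([realizes_central]), and through a
    character induced from the centralizer of E otherwise
    ([realizes_noncentral]). If there is no such E, then S is cyclic or a
    2-group of maximal class, and multiples of rotation representations
    suffice, the multiplicities being integers by the divisibility conditions
    for sections of odd prime order, of order 4 and of type Q_8
    ([realizes_cyclic], [realizes_extremal2]).

    The character chi need not be invariant under F, but the sums gsum chi C
    are, because f determines them. Two constructions repair chi.

    - There is an F-invariant function Psi with the same sums as chi
      ([stable_pieces]). On the generators of a cyclic group C > 1 with subgroup
      L of index p, it is a multiple of a Gaussian period inflated from C / L,
      and the multiple is an integer because of the congruence f L = f C modulo
      the orders of the induced automorphisms of C / L. The function Psi is not
      a virtual character, but by Artin induction |S| h Psi is one for every
      function h with integer values that depends only on the F-class of the
      cyclic subgroup ([vchar_artin]).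

    - Saturation provides a virtual S-S-biset that is stable under F on one side,
      free on both sides, and whose cardinality divided by |S| is prime to p
      ([stable_biset]). It is built from the large twisted diagonals down to the
      small ones, and the divisibilities that each step needs come from
      Burnside's congruences and from the extension axiom
      ([twisted_congruence]). The transfer T along this biset turns characters
      into F-invariant characters, T 1 = A has integer values prime to p, and T
      multiplies the sums over the generators of C by the value of A there
      ([transfer_gsum]).

    With n the totient of |S|, Euler's theorem gives A ^ n = 1 + |S| h for an
    integer-valued h, and psi = T chi * A ^ (n - 1) - |S| h Psi is F-invariant,
    is a virtual character, and has the sums
    A ^ n * gsum chi C - |S| h * gsum chi C = gsum chi C. *)

Set Implicit Arguments.
Unset Strict Implicit.
Unset Printing Implicit Defensive.

Import Order.TTheory GroupScope GRing.Theory Num.Theory.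
Local Open Scope ring_scope.

(** * Traces of real representations *)

Section RealRepresentations.

Variable R : realType.

Lemma realType_pchar' gT (G : {group gT}) : pgroup [pchar R]^' G.
Proof. by rewrite /pgroup pcharf'_nat pnatr_eq0 -lt0n cardG_gt0. Qed.

Lemma natrG_neq0 gT (G : {group gT}) : #|G|%:R != 0 :> R.
Proof. by rewrite pnatr_eq0 -lt0n cardG_gt0. Qed.

(** This stands in for the tensor product of A and B; note that composition
    reverses the left factors. *)
Definition lrmul_mx m n (A : 'M[R]_m) (B : 'M[R]_n) : 'M[R]_(m * n) :=
  lin_mx (mulmxr B \o mulmx A).

Lemma lrmul_mxE m n (A : 'M[R]_m) (B : 'M[R]_n) X :
  mxvec X *m lrmul_mx A B = mxvec (A *m X *m B).
Proof. exact: mul_vec_lin. Qed.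

Lemma eq_mx_mxvec m n p (M N : 'M[R]_(m * n, p)) :
  (forall X : 'M_(m, n), mxvec X *m M = mxvec X *m N) -> M = N.
Proof.
move=> eqMN; apply/row_matrixP=> i; rewrite !rowE.
by have:= eqMN (vec_mx (delta_mx 0 i)); rewrite vec_mxK.
Qed.

Lemma lrmul_mxM m n (A A' : 'M[R]_m) (B B' : 'M[R]_n) :
  lrmul_mx A B *m lrmul_mx A' B' = lrmul_mx (A' *m A) (B *m B').
Proof. by apply: eq_mx_mxvec => X; rewrite mulmxA !lrmul_mxE !mulmxA. Qed.

Lemma lrmul_mx1 m n : lrmul_mx (1%:M : 'M_m) (1%:M : 'M_n) = 1%:M.
Proof. by apply: eq_mx_mxvec => X; rewrite lrmul_mxE mul1mx !mulmx1. Qed.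

Lemma trace_lrmul m n (A : 'M[R]_m) (B : 'M[R]_n) :
  \tr (lrmul_mx A B) = \tr A * \tr B.
Proof.
rewrite /mxtrace (reindex _ (curry_mxvec_bij m n)) /=.
rewrite (eq_bigr (fun ij => A ij.1 ij.1 * B ij.2 ij.2)); last first.
  case=> i j _; rewrite mxE /= vec_mx_delta mxvecE.
  rewrite mxE (bigD1 j) //= big1 ?addr0 => [|k neq].
    rewrite mxE (bigD1 i) //= big1 ?addr0 ?mxE ?eqxx ?mulr1 // => l neq.
    by rewrite mxE (negPf neq) mulr0.
  rewrite mxE big1 ?mul0r // => l _.
  by rewrite mxE (negPf neq) andbF mulr0.
by rewrite mulr_suml -(pair_bigA _ (fun i j => A i i * B j j)) /=;
   apply: eq_bigr => i _; rewrite mulr_sumr.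
Qed.

Lemma row_col_base_idem n (e : 'M[R]_n) :
  e *m e = e -> row_base e *m col_base e = 1%:M.
Proof.
move=> ee; apply: (row_free_inj (row_base_free e)).
rewrite mul1mx -mulmxA mulmx_base.
have [D DC] := row_fullP (col_base_full e).
have eD : D *m e = row_base e.
  transitivity (D *m (col_base e *m row_base e)); first by rewrite mulmx_base.
  by rewrite mulmxA DC mul1mx.
by rewrite -eD -mulmxA ee.
Qed.

Lemma trace_idempotent n (e : 'M[R]_n) : e *m e = e -> \tr e = (\rank e)%:R.
Proof.
move=> ee; rewrite -{1}(mulmx_base e) mxtrace_mulC.
by rewrite row_col_base_idem // mxtrace1.
Qed.

Section Characters.

Variables (gT : finGroupType) (G : {group gT}).
Implicit Types (chi : gT -> R) (H : {group gT}).

Definition rchar chi : Prop :=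
  exists V : representation R G, {in G, forall x, chi x = \tr (V x)}.

Definition vchar chi : Prop :=
  exists X : virtual_repr R G,
    {in G, forall x, chi x = \tr (vpos X x) - \tr (vneg X x)}.

Lemma eq_rchar chi chi' : {in G, chi =1 chi'} -> rchar chi -> rchar chi'.
Proof. by move=> eqx [V VE]; exists V => x Gx; rewrite -eqx ?VE. Qed.

Lemma eq_vchar chi chi' : {in G, chi =1 chi'} -> vchar chi -> vchar chi'.
Proof. by move=> eqx [V VE]; exists V => x Gx; rewrite -eqx ?VE. Qed.

Lemma rchar_trace n (rG : mx_representation R G n) :
  rchar (fun x => \tr (rG x)).
Proof. by exists (Representation rG). Qed.

(** The action on the image of e, in the coordinates given by a row basis of e. *)
Lemma idem_mx_repr n (rG : mx_representation R G n) (e : 'M_n) :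
    e *m e = e -> {in G, forall x, e *m rG x = rG x *m e} ->
  mx_repr G (fun x => row_base e *m rG x *m col_base e).
Proof.
move=> ee cGe; split=> [|x y Gx Gy].
  by rewrite repr_mx1 mulmx1 row_col_base_idem.
move: (mulmx_base e) (row_col_base_idem ee).
move: (row_base e) (col_base e); move: (\rank e) => r B C CB BC.
have Be : B *m e = B by rewrite -CB mulmxA BC mul1mx.
rewrite !mulmxA -(mulmxA _ C) CB.
by rewrite -(mulmxA _ (rG x) e) -cGe // mulmxA Be repr_mxM // !mulmxA.
Qed.

Lemma rchar_idem n (rG : mx_representation R G n) (e : 'M_n) :
    e *m e = e -> {in G, forall x, e *m rG x = rG x *m e} ->
  rchar (fun x => \tr (e *m rG x)).
Proof.
move=> ee cGe.
exists (Representation (MxRepresentation (idem_mx_repr ee cGe))) => x Gx /=.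
by rewrite [RHS]mxtrace_mulC mulmxA mulmx_base.
Qed.

Definition avg_mx n (rG : mx_representation R G n) H :=
  #|H|%:R^-1 *: \sum_(x in H) rG x.

Lemma avg_mx_mull n (rG : mx_representation R G n) H y :
  H \subset G -> y \in H -> avg_mx rG H *m rG y = avg_mx rG H.
Proof.
move=> sHG Hy; rewrite -scalemxAl; congr (_ *: _); rewrite mulmx_suml.
rewrite [RHS](reindex_acts 'R _ Hy) ?astabsR //=; apply: eq_bigr => x Hx.
by rewrite repr_mxM ?(subsetP sHG).
Qed.

Lemma avg_mx_idem n (rG : mx_representation R G n) H :
  H \subset G -> avg_mx rG H *m avg_mx rG H = avg_mx rG H.
Proof.
move=> sHG; rewrite {2}/avg_mx -scalemxAr mulmx_sumr.
rewrite (eq_bigr (fun=> avg_mx rG H)); last by move=> x Hx; rewrite avg_mx_mull.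
by rewrite sumr_const -scaler_nat scalerA mulVf ?natrG_neq0 // scale1r.
Qed.

(** Averaging over H projects onto the fixed points of H, and the trace of a
    projection is its rank. *)
Lemma rank_rfix_trace n (rG : mx_representation R G n) H :
  H \subset G ->
  (\rank (rfix_mx rG H))%:R = #|H|%:R^-1 * \sum_(x in H) \tr (rG x).
Proof.
move=> sHG; transitivity (\tr (avg_mx rG H)); last first.
  by rewrite mxtraceZ raddf_sum.
rewrite trace_idempotent ?avg_mx_idem //; congr (_%:R); apply/eqP.
rewrite eqn_leq !mxrankS //.
  apply/rfix_mxP=> x Hx; exact: avg_mx_mull.
apply/submxP; exists (rfix_mx rG H).
rewrite -scalemxAr mulmx_sumr (eq_bigr (fun=> rfix_mx rG H)); last first.
  by move=> x Hx; rewrite rfix_mx_id.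
by rewrite sumr_const -scaler_nat scalerA mulVf ?natrG_neq0 // scale1r.
Qed.

Lemma hom_mx_repr n1 n2 (rU : mx_representation R G n1)
    (rW : mx_representation R G n2) :
  mx_repr G (fun x => lrmul_mx (rU x^-1%g) (rW x)).
Proof.
split=> [|x y Gx Gy]; first by rewrite invg1 !repr_mx1 lrmul_mx1.
by rewrite lrmul_mxM invMg !repr_mxM ?groupV.
Qed.

(** The homomorphisms are the fixed points of the action of G on matrices by
    X |-> rU x^-1 * X * rW x, whose trace is the product of the traces. *)
Lemma hom_exists n1 n2 (rU : mx_representation R G n1)
    (rW : mx_representation R G n2) :
  (exists2 X : 'M_(n1, n2), X != 0 & {in G, forall x, rU x *m X = X *m rW x})
  <-> \sum_(x in G) \tr (rU x^-1%g) * \tr (rW x) != 0.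
Proof.
pose rH := MxRepresentation (hom_mx_repr rU rW).
have -> : \sum_(x in G) \tr (rU x^-1%g) * \tr (rW x) =
          #|G|%:R * (\rank (rfix_mx rH G))%:R.
  rewrite (rank_rfix_trace rH (subxx G)) mulrA mulfV ?natrG_neq0 // mul1r.
  by apply: eq_bigr => x _; rewrite -trace_lrmul.
rewrite mulf_eq0 (negPf (natrG_neq0 G)) /= pnatr_eq0 mxrank_eq0.
split=> [[X nzX homX] | nzfix].
  apply: contraNneq nzX => fix0; rewrite -(inj_eq (can_inj mxvecK)) linear0.
  rewrite -submx0 -fix0; apply/rfix_mxP=> x Gx /=.
  rewrite lrmul_mxE -mulmxA -homX // mulmxA -repr_mxM ?groupV // mulVg.
  by rewrite repr_mx1 mul1mx.
have [i nzi] : exists i, row i (rfix_mx rH G) != 0.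
  apply/existsP; rewrite -negb_forall; apply: contraNN nzfix => /forallP all0.
  by apply/eqP/row_matrixP=> i; rewrite (eqP (all0 i)) row0.
exists (vec_mx (row i (rfix_mx rH G))) => [|x Gx].
  by rewrite -(inj_eq (can_inj mxvecK)) vec_mxK linear0.
have /rfix_mxP/(_ x Gx) /= : (row i (rfix_mx rH G) <= rfix_mx rH G)%MS.
  exact: row_sub.
rewrite -{1}[row i _]vec_mxK lrmul_mxE => /(canRL mxvecK) fixed.
by rewrite -[in LHS]fixed !mulmxA -repr_mxM ?groupV // mulgV repr_mx1 mul1mx.
Qed.

(** A simple submodule M of the first representation maps nontrivially into the
    second, since by [hom_exists] the existence of such a map can be read off the
    traces. The map is injective because M is simple; by Maschke's theorem M
    splits off on both sides, and the complements still have equal traces. *)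
Lemma rsim_trace n1 n2 (r1 : mx_representation R G n1)
    (r2 : mx_representation R G n2) :
  {in G, forall x, \tr (r1 x) = \tr (r2 x)} -> mx_rsim r1 r2.
Proof.
have [k] := ubnP n1; elim: k => // k IHk in n1 n2 r1 r2 * => le_n1k eqtr.
have eqn : n1 = n2.
  have := eqtr 1%g (group1 G); rewrite !repr_mx1 !mxtrace1.
  by move/eqP; rewrite eqr_nat => /eqP.
case: n2 / eqn in r2 eqtr *.
case: (posnP n1) => [n0 | n_gt0].
  exists 1%:M => //; first by rewrite row_free_unit unitmx1.
  move=> x _; apply/matrixP=> i; have := ltn_ord i; rewrite [X in (_ < X)%N]n0.
  by [].
apply/asboolP.
have nz1 : 1%:M != 0 :> 'M[R]_n1 by rewrite -mxrank_eq0 mxrank1 -lt0n.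
apply: (mxsimple_exists (mxmodule1 r1) nz1) => [[M simM _]]; apply/asboolP.
have [modM nzM _] := simM.
pose rM := submod_repr modM.
have rM1 : (0 < \rank M)%N by rewrite lt0n mxrank_eq0.
have : exists2 X : 'M_(\rank M, n1), X != 0 &
    {in G, forall x, rM x *m X = X *m r2 x}.
  apply/hom_exists; rewrite (eq_bigr (fun x => \tr (rM x^-1%g) * \tr (r1 x))).
    apply/hom_exists; exists (val_submod 1%:M).
      by rewrite -mxrank_eq0 val_submod1 mxrank_eq0.
    by move=> x Gx; rewrite -val_submodE -val_submodJ // mul1mx.
  by move=> x Gx; rewrite eqtr.
case=> X nzX homX.
have freeX : row_free X.
  have /mx_irrP[_ irrM] := (submod_mx_irr modM).2 simM.
  rewrite -kermx_eq0; apply: contraNT nzX => nzK.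
  have modK : mxmodule rM (kermx X).
    apply/mxmoduleP=> x Gx; apply/sub_kermxP.
    by rewrite -mulmxA homX // mulmxA mulmx_ker mul0mx.
  have := irrM _ modK nzK; rewrite -sub1mx => /sub_kermxP.
  by rewrite mul1mx => ->.
have homX' x : x \in G -> (X *m r2 x <= X)%MS.
  by move=> Gx; rewrite -homX // submxMl.
pose N := <<X>>%MS.
have sXN : (X <= N)%MS by rewrite genmxE.
have rkN : \rank N = \rank M by rewrite genmxE; apply/eqP.
have modN : mxmodule r2 N.
  rewrite (eqmx_module _ (genmxE X)); apply/mxmoduleP=> x Gx.
  exact: homX'.
have rsimMN : mx_rsim rM (submod_repr modN).
  exists (in_submod N X) => [||x Gx]; first by rewrite rkN.
    by rewrite /row_free mxrank_in_submod.
  rewrite -in_submodJ // -homX // in_submodE mulmxA -in_submodE.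
  by rewrite /rM.
have [M' modM' defM dxM] := mx_Maschke_pchar r1 (realType_pchar' G) modM (submx1 M).
have [N' modN' defN dxN] := mx_Maschke_pchar r2 (realType_pchar' G) modN (submx1 N).
have rsim' : mx_rsim (submod_repr modM') (submod_repr modN').
  apply: IHk => [|x Gx].
    have rkn : (\rank M + \rank M' = n1)%N.
      by have := mxdirectP dxM; rewrite /= defM mxrank1.
    by rewrite -ltnS; apply: leq_trans le_n1k; rewrite !ltnS -[leqRHS]rkn -add1n leq_add2r.
  apply: (addrI (\tr (rM x))).
  rewrite (mxtrace_dadd_mod modM modM' (mxmodule1 r1)) //.
  rewrite (mxtrace_rsim rsimMN) //.
  rewrite (mxtrace_dadd_mod modN modN' (mxmodule1 r2)) //.
  by rewrite !mxtrace_submod1 // eqtr.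
have rsimr1 := mx_rsim_dadd (mxmodule1 r1) defM dxM
  (mx_rsim_refl _ : mx_rsim _ (Representation rM))
  (mx_rsim_refl _ : mx_rsim _ (Representation (submod_repr modM'))).
have rsimr2 := mx_rsim_dadd (mxmodule1 r2) defN dxN
  (mx_rsim_sym rsimMN : mx_rsim _ (Representation rM))
  (mx_rsim_sym rsim' : mx_rsim _ (Representation (submod_repr modM'))).
apply: mx_rsim_trans (mx_rsim_sym (rsim_submod1 (mxmodule1 r1) _)) _ => //.
apply: mx_rsim_trans rsimr1 (mx_rsim_trans (mx_rsim_sym rsimr2) _).
exact: rsim_submod1.
Qed.

End Characters.

End RealRepresentations.

(** * Virtual characters, restriction and induction *)

Section CharacterRing.

Variables (R : realType) (gT : finGroupType) (G : {group gT}).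
Implicit Types (chi psi : gT -> R) (H : {group gT}).

Lemma rcharD chi psi :
  rchar G chi -> rchar G psi -> rchar G (fun x => chi x + psi x).
Proof.
case=> [V VE] [W WE]; exists (dadd_grepr V W) => x Gx /=.
by rewrite mxtrace_block VE ?WE.
Qed.

Lemma rchar0 : rchar G (fun=> 0 : R).
Proof. by exists grepr0 => x _ /=; rewrite mxtrace1. Qed.

Lemma rchar1 : rchar G (fun=> 1 : R).
Proof.
have repr1 : mx_repr G (fun=> 1%:M : 'M[R]_1) by split=> [|x y _ _] //; rewrite mulmx1.
by exists (Representation (MxRepresentation repr1)) => x _; rewrite mxtrace1.
Qed.

Lemma rcharM chi psi :
  rchar G chi -> rchar G psi -> rchar G (fun x => chi x * psi x).
Proof.
case=> [V VE] [W WE].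
have reprVW : mx_repr G (fun x => lrmul_mx (V x)^T (W x)).
  split=> [|x y Gx Gy]; first by rewrite !repr_mx1 trmx1 lrmul_mx1.
  by rewrite lrmul_mxM -trmx_mul !repr_mxM.
exists (Representation (MxRepresentation reprVW)) => x Gx /=.
by rewrite trace_lrmul mxtrace_tr VE ?WE.
Qed.

Lemma vcharP chi :
  vchar G chi <-> exists chi1 chi2,
    [/\ rchar G chi1, rchar G chi2 & {in G, forall x, chi x = chi1 x - chi2 x}].
Proof.
split=> [[X XE] | [c1 [c2 [[V VE] [W WE] cE]]]].
  by exists (fun x => \tr (vpos X x)), (fun x => \tr (vneg X x));
     split=> //; apply: rchar_trace.
by exists (VirtualRepr V W) => x Gx; rewrite cE ?VE ?WE.
Qed.

Lemma rchar_vchar chi : rchar G chi -> vchar G chi.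
Proof.
move=> rchi; apply/vcharP; exists chi, (fun=> 0).
by split=> // [|x _]; [apply: rchar0 | rewrite subr0].
Qed.

Lemma vchar0 : vchar G (fun=> 0 : R).
Proof. exact: rchar_vchar rchar0. Qed.

Lemma vchar1 : vchar G (fun=> 1 : R).
Proof. exact: rchar_vchar rchar1. Qed.

Lemma vcharB chi psi :
  vchar G chi -> vchar G psi -> vchar G (fun x => chi x - psi x).
Proof.
case/vcharP=> [c1 [c2 [rc1 rc2 cE]]] /vcharP[d1 [d2 [rd1 rd2 dE]]].
apply/vcharP; exists (fun x => c1 x + d2 x), (fun x => c2 x + d1 x).
split; [exact: rcharD | exact: rcharD | move=> x Gx].
by rewrite cE ?dE // opprB opprD addrACA.
Qed.

Lemma vcharN chi : vchar G chi -> vchar G (fun x => - chi x).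
Proof.
by move=> vc; apply: eq_vchar (vcharB vchar0 vc) => x _; rewrite sub0r.
Qed.

Lemma vcharD chi psi :
  vchar G chi -> vchar G psi -> vchar G (fun x => chi x + psi x).
Proof.
by move=> vc vd; apply: eq_vchar (vcharB vc (vcharN vd)) => x _; rewrite opprK.
Qed.

Lemma vchar_sum I (r : seq I) (P : pred I) (F : I -> gT -> R) :
  (forall i, P i -> vchar G (F i)) ->
  vchar G (fun x => \sum_(i <- r | P i) F i x).
Proof.
move=> vF; elim: r => [|i r IHr].
  by apply: eq_vchar vchar0 => x _; rewrite big_nil.
case: (boolP (P i)) => Pi.
  by apply: eq_vchar (vcharD (vF i Pi) IHr) => x _; rewrite big_cons Pi.
by apply: eq_vchar IHr => x _; rewrite big_cons (negPf Pi).
Qed.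

Lemma vcharMn chi n : vchar G chi -> vchar G (fun x => chi x *+ n).
Proof.
move=> vc; elim: n => [|n IHn].
  by apply: eq_vchar vchar0 => x _; rewrite mulr0n.
by apply: eq_vchar (vcharD vc IHn) => x _; rewrite mulrS.
Qed.

Lemma vcharZ (m : int) chi : vchar G chi -> vchar G (fun x => m%:~R * chi x).
Proof.
move=> vc; case: m => n.
  by apply: eq_vchar (vcharMn n vc) => x _; rewrite mulr_natl.
apply: eq_vchar (vcharN (vcharMn n.+1 vc)) => x _.
by rewrite NegzE mulrNz mulNr mulr_natl.
Qed.

Lemma vcharM chi psi :
  vchar G chi -> vchar G psi -> vchar G (fun x => chi x * psi x).
Proof.
case/vcharP=> [c1 [c2 [rc1 rc2 cE]]] /vcharP[d1 [d2 [rd1 rd2 dE]]].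
apply/vcharP; exists (fun x => c1 x * d1 x + c2 x * d2 x).
exists (fun x => c1 x * d2 x + c2 x * d1 x).
split; first by apply: rcharD; apply: rcharM.
  by apply: rcharD; apply: rcharM.
by move=> x Gx; rewrite cE ?dE //; ring.
Qed.

Lemma vcharX chi n : vchar G chi -> vchar G (fun x => chi x ^+ n).
Proof.
move=> vc; elim: n => [|n IHn]; first by apply: eq_vchar vchar1 => x _.
by apply: eq_vchar (vcharM vc IHn) => x _; rewrite exprS.
Qed.

Lemma vchar_class chi : vchar G chi -> {in G &, forall x y, chi (x ^ y)%g = chi x}.
Proof.
case=> X XE x y Gx Gy; rewrite !XE ?groupJ //.
by rewrite !repr_mxM ?groupM ?groupV //; congr (_ - _);
   rewrite mxtrace_mulC -mulmxA -repr_mxM ?groupV // mulgV repr_mx1 mulmx1.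
Qed.

Definition fixdim chi H : R := #|H|%:R^-1 * \sum_(x in H) chi x.

Lemma Dim_fixdim (X : virtual_repr R G) chi H :
    {in G, forall x, chi x = \tr (vpos X x) - \tr (vneg X x)} ->
  H \subset G -> (Dim X H)%:~R = fixdim chi H.
Proof.
move=> XE sHG; rewrite /Dim intrB -!pmulrn !rank_rfix_trace // -mulrBr -sumrB.
by congr (_ * _); apply: eq_bigr => x Hx; rewrite XE ?(subsetP sHG).
Qed.

Lemma fixdimD chi psi H :
  fixdim (fun x => chi x + psi x) H = fixdim chi H + fixdim psi H.
Proof. by rewrite /fixdim big_split mulrDr. Qed.

Lemma fixdimB chi psi H :
  fixdim (fun x => chi x - psi x) H = fixdim chi H - fixdim psi H.
Proof. by rewrite /fixdim sumrB mulrBr. Qed.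

Lemma fixdim_sum I (r : seq I) (P : pred I) (F : I -> gT -> R) H :
  fixdim (fun x => \sum_(i <- r | P i) F i x) H =
  \sum_(i <- r | P i) fixdim (F i) H.
Proof. by rewrite /fixdim exchange_big mulr_sumr. Qed.

Lemma fixdimZ a chi H : fixdim (fun x => a * chi x) H = a * fixdim chi H.
Proof. by rewrite /fixdim -mulr_sumr mulrCA. Qed.

Lemma eq_fixdim chi psi H : {in H, chi =1 psi} -> fixdim chi H = fixdim psi H.
Proof. by move=> eqx; congr (_ * _); apply: eq_bigr. Qed.

Lemma fixdim1 H : fixdim (fun=> 1) H = 1.
Proof. by rewrite /fixdim sumr_const mulVf ?natrG_neq0. Qed.

Lemma fixdim_trivg chi (H : {group gT}) : H :=: 1%g -> fixdim chi H = chi 1%g.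
Proof. by move=> H1; rewrite /fixdim H1 big_set1 cards1 invr1 mul1r. Qed.

End CharacterRing.

Section Functoriality.

Variable R : realType.

Lemma vchar_morph (aT rT : finGroupType) (P : {group aT}) (G : {group rT})
    (f : aT -> rT) (chi : rT -> R) :
    {in P &, {morph f : x y / (x * y)%g}} -> f @: P \subset G -> vchar G chi ->
  vchar P (chi \o f).
Proof.
move=> fM /subsetP sfPG [X XE].
have Gf x : x \in P -> f x \in G by move=> Px; rewrite sfPG ?imset_f.
have f1 : f 1%g = 1%g by apply: (mulgI (f 1%g)); rewrite mulg1 -fM // mulg1.
have reprf n (rG : mx_representation R G n) : mx_repr P (fun x => rG (f x)).
  split=> [|x y Px Py]; first by rewrite f1 repr_mx1.
  by rewrite fM // repr_mxM ?Gf.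
exists (VirtualRepr (Representation (MxRepresentation (reprf _ (vpos X))))
                    (Representation (MxRepresentation (reprf _ (vneg X))))).
by move=> x Px /=; rewrite XE ?Gf.
Qed.

Section Induction.

Variables (gT : finGroupType) (S : {group gT}).

Definition map_perm_mx (a : gT -> gT) : 'M[R]_#|S| :=
  \matrix_(i, j) (a (enum_val j) == enum_val i)%:R.

Lemma eq_map_perm_mx a b : {in S, a =1 b} -> map_perm_mx a = map_perm_mx b.
Proof. by move=> eqab; apply/matrixP=> i j; rewrite !mxE eqab ?enum_valP. Qed.

Lemma map_perm_mx1 : map_perm_mx id = 1%:M.
Proof. by apply/matrixP=> i j; rewrite !mxE (inj_eq enum_val_inj) eq_sym. Qed.

Lemma map_perm_mxM a b : {in S, forall x, b x \in S} ->
  map_perm_mx a *m map_perm_mx b = map_perm_mx (a \o b).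
Proof.
move=> Sb; apply/matrixP=> i j; rewrite !mxE.
have Sbj := Sb _ (enum_valP j).
pose k := enum_rank_in Sbj (b (enum_val j)).
rewrite (bigD1 k) //= !mxE enum_rankK_in // eqxx mulr1.
rewrite big1 ?addr0 // => l /eqP nlk; rewrite !mxE.
case: (b (enum_val j) =P enum_val l) => [bl|]; last by rewrite mulr0.
by case: nlk; apply: enum_val_inj; rewrite enum_rankK_in.
Qed.

Lemma trace_map_perm a :
  \tr (map_perm_mx a) = \sum_(x in S) (a x == x)%:R.
Proof.
by rewrite big_enum_val; apply: eq_bigr => i _; rewrite mxE.
Qed.

Definition ind_char (P : {group gT}) (chi : gT -> R) x :=
  #|P|%:R^-1 * \sum_(s in S | (x ^ s)%g \in P) chi (x ^ s)%g.

(** The induced representation is the part of the tensor product of the regular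
    representation of S with V that is fixed by the diagonal action of P, acting
    by left translations on S; right translations by S commute with it. *)
Lemma rchar_ind (P : {group gT}) chi :
  P \subset S -> rchar P chi -> rchar S (ind_char P chi).
Proof.
move=> sPS [V VE].
have reprS : mx_repr S (fun x => lrmul_mx (map_perm_mx (mulg^~ x))
                                          (1%:M : 'M_(rdegree V))).
  split=> [|x y Sx Sy].
    rewrite (eq_map_perm_mx (b := id)) ?map_perm_mx1 ?lrmul_mx1 //.
    by move=> z _; rewrite mulg1.
  rewrite lrmul_mxM mul1mx map_perm_mxM; last by move=> z Sz; rewrite groupM.
  by congr (lrmul_mx _ _); apply: eq_map_perm_mx => z _ /=; rewrite mulgA.
have SP x z : x \in P -> z \in S -> (x^-1 * z)%g \in S.
  by move=> Px Sz; rewrite groupM // groupV (subsetP sPS).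
have reprP : mx_repr P (fun x => lrmul_mx (map_perm_mx (mulg x^-1%g)) (V x)).
  split=> [|x y Px Py].
    rewrite (eq_map_perm_mx (b := id)) ?map_perm_mx1 ?repr_mx1 ?lrmul_mx1 //.
    by move=> z _; rewrite invg1 mul1g.
  rewrite lrmul_mxM repr_mxM // map_perm_mxM; last by move=> z; apply: SP.
  by congr (lrmul_mx _ _); apply: eq_map_perm_mx => z _ /=; rewrite invMg mulgA.
pose rS := MxRepresentation reprS; pose rP := MxRepresentation reprP.
have ee := avg_mx_idem rP (subxx P).
have cSe : {in S, forall x, avg_mx rP P *m rS x = rS x *m avg_mx rP P}.
  move=> x Sx; rewrite -scalemxAl -scalemxAr; congr (_ *: _).
  rewrite mulmx_suml mulmx_sumr; apply: eq_bigr => y Py /=.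
  rewrite !lrmul_mxM mul1mx mulmx1 !map_perm_mxM; last 2 first.
  - by move=> z Sz; rewrite groupM.
  - by move=> z; apply: SP.
  by congr (lrmul_mx _ _); apply: eq_map_perm_mx => z _ /=; rewrite mulgA.
apply: eq_rchar (rchar_idem ee cSe) => x Sx.
rewrite -scalemxAl mxtraceZ /ind_char; congr (_ * _).
rewrite mulmx_suml raddf_sum /=.
transitivity (\sum_(y in P) \sum_(s in S) ((x ^ s^-1)%g == y)%:R * chi y).
  apply: eq_bigr => y Py; rewrite lrmul_mxM mulmx1 trace_lrmul VE // -mulr_suml.
  rewrite map_perm_mxM; last by move=> z; apply: SP.
  rewrite trace_map_perm; congr (_ * _); apply: eq_bigr => s Ss /=.
  congr ((nat_of_bool _)%:R); apply/eqP/eqP=> [e|<-].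
    by rewrite conjgE invgK; apply: (mulgI y^-1%g); rewrite !mulgA e mulgV mulVg.
  by rewrite conjgE invgK !invMg invgK !mulgKV.
rewrite exchange_big (reindex_inj invg_inj) /= big_mkcondr /=.
apply: eq_big => [s|s Ss]; first by rewrite groupV.
rewrite groupV in Ss; rewrite invgK; case: ifP => [Pxs | P'xs].
  rewrite (bigD1 _ Pxs) /= eqxx mul1r big1 ?addr0 // => y /andP[_].
  by rewrite eq_sym => /negPf->; rewrite mul0r.
rewrite big1 // => y Py; case: eqP => [xsy|]; last by rewrite mul0r.
by rewrite xsy Py in P'xs.
Qed.

Lemma vchar_ind (P : {group gT}) chi :
  P \subset S -> vchar P chi -> vchar S (ind_char P chi).
Proof.
move=> sPS /vcharP[c1 [c2 [rc1 rc2 cE]]].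
apply: eq_vchar (vcharB (rchar_vchar (rchar_ind sPS rc1))
                        (rchar_vchar (rchar_ind sPS rc2))) => x Sx.
rewrite /ind_char -mulrBr -sumrB; congr (_ * _).
by apply: eq_bigr => s /andP[_ Pxs]; rewrite cE.
Qed.

(** Mackey's formula, with a sum over S to avoid representatives of double
    cosets. *)
Lemma fixdim_ind (P H : {group gT}) (chi : gT -> R) :
  H \subset S ->
  fixdim (ind_char P chi) H =
  #|P|%:R^-1 * \sum_(s in S)
    (#|H :^ s :&: P|%g%:R / #|H|%:R) * fixdim chi (H :^ s :&: P)%G.
Proof.
move=> sHS; rewrite /fixdim /ind_char -mulr_sumr mulrCA; congr (_ * _).
rewrite mulr_sumr (eq_bigr (fun x => \sum_(s in S | (x ^ s)%g \in P)
   (#|H|%:R^-1 * chi (x ^ s)%g))); last by move=> x _; rewrite mulr_sumr.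
rewrite (exchange_big_dep (mem S)) /=; last by move=> x s _ /andP[].
apply: eq_bigr => s Ss; rewrite [RHS]mulrACA mulfV ?natrG_neq0 // mul1r.
rewrite -mulr_sumr; congr (_ * _).
rewrite [in RHS](reindex_inj (conjg_inj s)); apply: eq_bigl => x.
by rewrite inE memJ_conjg Ss.
Qed.

End Induction.

(** Equality of characters gives an isomorphism, so that nothing has to be added
    to the two sides of the Grothendieck equality. *)
Lemma vchar_F_stable (gT : finGroupType) (S : {group gT}) (F : fusion_system S)
    (X : virtual_repr R S) chi :
    {in S, forall x, chi x = \tr (vpos X x) - \tr (vneg X x)} ->
    (forall P f, F P S f -> {in P, forall x, chi (f x) = chi x}) ->
  F_stable F X.
Proof.
move=> XE Fchi P f sPS Ff; exists (grepr0); apply: rsim_trace => x Px /=.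
have [_ _ /subsetP sfPS] := fs_inj Ff.
have Sx : x \in S by apply: subsetP Px.
have Sfx : f x \in S by rewrite sfPS ?imset_f.
have := Fchi P f Ff x Px; rewrite !XE //.
move/eqP; rewrite subr_eq => /eqP eqX; rewrite !mxtrace_block eqX.
by congr (_ + _); rewrite addrAC subrK.
Qed.

End Functoriality.

(** * Rotations of the plane *)

Section Rotations.

Variable R : realType.

Let J : 'M[R]_2 :=
  \matrix_(i, j) (if i == j then 0 else if i == 0 then 1 else -1).
Let refl : 'M[R]_2 := \matrix_(i, j) (if i == j then (-1) ^+ i else 0).
Let rot (t : R) : 'M[R]_2 := (cos t)%:M + sin t *: J.

Let eq_mx2 (M N : 'M[R]_2) :
    M 0 0 = N 0 0 -> M 0 1 = N 0 1 -> M 1 0 = N 1 0 -> M 1 1 = N 1 1 -> M = N.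
Proof.
move=> e00 e01 e10 e11; apply/matrixP=> i j.
have E (k : 'I_2) : k = 0 \/ k = 1.
  by case: k => [[|[|k]] ltk] //; [left | right]; apply: val_inj.
by case: (E i) (E j) => -> [] ->.
Qed.

Let mul2E (M N : 'M[R]_2) i j : (M * N) i j = M i 0 * N 0 j + M i 1 * N 1 j.
Proof.
have e1 : lift ord0 ord0 = 1 :> 'I_2 by apply: val_inj.
by rewrite mxE !big_ord_recl big_ord0 addr0 e1.
Qed.

Let reflK : refl * refl = 1.
Proof. by apply: eq_mx2; rewrite mul2E !mxE /=; ring. Qed.

Let rotD t u : rot (t + u) = rot t * rot u.
Proof. by apply: eq_mx2; rewrite mul2E !mxE /= cosD sinD; ring. Qed.

Let rot0 : rot 0 = 1.
Proof. by apply: eq_mx2; rewrite !mxE /= cos0 sin0; ring. Qed.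

Let rotX t k : rot t ^+ k = rot (t *+ k).
Proof. by elim: k => [|k IHk]; rewrite ?rot0 // exprS IHk mulrS rotD. Qed.

Let refl_rot t : refl * rot t * refl = rot (- t).
Proof. by apply: eq_mx2; rewrite !mul2E !mxE /= cosN sinN; ring. Qed.

Let tr_rot_refl t : \tr (rot t * refl) = 0.
Proof.
by rewrite /mxtrace !big_ord_recl big_ord0 !mul2E !mxE /=; ring.
Qed.

Let rot_fix t m (M : 'M_(m, 2)) : cos t != 1 -> M *m rot t = M -> M = 0.
Proof.
move=> cos_neq1 Mt.
have : M *m ((rot t - 1) * (rot (- t) - 1)) = 0.
  by rewrite mulmxA (mulmxBr M) Mt mulmx1 subrr mul0mx.
have -> : (rot t - 1) * (rot (- t) - 1) = (2 - 2 * cos t)%:M.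
  have e : cos t ^+ 2 + sin t ^+ 2 + 1 - 2 * cos t = 2 - 2 * cos t.
    by rewrite cos2Dsin2.
  by apply: eq_mx2; rewrite -e mul2E !mxE /= cosN sinN; ring.
rewrite mul_mx_scalar => /eqP; rewrite scaler_eq0 => /orP[|/eqP //].
by rewrite -{1}[2]mulr1 -mulrBr mulf_eq0 pnatr_eq0 /= subr_eq0 eq_sym (negPf cos_neq1).
Qed.

Let cos_rational_neq1 n k : (0 < n)%N -> ~~ (n %| k)%N ->
  cos (pi *+ 2 / n%:R *+ k : R) != 1.
Proof.
move=> n_gt0; rewrite [in X in _ -> X](divn_eq k n) => ndvd.
have r_gt0 : (0 < k %% n)%N by rewrite lt0n.
have ltrn := ltn_pmod k n_gt0; set r := (k %% n)%N in r_gt0 ltrn *.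
have nn0 : n%:R != 0 :> R by rewrite pnatr_eq0 -lt0n.
pose t : R := pi * (r%:R / n%:R).
have -> : pi *+ 2 / n%:R *+ (k %/ n * n + r) = t *+ 2 + pi *+ 2 *+ (k %/ n).
  rewrite mulrnDr addrC; congr (_ + _).
    by rewrite /t -[_ *+ r]mulr_natr; ring.
  by rewrite mulnC mulrnA -[_ *+ n]mulr_natr mulfVK.
rewrite periodicn; last exact: cosD2pi.
have sin_t : 0 < sin t.
  apply: sin_gt0_pi; rewrite mulr_gt0 ?pi_gt0 ?divr_gt0 ?ltr0n //=.
  by rewrite gtr_pMr ?pi_gt0 // ltr_pdivrMr ?ltr0n // mul1r ltr_nat.
rewrite cos_mulr2n cos2sin2 lt_eqF //.
have : 0 < sin t ^+ 2 by rewrite exprn_gt0.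
by set s := sin t ^+ 2 => s_gt0; lra.
Qed.

(** The matrix A is the rotation by 2 pi / n. A power of A that is not the
    identity fixes no nonzero vector, because 1 is the cosine of multiples of
    2 pi only. *)
Lemma rotation_reflection n : (0 < n)%N ->
  exists A B : 'M[R]_2,
    [/\ A ^+ n = 1, B * B = 1, forall k, B * A ^+ k * B * A ^+ k = 1,
        forall k m (M : 'M_(m, 2)), ~~ (n %| k)%N -> M *m A ^+ k = M -> M = 0
      & forall k, \tr (A ^+ k * B) = 0].
Proof.
move=> n_gt0; exists (rot (pi *+ 2 / n%:R)), refl; split=> //.
- have nn0 : n%:R != 0 :> R by rewrite pnatr_eq0 -lt0n.
  rewrite rotX -[_ *+ n]mulr_natr mulfVK //.
  by apply: eq_mx2; rewrite !mxE /= cos2pi sin2pi; ring.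
- by move=> k; rewrite rotX refl_rot -rotD addNr rot0.
- by move=> k m M ndvd; rewrite rotX; apply: rot_fix; apply: cos_rational_neq1.
by move=> k; rewrite rotX tr_rot_refl.
Qed.

Section CyclicGroup.

Variables (gT : finGroupType) (x : gT).
Local Notation X := <[x]>%g.

(* The logarithm of y to the base x; the value 0 off X is a default. *)
Let lg (y : gT) : nat := odflt 0%N (omap val [pick i : 'I_#[x] | x ^+ i == y]%g).

Let lgK y : y \in X -> (x ^+ lg y)%g = y.
Proof.
case/cyclePmin=> i lti ->; rewrite /lg; case: pickP => [j /eqP //|].
by move/(_ (Ordinal lti)); rewrite eqxx.
Qed.

Let pow_lg (M : 'M[R]_2) k : M ^+ #[x]%g = 1 -> M ^+ lg (x ^+ k)%g = M ^+ k.
Proof.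
move=> Mn; have /eqP := lgK (mem_cycle x k).
rewrite eq_expg_mod_order => /eqP emod.
by rewrite -(expr_mod k Mn) -emod expr_mod.
Qed.

Let pow_lgM (M : 'M[R]_2) : M ^+ #[x]%g = 1 ->
  {in X &, forall y z, M ^+ lg (y * z)%g = M ^+ lg y * M ^+ lg z}.
Proof.
move=> Mn _ _ /cycleP[i ->] /cycleP[j ->].
by rewrite -expgD !pow_lg // exprD.
Qed.

(** The generator x acts on the plane by a rotation of its own order, so that the
    action is free away from the origin. If y inverts X and has order 2, a
    reflection extends this to the dihedral group S, and reflections have trace
    zero. *)
Lemma rotation_char : exists chi : gT -> R,
  [/\ rchar X chi, chi 1%g = 2, {in X, forall y, chi y^-1%g = chi y},
      forall H : {group gT}, H \subset X -> H :!=: 1%g -> fixdim chi H = 0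
    & forall (S : {group gT}) y, S \subset (X :|: X :* y)%g -> X \subset S ->
        y \in S -> y \notin X -> (y * y = 1)%g ->
        {in X, forall u, u ^ y = u^-1}%g ->
      rchar S (fun s => if s \in X then chi s else 0)].
Proof.
have [A [B [An BB BABA Afix trAB]]] := rotation_reflection (order_gt0 x).
have rX : mx_repr X (fun y => A ^+ lg y).
  split=> [|y z Xy Xz]; last exact: pow_lgM.
  by rewrite -(expg0 x) pow_lg // expr0.
pose V := MxRepresentation rX.
have BA u : u \in X -> B * A ^+ lg u = A ^+ lg u^-1%g * B.
  case/cycleP=> k -> {u}.
  have -> : A ^+ lg (x ^+ k)^-1%g = B * A ^+ k * B.
    apply: (@mulIr _ (A ^+ k)).
      apply/unitrP; exists (B * A ^+ k * B); split=> //.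
      by apply: mulmx1C; apply: BABA.
    rewrite BABA -(pow_lg k An) -pow_lgM ?groupV ?mem_cycle // mulVg.
    by rewrite -(expg0 x) pow_lg // expr0.
  by rewrite -mulrA BB mulr1 pow_lg.
exists (fun y => \tr (A ^+ lg y)); split.
- exact: (rchar_trace V).
- by rewrite -(expg0 x) pow_lg // mxtrace1.
- move=> u Xu /=; rewrite -[A ^+ lg u^-1%g]mulr1 -BB mulrA -BA //.
  transitivity (\tr (B *m (B *m A ^+ lg u))); first exact: mxtrace_mulC.
  by rewrite mulmxA (BB : B *m B = 1) mul1mx.
- move=> H sHX ntH; rewrite /fixdim -(rank_rfix_trace V) //.
  suff -> : rfix_mx V H = 0 by rewrite mxrank0.
  have [h Hh nth] := trivgPn _ ntH.
  have /cycleP[k eqh] := subsetP sHX h Hh.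
  apply: (Afix k); first by rewrite order_dvdn -eqh.
  by have /= := rfix_mx_id V Hh; rewrite eqh pow_lg.
move=> S y /subsetP sSXy sXS Sy X'y yy Vy.
pose rho s := if s \in X then A ^+ lg s else A ^+ lg (s * y)%g * B.
have Xy_y s : s \in S -> s \notin X -> (s * y)%g \in X.
  move=> /sSXy; rewrite inE mem_rcoset => /orP[-> //|].
  by rewrite (_ : y^-1 = y)%g //; apply: (mulgI y); rewrite mulgV.
have yV : (y^-1 = y)%g by apply: (mulgI y); rewrite mulgV.
have rhoS : mx_repr S rho.
  split=> [|g h Sg Sh]; first by rewrite /rho group1; exact: (repr_mx1 V).
  rewrite /rho; case: (boolP (g \in X)) => Xg; case: (boolP (h \in X)) => Xh.
  - by rewrite groupM // pow_lgM.
  - rewrite groupMl // (negPf Xh) -mulgA pow_lgM ?Xy_y //.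
    by rewrite -[_ *m _]/(_ * _) mulrA.
  - rewrite groupMr // (negPf Xg) -[_ *m _]/(_ * _) -mulrA BA // mulrA.
    rewrite -pow_lgM ?Xy_y ?groupV //; congr (_ ^+ lg _ * _).
    by rewrite -mulgA (conjgC h) Vy // mulgA.
  have gh : (g * h = (g * y) * (h * y)^-1)%g.
    rewrite -Vy ?Xy_y // conjgE yV !mulgA -(mulgA g) yy mulg1.
    by rewrite -(mulgA _ y y) yy mulg1.
  rewrite gh groupM ?groupV ?Xy_y // pow_lgM ?groupV ?Xy_y //.
  rewrite -[RHS]/(_ * _) -[RHS]mulrA [in RHS](mulrA B) BA ?Xy_y //.
  by rewrite -mulrA BB mulr1.
exists (Representation (MxRepresentation rhoS)) => s Ss /=; rewrite /rho.
by case: ifP => // _; rewrite trAB.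
Qed.

End CyclicGroup.

End Rotations.

(** * Borel-Smith functions on subgroups and quotients *)

Section BorelSmithFunctors.

Variables (gT : finGroupType) (S : {group gT}) (f : {group gT} -> int).
Hypothesis BSf : Borel_Smith S f.
Local Open Scope group_scope.

Lemma Borel_SmithS (T : {group gT}) : T \subset S -> Borel_Smith T f.
Proof.
move=> sTS; have sNN (L N : {group gT}) : N \subset 'N_T(L) -> N \subset 'N_S(L).
  by move=> sN; apply: subset_trans sN (setSI _ sTS).
split.
- by move=> H x sHT Tx; apply: (BS_class BSf); rewrite ?(subsetP sTS) ?(subset_trans sHT).
- by move=> L H q nLH sHT; apply: (BS_odd BSf) nLH (subset_trans sHT sTS).
- by move=> L H q nLH sHT; apply: (BS_sum BSf) nLH (subset_trans sHT sTS).
- by move=> L H N nLH nHN /sNN; apply: (BS_four BSf).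
by move=> L H N nLH nHN /sNN; apply: (BS_quaternion BSf).
Qed.

Section Quotient.

Variable K : {group gT}.
Hypothesis nKS : K <| S.

Let pre (H : {group coset_of K}) := (coset K @*^-1 H)%G.

Let pre_sub (H : {group coset_of K}) : H \subset S / K -> pre H \subset S.
Proof. by move=> sHS; rewrite -(quotientGK nKS) cosetpreSK. Qed.

Let preK (H : {group coset_of K}) : pre H / K = H. Proof. exact: cosetpreK. Qed.

Let pre_isog (L H : {group coset_of K}) : L <| H -> H / L \isog pre H / pre L.
Proof.
move=> nLH; have : (pre H / K)%G / (pre L / K)%G \isog pre H / pre L.
  by apply: third_isog; rewrite ?normal_cosetpre ?cosetpre_normal ?sub_cosetpre.
have -> : (pre L / K)%G = L by apply: group_inj; apply: preK.
by have -> : (pre H / K)%G = H by apply: group_inj; apply: preK.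
Qed.

Let pre_norm (L N : {group coset_of K}) :
  N \subset 'N_(S / K)(L) -> pre N \subset 'N_S(pre L).
Proof.
by rewrite !subsetI => /andP[sNS nLN]; rewrite pre_sub //= morphpre_norms.
Qed.

Let normalN (L H N : {group coset_of K}) :
  L <| H -> H <| N -> N \subset 'N_(S / K)(L) -> L <| N.
Proof.
case/andP=> sLH _ /andP[sHN _]; rewrite subsetI => /andP[_ nLN].
by rewrite /normal nLN (subset_trans sLH).
Qed.

(** Taking preimages turns a section H / L of S / K into an isomorphic section
    of S, by the third isomorphism theorem. *)
Lemma Borel_Smith_quotient : Borel_Smith (S / K) (fun H => f (coset K @*^-1 H)%G).
Proof.
split.
- move=> H xb sHS /morphimP[x nKx Sx ->].
  rewrite -(BS_class BSf (pre_sub sHS) Sx); congr (f _); apply: group_inj.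
  by rewrite /= -morphpreJ.
- move=> L H q nLH sHS q_pr q_odd isoHL.
  apply: (BS_odd BSf) q_pr q_odd _; rewrite ?cosetpre_normal ?pre_sub //.
  by apply: isog_trans isoHL; rewrite isog_sym pre_isog.
- move=> L H q nLH sHS q_pr isoHL.
  rewrite (BS_sum BSf (L := pre L) (H := pre H) _ _ q_pr); last 3 first.
  - by rewrite cosetpre_normal.
  - exact: pre_sub.
  - by apply: isog_trans isoHL; rewrite isog_sym pre_isog.
  rewrite (reindex_onto pre (fun M => M / K)%G) /=; last first.
    move=> M /and3P[sLM sMH _]; apply: group_inj; rewrite /= quotientGK //.
    rewrite /normal (subset_trans (sub_cosetpre _) sLM).
    by rewrite (subset_trans sMH) // subsetIl.
  apply: eq_bigl => M; rewrite !cosetpreSK.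
  have -> : (pre M / K)%G == M by apply/eqP/group_inj; apply: preK.
  rewrite andbT; case sLM: (L \subset M) => //=; case sMH: (M \subset H) => //=.
  by rewrite (card_isog (pre_isog (normalS sLM sMH nLH))).
- move=> L H N nLH nHN nLN isoHL isoNL.
  apply: (BS_four BSf) (pre_norm nLN) _ _; rewrite ?cosetpre_normal //.
    by apply: isog_trans isoHL; rewrite isog_sym pre_isog.
  apply: isog_trans isoNL; rewrite isog_sym pre_isog //.
  exact: normalN nLH nHN nLN.
move=> L H N nLH nHN nLN isoHL isoNL.
apply: (BS_quaternion BSf) (pre_norm nLN) _ _; rewrite ?cosetpre_normal //.
  by apply: isog_trans isoHL; rewrite isog_sym pre_isog.
apply: isog_trans isoNL; rewrite isog_sym pre_isog //.
exact: normalN nLH nHN nLN.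
Qed.

End Quotient.

End BorelSmithFunctors.

(** * Inflation, and elementary abelian subgroups of rank two *)

Section FixdimMorphism.

Variables (R : realType) (aT rT : finGroupType).

(** The fibres of f on H all have the same cardinality k. *)
Lemma fixdim_morph (H : {group aT}) (fH : {group rT}) (f : aT -> rT)
    (psi : rT -> R) :
    {in H &, {morph f : x y / (x * y)%g}} -> f @: H = fH ->
  fixdim (psi \o f) H = fixdim psi fH.
Proof.
move=> fM fHE; have f1 : f 1%g = 1%g.
  by apply: (mulgI (f 1%g)); rewrite mulg1 -fM // mulg1.
pose k := (\sum_(x in H | f x == 1%g) 1)%N.
have sumE (F : rT -> R) : \sum_(x in H) F (f x) = k%:R * \sum_(y in fH) F y.
  rewrite (partition_big_imset f) fHE mulr_sumr; apply: eq_bigr => y.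
  rewrite -fHE => /imsetP[h Hh ->]; rewrite /k natr_sum mulr_suml /=.
  rewrite (reindex_inj (mulIg h)) /=; apply: eq_big => [x|x].
    rewrite groupMr //; apply: andb_id2l => Hx; rewrite fM //.
    by rewrite -{2}[f h]mul1g (inj_eq (mulIg _)).
  by rewrite mul1r groupMr // => /andP[Hx /eqP fx]; rewrite fx.
have := sumE (fun=> 1); rewrite !sumr_const => cardE.
rewrite /fixdim /= sumE mulrA; congr (_ * _); apply: (mulfI (natrG_neq0 R H)).
rewrite mulrA mulfV ?natrG_neq0 // mul1r cardE -mulrA.
by rewrite mulfV ?mulr1 ?natrG_neq0.
Qed.

End FixdimMorphism.

Definition realizes (R : realType) (gT : finGroupType) (S : {group gT})
    (f : {group gT} -> int) (chi : gT -> R) :=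
  vchar S chi /\ forall H : {group gT}, H \subset S -> fixdim chi H = (f H)%:~R.

Section Steps.

Variables (R : realType) (gT : finGroupType).
Implicit Types (S H K E : {group gT}) (f : {group gT} -> int).
Local Open Scope group_scope.

(** A representation inflated from S / K has the same fixed points for H and for
    H K / K. *)
Lemma inflation_realizes S K f :
    K <| S ->
    (exists psi : coset_of K -> R, realizes (S / K)%G
       (fun M : {group coset_of K} => f (coset K @*^-1 M)%G) psi) ->
  exists chi : gT -> R, realizes S (fun H => f (H <*> K)%G) chi.
Proof.
case/andP=> sKS nKS [psi [vpsi psiE]]; exists (psi \o coset K).
have cosetM H : H \subset S -> {in H &, {morph coset K : x y / x * y}}.
  move=> sHS x y Hx Hy /=.
  by rewrite morphM ?(subsetP nKS) ?(subsetP sHS).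
have imE H : H \subset S -> coset K @: H = H / K.
  by move=> sHS; rewrite /quotient morphimEsub // (subset_trans sHS).
split; first by apply: vchar_morph vpsi; rewrite ?imE //; apply: cosetM.
move=> H sHS; rewrite (fixdim_morph (fH := (H / K)%G)) ?psiE ?quotientS //.
- congr (f _)%:~R%R; apply: group_inj => /=.
  have nKH := subset_trans sHS nKS.
  by rewrite quotientK // joingC norm_joinEr.
- exact: cosetM.
exact: imE.
Qed.

Lemma isog_Zp2 (hT : finGroupType) (E : {group hT}) p :
  prime p -> p.-abelem E -> #|E| = (p ^ 2)%N -> E \isog setX (Zp p) (Zp p).
Proof.
move=> p_pr abelE oE; have p_gt1 := prime_gt1 p_pr.
have oX : #|setX (Zp p) (Zp p)| = (p ^ 2)%N by rewrite cardsX card_Zp // prime_gt0.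
rewrite (isog_abelem_card _ abelE) oX oE eqxx andbT.
apply/abelemP=> //; split.
  apply/centsP=> -[a b] _ [c d] _ /=; congr (_, _); exact: Zp_mulgC.
case=> a b _.
have Zp1 (c : 'Z_p) : c ^+ p == 1.
  by rewrite -order_dvdn (dvdn_trans (order_dvdG (in_setT c))) // cardsT card_ord Zp_cast.
have expE n : (a, b) ^+ n = (a ^+ n, b ^+ n) :> ('Z_p * 'Z_p)%type.
  by elim: n => // n IHn; rewrite !expgS IHn.
by rewrite expE (eqP (Zp1 a)) (eqP (Zp1 b)).
Qed.

(** If H meets E trivially, this is the Borel-Smith condition on H E / H. If H
    contains E, every term of the sum is zero. Otherwise the intersection of H
    and E is one of the lines K of E, and contributes f H - f (H E), whereas
    H K = H E for the other lines. *)
Lemma Borel_Smith_rank2 S E H f p :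
    Borel_Smith S f -> prime p -> p.-abelem E -> #|E| = (p ^ 2)%N ->
    E \subset S -> H \subset S -> H \subset 'C(E) ->
  (f H = f (H <*> E)%G +
    \sum_(K : {group gT} | (K \subset E) && (#|K| == p))
       (f (H <*> K)%G - f (H <*> E)%G))%R.
Proof.
move=> BSf p_pr abelE oE sES sHS cEH.
have nHsub K : K \subset E -> K \subset 'N(H).
  by move=> sKE; rewrite (subset_trans sKE) // cents_norm // centsC.
have HKE K : K \subset E -> (H <*> K = H * K)%g.
  by move=> sKE; rewrite norm_joinEr ?nHsub.
have nHE := nHsub E (subxx E).
have [tiHE | ntHE] := eqVneq (H :&: E) 1.
  rewrite -[LHS](subrK (f (H <*> E)%G)) addrC; congr (_ + _)%R.
  rewrite (BS_sum BSf (L := H) (H := (H <*> E)%G) _ _ p_pr); last 3 first.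
  - by rewrite /normal joing_subl join_subG normG nHE.
  - by rewrite join_subG sHS sES.
  - rewrite /= quotientYidl //.
    apply: isog_trans (isog_Zp2 p_pr abelE oE); rewrite isog_sym.
    exact: quotient_isog.
  rewrite (reindex_onto (fun K => (H <*> K)%G) (fun M => (M :&: E)%G)) /=; last first.
    move=> M /and3P[sHM sME _]; apply: group_inj.
    rewrite /= HKE ?subsetIr //= setIC group_modl // -HKE //.
    exact/setIidPr.
  apply: eq_bigl => K; rewrite joing_subl /=.
  have [sKE | not_sKE] := boolP (K \subset E); last first.
    apply: contraNF not_sKE => /andP[_ /eqP/(congr1 val) /= <-].
    exact: subsetIr.
  have -> : ((H <*> K) :&: E)%G = K.
    apply: group_inj; rewrite /= HKE //= setIC -group_modr // setIC tiHE.
    exact: mul1g.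
  rewrite eqxx andbT genS ?setUS // quotientYidl ?nHsub //=.
  rewrite -(card_isog (quotient_isog (nHsub K sKE) _)) //.
  by apply/trivgP; rewrite -tiHE setIS.
have [sEH | not_sEH] := boolP (E \subset H).
  have HKH K : K \subset E -> (H <*> K)%G = H.
    move=> sKE; apply: group_inj; apply/joing_idPl.
    exact: subset_trans sKE sEH.
  rewrite HKH // big1 ?addr0 // => K /andP[sKE _].
  by rewrite HKH // subrr.
have oHE : #|H :&: E|%g = p.
  have : (#|H :&: E| %| p ^ 2)%N by rewrite -oE cardSg ?subsetIr.
  case/(dvdn_pfactor _ _ p_pr) => [[|[|[|m]]]] // _ oHE.
  - by case/negP: ntHE; rewrite trivg_card1 oHE.
  case/negP: not_sEH; rewrite -oE in oHE; apply/setIidPr/eqP.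
  by rewrite eqEcard subsetIr oHE leqnn.
rewrite (bigD1 (H :&: E)%G) /=; last by rewrite subsetIr oHE eqxx.
rewrite big1 => [|K /andP[/andP[sKE /eqP oK] neqK]]; last first.
  suff -> : (H <*> K)%G = (H <*> E)%G by rewrite subrr.
  apply: group_inj; rewrite /= !HKE //; apply/eqP.
  rewrite eqEsubset mulgS //= -[in X in _ \subset X](mulGid H) -mulgA mulgS //.
  suff <- : (H :&: E) * K = E by rewrite mulSg ?subsetIl.
  apply/eqP; rewrite eqEcard mul_subG ?subsetIr //= TI_cardMg ?oHE ?oK ?oE //.
  have [//|ntI] := eqVneq (H :&: E :&: K) 1.
  have oI : #|H :&: E :&: K|%g = p.
    have := cardSg (subsetIr (H :&: E) K); rewrite oK.
    case/primeP: p_pr => _ dvdp /dvdp /orP[|/eqP //].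
    by rewrite -trivg_card1 (negPf ntI).
  case/negP: neqK; rewrite -val_eqE /= eqEcard oHE oK leqnn andbT.
  rewrite -(_ : H :&: E :&: K = K) ?subsetIl //.
  by apply/eqP; rewrite eqEcard subsetIr oI oK leqnn.
have -> : (H <*> (H :&: E))%G = H.
  by apply: group_inj; apply/joing_idPl; apply: subsetIl.
by rewrite addr0 addrC subrK.
Qed.

End Steps.

(** * Groups with a normal elementary abelian subgroup of rank two *)

Section Cases.

Variables (R : realType) (gT : finGroupType) (p : nat).
Variables (S : {group gT}) (f : {group gT} -> int).
Implicit Types (H K E T M : {group gT}).
Hypotheses (p_pr : prime p) (pS : (p.-group S)%g) (BSf : Borel_Smith S f).
Hypothesis IH : forall T K, T \subset S -> (K <| T)%g -> K :!=: 1%g ->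
  exists chi : gT -> R, realizes T (fun H => f (H <*> K)%G) chi.

Local Open Scope group_scope.

(** As H centralizes E, [Borel_Smith_rank2] writes f as a combination of functions
    H |-> f (H K), inflated from S / K, with K = E or K a line of E; these are
    normal in S. *)
Lemma realizes_central E :
    p.-abelem E -> #|E| = (p ^ 2)%N -> E \subset 'Z(S) ->
  exists chi : gT -> R, realizes S f chi.
Proof.
move=> abelE oE sEZ; have [sES cSE] := subsetIP sEZ.
have p_gt1 := prime_gt1 p_pr.
have central K : K \subset E -> K <| S.
  by move=> sKE; apply: sub_center_normal; apply: subset_trans sKE sEZ.
have /choice[chiK chiKE] K : exists chi : gT -> R,
    (K \subset E) && (#|K| == p) -> realizes S (fun H => f (H <*> K)%G) chi.
  have [/andP[sKE /eqP oK] | //] := boolP ((K \subset E) && (#|K| == p));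
    last by exists (fun=> 0%R).
  have [|chi chiP] := IH (subxx S) (central K sKE); last by exists chi.
  by rewrite trivg_card1 oK; case: (p) p_gt1 => [|[]].
have [|chiE [vchiE chiEE]] := IH (subxx S) (central E (subxx E)).
  by rewrite trivg_card1 oE; case: (p) p_gt1 => [|[]].
exists (fun x => chiE x + \sum_(K : {group gT} | (K \subset E) && (#|K| == p))
                            (chiK K x - chiE x))%R.
split.
  apply: vcharD => //; apply: vchar_sum => K KP; apply: vcharB => //.
  by case: (chiKE K KP).
move=> H sHS; rewrite (Borel_Smith_rank2 BSf p_pr abelE oE sES sHS); last first.
  by rewrite (subset_trans sHS) // centsC.
rewrite fixdimD fixdim_sum rmorphD rmorph_sum chiEE //; congr (_ + _)%R.
apply: eq_bigr => K KP; rewrite fixdimB chiEE // rmorphB.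
by case: (chiKE K KP) => _ ->.
Qed.

Lemma sum_conj_groups (A H : {group gT}) (F : {group gT} -> R) :
  (\sum_(s in A) F (H :^ s)%G =
   #|'N_A(H)|%:R * \sum_(K in [set (H :^ s)%G | s in A]) F K)%R.
Proof.
rewrite (partition_big_imset (fun s => (H :^ s)%G)) /= mulr_sumr.
apply: eq_bigr => _ /imsetP[t At ->]; rewrite -sumr_const mulr_suml.
rewrite (reindex_inj (mulIg t)) /=; apply: eq_big => [s|s].
  rewrite inE groupMr //; apply: andb_id2l => As.
  rewrite -val_eqE /= conjsgM (inj_eq (@conjsg_inj _ t)).
  by apply/eqP/normP.
by rewrite mul1r => /andP[_ /eqP ->].
Qed.

Lemma card_conj_groups (A H : {group gT}) :
  (#|'N_A(H)| * #|[set (H :^ s)%G | s in A]|)%N = #|A|.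
Proof.
apply/eqP; rewrite -(eqr_nat R) natrM.
by have := sum_conj_groups A H (fun=> 1%R); rewrite !sumr_const => <-.
Qed.

(** Let C, of order p, be the central part of E, and let S0 be the centralizer of
    E. The lines of E other than C form one orbit under S, with stabilizer S0.
    For one such line E1, the function H |-> f (H E1) - f (H E) on S0 is known by
    induction, and the character that it induces on S has the dimensions
    f H - f (H C). *)
Section NonCentral.

Variable E : {group gT}.
Hypotheses (abelE : p.-abelem E) (oE : #|E| = (p ^ 2)%N) (nES : E <| S).
Hypothesis ncE : ~~ (E \subset 'Z(S)).

Let C := (E :&: 'Z(S))%G.
Let S0 := 'C_S(E)%G.
Let lines := [set K : {group gT} | (K \subset E) && (#|K| == p)].

Let sES : E \subset S := normal_sub nES.
Let p_gt1 : (1 < p)%N := prime_gt1 p_pr.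

Let oC : #|C| = p.
Proof.
have ntC : C :!=: 1.
  apply: meet_center_nil (pgroup_nil pS) nES _.
  by rewrite trivg_card1 oE; case: (p) p_gt1 => [|[]].
have : (#|C| %| p ^ 2)%N by rewrite -oE cardSg ?subsetIl.
case/(dvdn_pfactor _ _ p_pr) => [[|[|[|m]]]] // _ oC.
- by case/negP: ntC; rewrite trivg_card1 oC.
case/negP: ncE; rewrite -oE in oC; apply/setIidPl/eqP.
by rewrite eqEcard subsetIl oC leqnn.
Qed.

Let sCE : C \subset E := subsetIl _ _.
Let cCS : S \subset 'C(C).
Proof. by rewrite centsC; apply: subset_trans (subsetIr _ _) (subsetIr _ _). Qed.
Let Cline : C \in lines. Proof. by rewrite inE sCE oC eqxx. Qed.

Let card_lines : #|lines| = p.+1.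
Proof.
rewrite -(card_p1Elem_p2Elem (_ : E \in 'E_p^2(E))).
  by rewrite p1ElemE //; apply: eq_card => K; rewrite !inE.
by rewrite !inE subxx abelE oE pfactorK.
Qed.

Let nS0S : S0 <| S.
Proof.
rewrite /S0 /normal subsetIl normsI ?normG //.
by rewrite (subset_trans (normal_norm nES)) ?cent_norm.
Qed.

Let sES0 : E \subset S0.
Proof. by rewrite subsetI sES; exact: abelem_abelian abelE. Qed.

Let line_gen K : K \in lines -> K != C -> C * K = E.
Proof.
rewrite inE => /andP[sKE /eqP oK] neqKC; apply/eqP.
rewrite eqEcard mul_subG ?sCE //= TI_cardMg ?oC ?oK ?oE //.
apply: prime_TIg; first by rewrite oC.
apply: contra neqKC => sCK; apply/eqP/esym/group_inj/eqP.
by rewrite eqEcard sCK oC oK leqnn.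
Qed.

Let commES : [~: E, S] \subset C.
Proof.
have nCE := subset_trans sES (cents_norm cCS).
rewrite -quotient_cents2 ?(cents_norm cCS) //.
have oEC : #|E / C| = p by rewrite card_quotient // -divgS // oE oC expnS expn1 mulKn ?prime_gt0.
have pSC : p.-group (S / C) by rewrite quotient_pgroup.
have nEC := quotient_normal C nES.
have ntEC : E / C :&: 'Z(S / C) != 1.
  apply: meet_center_nil (pgroup_nil pSC) nEC _.
  by rewrite trivg_card1 oEC; case: (p) p_gt1 => [|[]].
apply: subset_trans (prime_meetG _ ntEC) (subsetIr _ _).
by rewrite oEC.
Qed.


Let S0_lt_S : (p <= #|S : S0|)%N.
Proof.
have : (#|S : S0| %| #|S|)%N by apply: dvdn_indexg.
have [n ->] := p_natP pS; case/(dvdn_pfactor _ _ p_pr) => [[|m]] _ iS.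
  have sSS0 : S \subset S0 by rewrite -indexg_eq1 iS.
  by case/negP: ncE; rewrite subsetI sES centsC (subset_trans sSS0) ?subsetIr.
by rewrite iS expnS leq_pmulr // expn_gt0 prime_gt0.
Qed.

Section Line.

Variable E1 : {group gT}.
Hypotheses (lineE1 : E1 \in lines) (neqE1C : E1 != C).

Let norm_line : 'N_S(E1) = S0.
Proof.
move: (lineE1); rewrite inE => /andP[sE1E /eqP oE1].
apply/eqP; rewrite eqEsubset; apply/andP; split; last first.
  rewrite subsetI subsetIl cents_norm //; apply: subset_trans (subsetIr _ _) _.
  exact: centS.
rewrite subsetI subsetIl /= -(line_gen lineE1 neqE1C) centM subsetI.
rewrite (subset_trans (subsetIl _ _) cCS) /=.
have pP : p.-group 'N_S(E1) := pgroupS (subsetIl _ _) pS.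
have nE1P : E1 <| 'N_S(E1) by rewrite normalSG // (subset_trans sE1E).
have ntZ : E1 :&: 'Z('N_S(E1)) != 1.
  apply: meet_center_nil (pgroup_nil pP) nE1P _.
  by rewrite trivg_card1 oE1; case: (p) p_gt1 => [|[]].
have sE1Z : E1 \subset 'Z('N_S(E1)) by rewrite prime_meetG ?oE1.
by rewrite centsC (subset_trans sE1Z) ?subsetIr.
Qed.

Let orbit_line : [set (E1 :^ s)%G | s in S] = lines :\ C.
Proof.
apply/eqP; rewrite eqEcard; apply/andP; split.
  apply/subsetP=> _ /imsetP[s Ss ->]; move: lineE1; rewrite !inE => /andP[sE1E /eqP oE1].
  rewrite cardJg oE1 eqxx andbT; apply/andP; split.
    apply: contra neqE1C => /eqP/(congr1 val)/= E1s; apply/eqP/group_inj.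
    apply: (@conjsg_inj _ s); rewrite E1s; apply/esym/normP.
    by apply: (subsetP (cents_norm cCS)).
  by rewrite -(normsP (normal_norm nES) s Ss) conjSg.
have := card_conj_groups S E1; rewrite norm_line -(Lagrange (normal_sub nS0S)).
move/eqP; rewrite eqn_pmul2l ?cardG_gt0 // => /eqP ->.
have := cardsD1 C lines; rewrite Cline card_lines add1n => -[<-].
exact: S0_lt_S.
Qed.

Lemma sum_lines F : (\sum_(s in S) F (E1 :^ s)%G =
  #|S0|%:R * \sum_(K in lines :\ C) (F K : R))%R.
Proof. by rewrite sum_conj_groups norm_line orbit_line. Qed.

(** The sum over S that computes the dimension runs over the S-orbit of E1, that
    is over all the lines of E but C; [Borel_Smith_rank2] for the intersection of
    H with S0 evaluates it. *)
Lemma fixdim_noncentral (g : gT -> R) (H : {group gT}) :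
    (forall K, K \subset S0 ->
       fixdim g K = (f (K <*> E1)%G)%:~R - (f (K <*> E)%G)%:~R)%R ->
    H \subset S ->
  fixdim (ind_char S S0 g) H =
    (#|H :&: S0|%:R / #|H|%:R *
     ((f (H :&: S0)%G)%:~R - (f ((H :&: S0) <*> C)%G)%:~R))%R.
Proof.
move=> gE sHS; rewrite fixdim_ind //; set H0 := (H :&: S0)%G.
have sH0S0 : H0 \subset S0 by apply: subsetIr.
have sH0S : H0 \subset S by apply: subset_trans (subsetIl _ _) sHS.
have HsE s : s \in S -> (H :^ s :&: S0)%G = (H0 :^ s)%G.
  move=> Ss; apply: group_inj; rewrite /= conjIg; congr (_ :&: _).
  by apply/esym/normP; apply: (subsetP (normal_norm nS0S)).
have joinJ (K : {group gT}) s : K \subset S -> s \in S ->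
    f ((H0 :^ s) <*> K)%G = f (H0 <*> (K :^ s^-1))%G.
  move=> sKS Ss; rewrite -(BS_class BSf (H := (H0 <*> (K :^ s^-1))%G) _ Ss).
    congr (f _); apply: group_inj.
    by rewrite /= joingE -[in RHS]genJ conjUg -conjsgM mulVg conjsg1.
  by rewrite join_subG sH0S -(normsP (normG S) s^-1) ?groupV // conjSg.
have sE1S : E1 \subset S.
  by move: lineE1; rewrite inE => /andP[/subset_trans-> //].
have term s : s \in S -> fixdim g (H :^ s :&: S0)%G =
    ((f (H0 <*> (E1 :^ s^-1))%G)%:~R - (f (H0 <*> E)%G)%:~R)%R.
  move=> Ss; rewrite HsE // gE.
    rewrite !joinJ //; congr (_ - intmul _ _)%R; congr (f _).
    by apply: group_inj; rewrite /= (normsP (normal_norm nES)) ?groupV.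
  by rewrite -(normsP (normal_norm nS0S) s Ss) conjSg.
rewrite (eq_bigr (fun s => (#|H0|%:R / #|H|%:R) *
  ((f (H0 <*> (E1 :^ s^-1))%G)%:~R - (f (H0 <*> E)%G)%:~R)))%R; last first.
  move=> s Ss; rewrite term //; congr (_%:R / _ * _)%R.
  by have := congr1 (fun K : {group gT} => #|K|) (HsE s Ss); rewrite cardJg.
rewrite -mulr_sumr mulrCA; congr (_ * _)%R.
rewrite (reindex_inj invg_inj) /=.
rewrite (eq_bigl (mem S)); last by move=> s; rewrite /= groupV.
rewrite (eq_bigr (fun s => (fun K => (f (H0 <*> K)%G)%:~R -
    (f (H0 <*> E)%G)%:~R) (E1 :^ s)%G))%R; last by move=> s _ /=; rewrite invgK.
rewrite (sum_lines (fun K => (f (H0 <*> K)%G)%:~R - (f (H0 <*> E)%G)%:~R)%R).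
rewrite mulKf ?natrG_neq0 //.
have cH0E : H0 \subset 'C(E) by apply: subset_trans sH0S0 (subsetIr _ _).
rewrite (Borel_Smith_rank2 BSf p_pr abelE oE sES sH0S cH0E).
have eqlines K : (K \subset E) && (#|K| == p) = (K \in lines) by rewrite inE.
rewrite (eq_bigl _ _ eqlines) [in RHS](big_setD1 C) // intrD.
rewrite [in RHS]intrD rmorphB rmorph_sum.
under [in RHS]eq_bigr do rewrite rmorphB.
by ring.
Qed.

Lemma index_cent_line : #|S : S0| = p.
Proof.
apply: succn_inj; rewrite -card_lines (cardsD1 C) Cline add1n -orbit_line.
congr _.+1; apply/eqP; have := card_conj_groups S E1.
by rewrite norm_line -(Lagrange (normal_sub nS0S)) => /eqP; rewrite eqn_pmul2l // eq_sym.
Qed.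

End Line.

Let noncentral_line : exists2 E1, E1 \in lines & E1 != C.
Proof.
have : (0 < #|lines :\ C|)%N.
  have := cardsD1 C lines; rewrite Cline card_lines add1n => -[<-].
  exact: prime_gt0.
by case/card_gt0P=> E1; rewrite in_setD1 => /andP[]; exists E1.
Qed.

Section Outside.

Variable H : {group gT}.
Hypotheses (sHS : H \subset S) (not_sHS0 : ~~ (H \subset S0)) (tiCH : C :&: H = 1).

Let H0 := (H :&: S0)%G.
Let HC := (H <*> C)%G.
Let sH0H : H0 \subset H := subsetIl _ _.
Let cHC : H \subset 'C(C) := subset_trans sHS cCS.

Let norm_outside : 'N_E(H) = C.
Proof.
have sCN : C \subset 'N_E(H).
  by rewrite subsetI sCE cents_norm // centsC.
have sNC : 'N_E(H) \subset 'C(H).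
  apply/commG1P/trivgP; rewrite -tiCH subsetI; apply/andP; split.
    by apply: subset_trans commES; apply: commgSS; rewrite ?subsetIl.
  by rewrite commg_subr subsetIr.
have : (#|'N_E(H)| %| p ^ 2)%N by rewrite -oE cardSg ?subsetIl.
case/(dvdn_pfactor _ _ p_pr) => [[|[|[|m]]]] // _ oN.
- by have := subset_leq_card sCN; rewrite oN oC leqNgt p_gt1.
- by apply/esym/eqP; rewrite eqEcard sCN oN oC expn1 leqnn.
case/negP: not_sHS0; rewrite subsetI sHS centsC.
apply: subset_trans sNC; rewrite -oE in oN.
have -> : 'N_E(H) = E :> {set gT}; last exact: subxx.
by apply/eqP; rewrite eqEcard subsetIl oN leqnn.
Qed.

Lemma index_outside : #|H : H0| = p.
Proof.
have [E1 E1l E1C] := noncentral_line.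
have nS0H := subset_trans sHS (normal_norm nS0S).
have : (#|H / S0| %| #|S / S0|)%N by rewrite cardSg ?quotientS.
rewrite !card_quotient ?(normal_norm nS0S) // (index_cent_line E1l E1C).
rewrite indexgI /=; case/primeP: (p_pr) => _ dvdp /dvdp /orP[|/eqP //].
by rewrite indexg_eq1 (negPf not_sHS0).
Qed.

Let nH0HC : H0 <| HC.
Proof.
rewrite /normal (subset_trans sH0H (joing_subl _ _)) join_subG.
rewrite normsI ?normG ?(subset_trans sHS (normal_norm nS0S)) //=.
by rewrite cents_norm // centsC (subset_trans sH0H).
Qed.

Let HCE : HC = H * C :> {set gT}.
Proof. by rewrite /= norm_joinEr // cents_norm // centsC. Qed.

Let quoHC_cprod : (H / H0) \* (C / H0) = HC / H0.
Proof.
rewrite HCE quotientMl ?(subset_trans _ (normal_norm nH0HC)) ?joing_subl //.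
by rewrite cprodE // quotient_cents // centsC.
Qed.

Let abelHC : p.-abelem (HC / H0).
Proof.
rewrite (cprod_abelem _ quoHC_cprod) prime_abelem //=; last first.
  rewrite card_quotient ?index_outside //.
  by rewrite (subset_trans _ (normal_norm nH0HC)) ?joing_subl.
by rewrite quotient_abelem // (abelemS sCE).
Qed.

Let oHC : #|HC / H0| = (p ^ 2)%N.
Proof.
rewrite card_quotient ?normal_norm // -divgS ?normal_sub //.
rewrite HCE TI_cardMg; last by rewrite setIC.
by rewrite oC -(Lagrange sH0H) index_outside -mulnA mulKn.
Qed.

Let intermediate :=
  [set M : {group gT} | [&& H0 \subset M, M \subset HC & #|M / H0| == p]].

Let H0C_inter : (H0 <*> C)%G \in intermediate.
Proof.
rewrite inE joing_subl genS ?setSU //=.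
rewrite quotientYidl ?(subset_trans _ (normal_norm nH0HC)) ?joing_subr //.
rewrite -(card_isog (quotient_isog _ _)) ?oC //.
  by rewrite (subset_trans _ (normal_norm nH0HC)) ?joing_subr.
apply/eqP; rewrite -subG1 -tiCH subsetI subsetIr.
exact: subset_trans (subsetIl _ _) sH0H.
Qed.

Let conj_inter : [set (H :^ e)%G | e in E] = intermediate :\ (H0 <*> C)%G.
Proof.
apply/eqP; rewrite eqEcard; apply/andP; split.
  apply/subsetP=> _ /imsetP[e Ee ->].
  have He0 : H0 :^ e = H0.
    apply/normP; apply: (subsetP (cents_norm _)) e Ee.
    by rewrite centsC (subset_trans (subsetIr _ _)) ?subsetIr.
  have Se := subsetP sES e Ee.
  have sH0He : H0 \subset H :^ e by rewrite -[gval H0]He0 conjSg.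
  have sHeC : H :^ e \subset HC.
    apply/subsetP=> _ /imsetP[h Hh ->].
    rewrite conjg_mulR; apply: groupM; first by rewrite (subsetP (joing_subl _ _)).
    apply: (subsetP (joing_subr _ _)); apply: (subsetP commES).
    by rewrite commGC mem_commg // (subsetP sHS).
  rewrite !inE sH0He sHeC /=; apply/andP; split.
  - apply/eqP=> /(congr1 val)/= HeC.
    have : C \subset H :^ e by rewrite HeC joing_subr.
    have -> : C :=: C :^ e.
      by apply/esym/normP; apply: (subsetP (cents_norm cCS)).
    rewrite conjSg => sCH; move: tiCH; rewrite (setIidPl sCH) => C1.
    by move: oC p_gt1; rewrite C1 cards1 => <-.
  rewrite card_quotient ?(subset_trans sHeC) ?normal_norm //.
  by rewrite -divgS // cardJg divgS // index_outside.
have : (#|intermediate| <= p.+1)%N.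
  rewrite -(card_p1Elem_p2Elem (_ : (HC / H0)%G \in 'E_p^2(HC / H0))); last first.
    by rewrite !inE subxx abelHC oHC pfactorK.
  rewrite -(card_in_imset (f := fun M => (M / H0)%G) (D := intermediate)).
    apply/subset_leq_card/subsetP=> _ /imsetP[M + ->].
    rewrite inE p1ElemE // => /and3P[sH0M sMH oM].
    by rewrite !inE quotientS.
  move=> M M'; rewrite !inE => /and3P[sM sMH _] /and3P[sM' sMH' _] /(congr1 val)/= eqM.
  apply: group_inj.
  rewrite -(quotientGK (normalS sM sMH nH0HC)) eqM.
  by rewrite (quotientGK (normalS sM' sMH' nH0HC)).
rewrite (cardsD1 (H0 <*> C)%G) H0C_inter add1n ltnS => /leq_trans-> //.
have := card_conj_groups E H; rewrite norm_outside oC oE expnS expn1.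
by move/eqP; rewrite eqn_pmul2l ?prime_gt0 // => /eqP->.
Qed.

(** This is the Borel-Smith condition on H C / H0, which is elementary abelian of
    rank 2: its lines are H0 C / H0 and the E-conjugates of H / H0, of which there
    are p. *)
Lemma noncentral_outside :
  (f H0 - f (H0 <*> C)%G = (f H - f HC) *+ p)%R.
Proof.
have sHCS : HC \subset S by rewrite join_subG sHS (subset_trans sCE).
have := BS_sum BSf nH0HC sHCS p_pr (isog_Zp2 p_pr abelHC oHC).
have -> : (\sum_(K : {group gT} | [&& H0 \subset K, K \subset HC & #|(K / H0)%g| == p])
            (f K - f HC) = \sum_(K in intermediate) (f K - f HC))%R.
  by apply: eq_bigl => K; rewrite inE.
rewrite (big_setD1 _ H0C_inter) /= -conj_inter.
rewrite (eq_bigr (fun=> f H - f HC)%R); last first.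
  move=> _ /imsetP[e Ee ->]; rewrite (BS_class BSf) //.
  exact: subsetP sES e Ee.
rewrite sumr_const.
have -> : #|[set (H :^ e)%G | e in E]| = p.
  have := card_conj_groups E H; rewrite norm_outside oC oE expnS expn1.
  by move/eqP; rewrite eqn_pmul2l ?prime_gt0 // => /eqP.
by move=> e; apply: (addrI (f (H0 <*> C)%G - f HC)%R); rewrite -e; ring.
Qed.

End Outside.

Lemma realizes_noncentral : exists chi : gT -> R, realizes S f chi.
Proof.
have nt1 (K : {group gT}) : #|K| = p -> K :!=: 1.
  by move=> oK; rewrite trivg_card1 oK; case: (p) p_gt1 => [|[]].
have [E1 E1l E1C] := noncentral_line.
have /andP[sE1E /eqP oE1] : (E1 \subset E) && (#|E1| == p).
  by move: E1l; rewrite inE.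
have nCS : C <| S.
  by apply: sub_center_normal; apply: subsetIr.
have nES0 K : K \subset E -> K <| S0.
  move=> sKE; rewrite /normal (subset_trans sKE) // cents_norm //.
  by rewrite (subset_trans (subsetIr _ _)) // centS.
have sS0S := normal_sub nS0S.
have ntE : E :!=: 1 by rewrite trivg_card1 oE; case: (p) p_gt1 => [|[]].
have [chiC [vC chiCE]] := IH (subxx S) nCS (nt1 C oC).
have [chi1 [v1 chi1E]] := IH sS0S (nES0 E1 sE1E) (nt1 E1 oE1).
have [chi2 [v2 chi2E]] := IH sS0S (nES0 E (subxx E)) ntE.
exists (fun x => chiC x + ind_char S S0 (fun y => chi1 y - chi2 y) x)%R.
split; first by apply: vcharD => //; apply: vchar_ind => //; apply: vcharB.
move=> H sHS; rewrite fixdimD chiCE // (fixdim_noncentral E1l E1C) //; last first.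
  by move=> K sKS0; rewrite fixdimB chi1E ?chi2E.
(* Inside S0 the induced character has the required dimension by
   fixdim_noncentral. Outside, both sides vanish if C is contained in H, and
   noncentral_outside compares H with its intersection with S0 otherwise. *)
have [sHS0 | not_sHS0] := boolP (H \subset S0).
  have -> : (H :&: S0)%G = H by apply: group_inj; apply/setIidPl.
  by rewrite (setIidPl sHS0) mulfV ?natrG_neq0 // mul1r addrC subrK.
have [sCH | not_sCH] := boolP (C \subset H).
  have -> : (H <*> C)%G = H by apply: group_inj; apply/joing_idPl.
  have -> : ((H :&: S0) <*> C)%G = (H :&: S0)%G.
    apply: group_inj; apply/joing_idPl; rewrite subsetI sCH.
    exact: subset_trans sCE sES0.
  by rewrite subrr mulr0 addr0.
have tiCH : C :&: H = 1 by rewrite prime_TIg ?oC.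
rewrite -rmorphB (noncentral_outside sHS not_sHS0 tiCH).
have <- := Lagrange (subsetIl H S0 : (H :&: S0)%G \subset H).
rewrite (index_outside sHS not_sHS0) natrM rmorphMn rmorphB /=.
have p0 : (p%:R != 0 :> R)%R by rewrite pnatr_eq0 -lt0n prime_gt0.
have h0 := natrG_neq0 R (H :&: S0)%G.
by rewrite -[(_ *+ p)%R]mulr_natr; field; rewrite p0.
Qed.

End NonCentral.
End Cases.

(** * Cyclic groups *)

Section RankOneGeneralities.

Variables (gT : finGroupType) (p : nat).
Implicit Types (S H X C : {group gT}).
Local Open Scope group_scope.

(** The subgroup of X generated by the elements of order p has rank at least 2
    and is normal in S, hence contains such a subgroup E. *)
Lemma normal_rank2_exists S X :
    prime p -> p.-group S -> X <| S -> abelian X -> ~~ cyclic X ->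
  exists E : {group gT}, [/\ E <| S, p.-abelem E & #|E| = (p ^ 2)%N].
Proof.
move=> p_pr pS nXS abX ncX; have pX := pgroupS (normal_sub nXS) pS.
have nOS : 'Ohm_1(X) <| S := gFnormal_trans _ nXS.
have rO : (2 <= logn p #|'Ohm_1(X)|)%N.
  by rewrite -p_rank_abelian // -rank_pgroup // ltnNge -abelian_rank1_cyclic.
have [E [sEO nES oE]] := normal_pgroup pS nOS rO.
by exists E; split=> //; apply: abelemS sEO (Ohm1_abelem pX abX).
Qed.

Lemma cyclic_pgroup_min X C H :
    cyclic X -> p.-group X -> C \subset X -> #|C| = p -> H \subset X ->
  H :!=: 1 -> C \subset H.
Proof.
move=> cycX pX sCX oC sHX ntH.
have ntX : X :!=: 1 by apply: contraNneq ntH => X1; rewrite -subG1 -X1.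
have oOH := Ohm1_cyclic_pgroup_prime (cyclicS sHX cycX) (pgroupS sHX pX) ntH.
have oOX := Ohm1_cyclic_pgroup_prime cycX pX ntX.
have eqO : 'Ohm_1(H) = 'Ohm_1(X).
  by apply/eqP; rewrite eqEcard OhmS //= oOH oOX.
have p_pr : prime p by have [] := pgroup_pdiv pX ntX.
have C1 : 'Ohm_1(C) = C.
  by apply: (@Ohm1_id _ p); rewrite prime_abelem.
by rewrite -C1 (subset_trans (OhmS 1 sCX)) // -eqO Ohm_sub.
Qed.

Lemma isog_quotient1_Zp H n :
  (1 < n)%N -> cyclic H -> #|H| = n -> (H / [1 gT]) \isog Zp n.
Proof.
move=> n_gt1 /cyclicP[x HE] <-; apply: isog_trans (_ : H \isog _).
  by rewrite isog_sym quotient1_isog.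
by rewrite HE -orderE isog_sym Zp_isog.
Qed.

(** The presentation gives a surjection from the quaternion group, and both
    groups have order 8. *)
Lemma isog_quotient1_Q8 (u t : gT) :
    #[u] = 4%N -> t ^+ 2 = u ^+ 2 -> u ^ t = u^-1 -> t \notin <[u]> ->
  (<<[set u; t]>> / [1 gT]) \isog 'Q_8.
Proof.
move=> ou tu ut u't; apply: isog_trans (_ : <<[set u; t]>> \isog _).
  by rewrite isog_sym quotient1_isog.
have nut : <[t]> \subset 'N(<[u]>) by rewrite norms_cycle ut groupV cycle_id.
have defG : <<[set u; t]>> = <[u]> * <[t]>.
  by rewrite -norm_joinEr // joing_idl joing_idr.
have Q8 : 'Q_8 \isog Grp (x : y : (x ^+ 4, y ^+ 2 = x ^+ 2, x ^ y = x^-1)).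
  exact: (@Grp_quaternion 3 isT).
apply/(isoGrpP _ Q8); split.
  have u2 : u ^+ 2 != 1 by rewrite -order_dvdn ou.
  have ot : #[t] = 4%N.
    have : (#[t] %| 2 ^ 2)%N.
      by rewrite order_dvdn (expgM t 2 2) tu -expgM -order_dvdn ou.
    case/(dvdn_pfactor _ _ (isT : prime 2)) => [[|[|[|m]]]] // _ ot.
      by move: u2; rewrite -tu -order_dvdn ot.
    by move: u2; rewrite -tu -order_dvdn ot.
  have oI : #|<[u]> :&: <[t]>| = 2%N.
    have : (#|<[u]> :&: <[t]>| %| 2 ^ 2)%N by rewrite -[(2 ^ 2)%N]ot cardSg ?subsetIr.
    case/(dvdn_pfactor _ _ (isT : prime 2)) => [[|[|[|m]]]] // _ oI.
      have I1 : <[u]> :&: <[t]> = 1 by apply/eqP; rewrite trivg_card1 oI.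
      have : u ^+ 2 \in <[u]> :&: <[t]> by rewrite inE mem_cycle -tu mem_cycle.
      by rewrite I1 set1gE inE (negPf u2).
    case/negP: u't; rewrite -cycle_subG; apply/setIidPr/eqP.
    by rewrite eqEcard subsetIr oI -orderE ot.
  apply/eqP; rewrite (@card_quaternion 3 isT) -(eqn_pmul2r (_ : 0 < 2)%N) //.
  have := mul_cardG <[u]> <[t]>; rewrite -!orderE ou ot oI => oG.
  by rewrite /= defG -oG.
apply/existsP; exists (u, t); rewrite /= defG -norm_joinEr // !xpair_eqE /=.
have u4 : u ^+ 4 = 1 by rewrite -ou expg_order.
by rewrite ut tu u4 !eqxx.
Qed.

End RankOneGeneralities.

Section RankOne.

Variables (R : realType) (gT : finGroupType) (p : nat).
Variables (S : {group gT}) (f : {group gT} -> int).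
Implicit Types (H K E T M X : {group gT}).
Hypotheses (p_pr : prime p) (pS : (p.-group S)%g) (BSf : Borel_Smith S f).
Hypothesis IH : forall T K, T \subset S -> (K <| T)%g -> K :!=: 1%g ->
  exists chi : gT -> R, realizes T (fun H => f (H <*> K)%G) chi.

Local Open Scope group_scope.

(** The function H |-> f (H C) is realized by induction, being inflated from
    S / C, so only its difference with f is left. *)
Lemma realizes_mod_normal (C : {group gT}) (psi : gT -> R) :
    C <| S -> C :!=: 1 -> vchar S psi ->
    (forall H, H \subset S -> fixdim psi H = (f H - f (H <*> C)%G)%:~R)%R ->
  exists chi : gT -> R, realizes S f chi.
Proof.
move=> nCS ntC vpsi psiE; have [chi [vchi chiE]] := IH (subxx S) nCS ntC.
exists (fun x => chi x + psi x)%R; split; first exact: vcharD.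
by move=> H sHS; rewrite fixdimD chiE // psiE // -rmorphD addrC subrK.
Qed.

Lemma dvdz_real (k : nat) (d : int) : (k %| d)%Z ->
  exists m : int, (m%:~R * k%:R = d%:~R :> R)%R.
Proof. by case/dvdzP=> m ->; exists m; rewrite intrM. Qed.

(** Every nontrivial subgroup contains the subgroup C of order p, so the
    difference of f H and f (H C) is nonzero at H = 1 only. Multiples of the
    rotation representation realize all even differences, and the regular
    representation takes care of the group of order 2. *)
Lemma realizes_cyclic : cyclic S -> exists chi : gT -> R, realizes S f chi.
Proof.
move=> cycS; have [S1 | ntS] := eqVneq S 1%G.
  exists (fun=> (f 1%G)%:~R * 1)%R; split; first by apply: vcharZ; apply: vchar1.
  move=> H sHS; have -> : H = 1%G.
    by apply/group_inj/trivgP; rewrite S1 in sHS.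
  by rewrite fixdimZ fixdim1 mulr1.
have {}ntS : S :!=: 1 by apply: contraNneq ntS => S1; apply/eqP/group_inj.
pose C := 'Ohm_1(S)%G; have oC : #|C| = p := Ohm1_cyclic_pgroup_prime cycS pS ntS.
have nCS : C <| S by apply: gFnormal.
have sCS := normal_sub nCS.
have ntC : C :!=: 1 by rewrite trivg_card1 oC; case: (p) (prime_gt1 p_pr) => [|[]].
pose d := (f 1%G - f C)%R.
have target H : H \subset S ->
    (f H - f (H <*> C)%G = if H :==: 1%g then d else 0)%R.
  move=> sHS; case: eqP => [H1 | /eqP ntH].
    have -> : H = 1%G by apply: group_inj.
    by congr (_ - f _)%R; apply: group_inj; rewrite /= joing1G.
  have sCH := cyclic_pgroup_min cycS pS sCS oC sHS ntH.
  have -> : (H <*> C)%G = H by apply: group_inj; apply/joing_idPl.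
  by rewrite subrr.
have [S2 | Sn2] := eqVneq #|S| 2%N.
  apply: (realizes_mod_normal (psi := fun x => d%:~R * (ind_char S 1%G (fun=> 1) x - 1))%R nCS ntC).
    apply: vcharZ; apply: vcharB; last exact: vchar1.
    by apply: vchar_ind; [apply: sub1G | apply: vchar1].
  move=> H sHS; rewrite target // fixdimZ fixdimB fixdim1 fixdim_ind //.
  rewrite cards1 invr1 mul1r (eq_bigr (fun=> #|H|%:R^-1)%R); last first.
    move=> s _; have I1 : (H :^ s :&: 1)%G = 1%G by apply/group_inj/trivgP/subsetIr.
    rewrite -[#|_ :&: _|]/(#|(H :^ s :&: 1)%G|) I1 cards1 fixdim1.
    by rewrite mulr1 mul1r.
  rewrite sumr_const S2; case: eqP => [-> | /eqP ntH].
    by rewrite cards1 invr1; ring.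
  have oH : #|H| = 2%N.
    have : (#|H| %| 2)%N by rewrite -S2 cardSg.
    case/primeP: (isT : prime 2) => _ dvd2 /dvd2 /orP[|/eqP //].
    by rewrite -trivg_card1 (negPf ntH).
  by rewrite oH; field.
(* For odd p this is the condition for C itself; for p = 2, the group S has a
   subgroup of order 4, to which the condition on cyclic sections of order 4
   applies. *)
have d_even : (2 %| d)%Z.
  have nC1 : 1%G <| C by apply: normal1.
  have [p2 | p_odd] := even_prime p_pr; last first.
    apply: (BS_odd BSf nC1 sCS p_pr p_odd).
    by apply: isog_quotient1_Zp; rewrite ?prime_gt1 ?prime_cyclic ?oC.
  have S4 : (2 <= logn p #|S|)%N.
    rewrite p2; have [n oS] := p_natP pS.
    by move: ntS Sn2; rewrite trivg_card1 oS p2; case: (n) => [|[|m]] //; rewrite pfactorK.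
  have [N [sNS nNS oN]] := normal_pgroup pS (normal_refl S) S4.
  apply: (BS_four BSf (L := 1%G) (H := C) (N := N)) => //.
  - apply: normalS nCS => //; apply: (cyclic_pgroup_min cycS pS sCS oC sNS).
    by rewrite trivg_card1 oN p2.
  - by rewrite subsetI sNS norms1.
  - by apply: isog_quotient1_Zp; rewrite ?prime_cyclic ?oC ?p2.
  by apply: isog_quotient1_Zp; rewrite ?(cyclicS sNS) // oN p2.
have [x Sx] := cyclicP cycS.
have [rho [rrho rho1 _ rho0 _]] := rotation_char R x.
have [m mE] := dvdz_real d_even.
apply: (realizes_mod_normal (psi := fun x => m%:~R * rho x)%R nCS ntC).
  by apply: vcharZ; rewrite (group_inj Sx : S = <[x]>%G); apply: rchar_vchar.
move=> H sHS; rewrite target // fixdimZ; case: eqP => [H1|/eqP ntH].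
  by rewrite fixdim_trivg // rho1 mE.
by rewrite rho0 ?mulr0 -?Sx.
Qed.

End RankOne.

(** * Extremal 2-groups *)

(** Here S is a 2-group of maximal class with cyclic maximal subgroup X, and u is
    an element of order 4 of X. All subgroups that meet X nontrivially contain
    C, generated by u ^ 2, so that the others, apart from 1, have order 2. *)
Section Extremal.

Variables (R : realType) (gT : finGroupType).
Variables (S : {group gT}) (f : {group gT} -> int).
Implicit Types (H K : {group gT}).
Hypotheses (pS : (2.-group S)%g) (BSf : Borel_Smith S f).
Hypothesis IH : forall T K : {group gT}, T \subset S -> (K <| T)%g -> K :!=: 1%g ->
  exists chi : gT -> R, realizes T (fun H => f (H <*> K)%G) chi.

Local Open Scope group_scope.

Variables x u : gT.
Local Notation X := <[x]>%G.
Hypotheses (sXS : X \subset S) (iX : #|S : X| = 2%N) (Xu : u \in X).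
Hypotheses (ou : #[u] = 4%N) (uV : {in S :\: X, forall z, u ^ z = u^-1}).

Let C := <[u ^+ 2]>%G.
Let d := (f 1%G - f C)%R.

Let oC : #|C| = 2%N. Proof. by rewrite -orderE orderXdiv ?ou. Qed.
Let sCX : C \subset X. Proof. by rewrite cycle_subG groupX. Qed.
Let ntC : C :!=: 1. Proof. by rewrite trivg_card1 oC. Qed.

Let cSC : S \subset 'C(C).
Proof.
apply/subsetP=> z Sz; rewrite cent_cycle; apply/cent1P/commute_sym/commgP/conjg_fixP.
have [Xz | X'z] := boolP (z \in X).
  apply/conjg_fixP/commgP; apply: (centsP (cycle_abelian x)) => //.
  by rewrite groupX.
rewrite conjXg uV ?inE ?X'z // expgVn; apply: (mulgI (u ^+ 2)).
by rewrite mulgV -expgD; apply/esym/eqP; rewrite -order_dvdn ou.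
Qed.

Let nCS : C <| S.
Proof. by rewrite /normal (subset_trans sCX sXS) cents_norm. Qed.

Let tiX H : H \subset S -> ~~ (C \subset H) -> H :&: X = 1.
Proof.
move=> sHS not_sCH; apply/eqP; apply: contraNT not_sCH => ntHX.
apply: subset_trans (subsetIl H X).
apply: (cyclic_pgroup_min (cycle_cyclic x) (pgroupS sXS pS) sCX oC) ntHX.
exact: subsetIr.
Qed.

(** The group H C is a four-group, whose subgroups of order 2 are C, H and the
    conjugate of H by u; the last two have the same value under f. *)
Let half H : H \subset S -> ~~ (C \subset H) -> H :!=: 1 ->
  #|H| = 2%N /\ d = ((f H - f (H <*> C)%G) *+ 2)%R.
Proof.
move=> sHS not_sCH ntH; have tiHX := tiX sHS not_sCH.
have oH : #|H| = 2%N.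
  have : (#|H| * #|X| <= 2 * #|X|)%N.
    rewrite -TI_cardMg // -iX mulnC Lagrange // subset_leq_card // mul_subG //.
  rewrite leq_pmul2r ?cardG_gt0 // leq_eqVlt => /orP[/eqP // | ].
  by rewrite ltnS leqNgt cardG_gt1 ntH.
split=> //; have [s Hs nts] := trivgPn _ ntH.
have X's : s \notin X.
  by apply: contra nts => Xs; rewrite -in_set1 -set1gE -tiHX inE Hs.
have sCS := normal_sub nCS.
pose A := (H <*> C)%G.
have tiHC : H :&: C = 1.
  by rewrite setIC; apply: prime_TIg; rewrite ?oC.
have cHC : C \subset 'C(H) by rewrite centsC (subset_trans sHS).
have AE : H \* C = A by rewrite cprodE //= cent_joinEr.
have abelA : 2.-abelem A by rewrite (cprod_abelem _ AE) !prime_abelem.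
have oA : #|A| = 4%N by rewrite /= cent_joinEr // TI_cardMg // oH oC.
have sAS : A \subset S by rewrite join_subG sHS.
have Su : u \in S by apply: subsetP sXS u Xu.
have sHA : H \subset A := joing_subl _ _.
have sCA : C \subset A := joing_subr _ _.
have neqHC : H != C by apply: contraNneq not_sCH => ->.
have not_sHuC : ~~ (C \subset H :^ u).
  apply: contra not_sCH; rewrite -{1}(normP (_ : u \in 'N(C))) ?conjSg //.
  by apply: (subsetP (normal_norm nCS)).
have sHuA : H :^ u \subset A.
  apply/subsetP=> _ /imsetP[h Hh ->].
  have [-> | nth] := eqVneq h 1; first by rewrite conj1g group1.
  have X'h : h \notin X.
    by apply: contra nth => Xh; rewrite -in_set1 -set1gE -tiHX inE Hh.
  have Sh := subsetP sHS h Hh.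
  have -> : h ^ u = h * u ^+ 2.
    rewrite conjgE mulgA (conjgC u^-1 h) conjVg uV ?inE ?X'h // invgK.
    by rewrite -mulgA.
  by apply: groupM; [apply: subsetP sHA h Hh | apply: subsetP sCA _ (cycle_id _)].
have neqHHu : (H :^ u)%G != H.
  apply/eqP=> /(congr1 val)/= HuH.
  case/negP: not_sCH; rewrite cycle_subG.
  have Ss := subsetP sHS s Hs.
  have : s ^ u \in H by rewrite -HuH memJ_conjg.
  rewrite conjgE mulgA (conjgC u^-1 s) conjVg uV ?inE ?X's // invgK.
  by rewrite -mulgA groupMl.
pose lines := [set K : {group gT} | (K \subset A) && (#|K| == 2%N)].
have linesE : lines = (H :^ u)%G |: [set H; C].
  apply/esym/eqP; rewrite eqEcard; apply/andP; split.
    apply/subsetP=> K; rewrite !inE => /or3P[] /eqP->.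
    - by rewrite sHuA cardJg oH.
    - by rewrite sHA oH.
    by rewrite sCA oC.
  have -> : #|lines| = 3%N.
    rewrite -(card_p1Elem_p2Elem (_ : A \in 'E_2^2(A))).
      by rewrite p1ElemE //; apply: eq_card => K; rewrite !inE.
    by rewrite !inE subxx abelA oA.
  rewrite cardsU1 cards2 neqHC !inE negb_or neqHHu /=.
  by case: eqP not_sHuC => // <-; rewrite subxx.
have isoA : A / 1%G \isog setX (Zp 2) (Zp 2).
  apply: isog_trans (isog_Zp2 (isT : prime 2) abelA oA).
  by rewrite isog_sym quotient1_isog.
have := BS_sum BSf (normal1 A) sAS (isT : prime 2) isoA.
rewrite (eq_bigl (mem lines)) => [|K]; last first.
  by rewrite !inE sub1G /= -(card_isog (quotient1_isog K)).
rewrite linesE big_setU1 /=; last first.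
  rewrite !inE negb_or neqHHu /=.
  by case: eqP not_sHuC => // <-; rewrite subxx.
rewrite big_setU1 /= ?big_set1; last by rewrite inE.
rewrite (BS_class BSf) // => e.
by rewrite /d -[f 1%G](subrK (f A)) e; ring.
Qed.

(** If H does not contain C, its order is 1 or 2, and [half] gives the value. Up to
    a factor, these are the dimensions in any representation on which X acts
    freely away from the origin. *)
Let target H : H \subset S ->
  ((f H - f (H <*> C)%G)%:~R = (if C \subset H then 0 else d%:~R / #|H|%:R) :> R)%R.
Proof.
move=> sHS; case: ifP => [sCH | /negbT not_sCH].
  have -> : (H <*> C)%G = H by apply: group_inj; apply/joing_idPl.
  by rewrite subrr.
have [H1 | ntH] := eqVneq (gval H) 1.
  have -> : H = 1%G by apply: group_inj.
  rewrite cards1 divr1 /d; congr (_ - f _)%:~R%R.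
  by apply: group_inj; rewrite /= joing1G.
have [oH ->] := half sHS not_sCH ntH.
by rewrite oH rmorphMn /= -[(_ *+ 2)%R]mulr_natr mulfK ?pnatr_eq0.
Qed.

Let fixdim_rho (rho : gT -> R) H : H \subset S ->
    (rho 1%g = 2 :> R)%R ->
    (forall K, K \subset X -> K :!=: 1%g -> fixdim rho K = 0)%R ->
  (#|H :&: X|%:R / #|H|%:R * fixdim rho (H :&: X)%G =
   (if C \subset H then 0 else 2 / #|H|%:R))%R.
Proof.
move=> sHS rho1 rho0; case: ifP => [sCH | /negbT not_sCH].
  rewrite rho0 ?subsetIr ?mulr0 //; apply: contraNneq ntC => HX1.
  by rewrite -subG1 -HX1 subsetI sCH.
have HX1 := tiX sHS not_sCH.
by rewrite HX1 cards1 fixdim_trivg //= rho1 mulrC mulrA mulr1.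
Qed.

(** The elements u and t generate a quaternion group, so the condition on
    quaternion sections says that 4 divides d; the rotation representation of X,
    induced to S, has degree 4. *)
Lemma realizes_extremal_Q8 t :
  t \in S :\: X -> t ^+ 2 = u ^+ 2 -> exists chi : gT -> R, realizes S f chi.
Proof.
move=> X't tu; have [St not_Xt] := setDP X't.
have d4 : (4 %| d)%Z.
  have u't : t \notin <[u]>.
    by apply: contra not_Xt; apply: subsetP; rewrite cycle_subG.
  have sNS : <<[set u; t]>> \subset S.
    by rewrite gen_subG subUset !sub1set St (subsetP sXS).
  apply: (BS_quaternion BSf (L := 1%G) (H := C) (N := <<[set u; t]>>%G)).
  - exact: normal1.
  - apply: normalS nCS => //; rewrite cycle_subG groupX // mem_gen //.
    by rewrite !inE eqxx.
  - by rewrite subsetI sNS norms1.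
  - by apply: isog_quotient1_Zp; rewrite ?cycle_cyclic.
  exact: isog_quotient1_Q8 ou tu (uV X't) u't.
have [rho [rrho rho1 _ rho0 _]] := rotation_char R x.
have [m mE] := dvdz_real R d4.
apply: (realizes_mod_normal IH (psi := fun x => m%:~R * ind_char S X rho x)%R nCS ntC).
  by apply: vcharZ; apply: vchar_ind => //; apply: rchar_vchar.
move=> H sHS; rewrite target // fixdimZ fixdim_ind //.
rewrite (eq_bigr (fun=> if C \subset H then 0 else 2 / #|H|%:R)%R); last first.
  move=> s Ss; rewrite (_ : #|H| = #|(H :^ s)%G|); last by rewrite cardJg.
  rewrite (fixdim_rho (H := (H :^ s)%G)) //; last first.
    by rewrite -(normsP (normG S) s Ss) conjSg.
  by rewrite -{1}(normP (subsetP (normal_norm nCS) s Ss)) conjSg.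
case: ifP => _; first by rewrite sumr_const mul0rn !mulr0.
rewrite sumr_const -(Lagrange sXS) iX -mE -[(_ *+ (_ * _))%R]mulr_natr natrM.
by have X0 := natrG_neq0 R X; have H0 := natrG_neq0 R H; field; rewrite ?X0 ?H0.
Qed.

(** By [half] for the subgroup generated by y, the number d is even. This suffices
    as the rotation representation of X extends to S. *)
Lemma realizes_extremal_dihedral y :
    y \in S :\: X -> y ^+ 2 = 1 -> {in X, forall v, v ^ y = v^-1} ->
  exists chi : gT -> R, realizes S f chi.
Proof.
move=> X'y yy Vy; have [Sy not_Xy] := setDP X'y.
have d2 : (2 %| d)%Z.
  have sYS : <[y]> \subset S by rewrite cycle_subG.
  have nty : y != 1 by apply: contraNneq not_Xy => ->; apply: group1.
  have [||_ ->] := half sYS; last by rewrite -[X in (_ %| X)%Z]mulr_natr dvdz_mull.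
    apply: contra not_Xy => sCY; have oy : #[y] = 2%N.
      exact: nt_prime_order.
    rewrite -cycle_subG; apply: subset_trans sCX.
    by rewrite -(_ : C = <[y]> :> {set gT}) //; apply/eqP; rewrite eqEcard sCY oC -orderE oy.
  by rewrite cycle_eq1.
have [rho [rrho rho1 _ rho0 dih]] := rotation_char R x.
have [m mE] := dvdz_real R d2.
apply: (realizes_mod_normal IH
  (psi := fun s => m%:~R * (if s \in X then rho s else 0))%R nCS ntC).
  apply: vcharZ; apply: rchar_vchar; apply: (dih S y) => //.
  by rewrite (rcoset_index2 sXS iX X'y); apply/subsetP=> s Ss; rewrite !inE Ss andbT orbN.
move=> H sHS; rewrite target // fixdimZ.
have -> : fixdim (fun s => if s \in X then rho s else 0)%R H =
    (#|H :&: X|%:R / #|H|%:R * fixdim rho (H :&: X)%G)%R.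
  rewrite /fixdim [RHS]mulrACA mulfV ?(natrG_neq0 R (H :&: X)%G) // mul1r.
  congr (_ * _)%R.
  by rewrite -big_mkcondr; apply: eq_bigl => s; rewrite inE.
rewrite fixdim_rho // -mE; case: ifP => _; first by rewrite mulr0.
by rewrite mulrA.
Qed.

End Extremal.

Section ExtremalClasses.

Variables (R : realType) (gT : finGroupType).
Variables (S : {group gT}) (f : {group gT} -> int).
Hypotheses (pS : (2.-group S)%g) (BSf : Borel_Smith S f).
Hypothesis IH : forall T K : {group gT}, T \subset S -> (K <| T)%g -> K :!=: 1%g ->
  exists chi : gT -> R, realizes T (fun H => f (H <*> K)%G) chi.

Local Open Scope group_scope.

(** Semidihedral groups have elements x y outside X whose square is the involution
    of X, like generalized quaternion groups. *)
Lemma realizes_extremal2 :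
  extremal2 S -> (7 < #|S|)%N -> exists chi : gT -> R, realizes S f chi.
Proof.
move=> ext2 S_gt7.
have facts n x y : extremal_generators S 2 n (x, y) ->
    [/\ (2 < n)%N, <[x]> \subset S, #|S : <[x]>| = 2%N,
        #[x ^+ (2 ^ (n - 3))] = 4%N & (x ^+ (2 ^ (n - 3))) ^+ 2 = x ^+ (2 ^ n.-2)].
  move=> genS; have [oS Sx ox _] := genS.
  have n_gt2 : (2 < n)%N.
    by move: S_gt7; rewrite oS ltnNge; apply: contraR; rewrite -leqNgt => ?;
       apply: (@leq_trans (2 ^ 2)%N); rewrite ?leq_exp2l.
  have sXS : <[x]> \subset S by rewrite cycle_subG.
  case: n n_gt2 oS ox {genS} => [|[|[|m]]] // _ oS ox; rewrite !subSS subn0 /=.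
  split=> //.
  - by rewrite -divgS // -orderE oS ox expnS mulnK ?expn_gt0.
  - by rewrite orderXdiv ox /= -(addn2 m) expnD ?dvdn_mulr // mulKn ?expn_gt0.
  by rewrite -expgM mulnC -expnS.
move: ext2; rewrite /extremal2 !inE => /or3P[] /eqP.
- case/dihedral_classP=> n n_gt1 isoS.
  have [[x y] genS _] := generators_2dihedral n_gt1 isoS.
  have [_ sXS iX ou _] := facts _ _ _ genS; have [_ _ _ X'y] := genS.
  have [[_ oX' inv] _ _ _ _] := dihedral2_structure n_gt1 genS isoS.
  apply: (realizes_extremal_dihedral pS BSf IH sXS iX _ ou _ X'y).
  - exact: mem_cycle.
  - by move=> z X'z; rewrite inv ?mem_cycle.
  - by apply/eqP; rewrite -order_dvdn oX'.
  by move=> v Xv; rewrite inv.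
- case/semidihedral_classP=> n n_gt3 isoS.
  have [[x y] genS [oy xy]] := generators_semidihedral n_gt3 isoS.
  have [n_gt2 sXS iX ou u2] := facts _ _ _ genS; have [_ Sx ox X'y] := genS.
  have [[_ oxy inv] _ _ _ _] := semidihedral_structure n_gt3 genS isoS oy.
  have y2 : y ^+ 2 = 1 by rewrite -oy expg_order.
  apply: (realizes_extremal_Q8 pS BSf IH sXS iX _ ou _ (t := x * y)).
  - exact: mem_cycle.
  - move=> z X'z; rewrite inv ?mem_cycle //; apply: (mulgI (x ^+ (2 ^ (n - 3)))).
    rewrite mulgV -expgS prednK ?expn_gt0 //; apply/eqP; rewrite -order_dvdn ou.
    by apply: (@dvdn_exp2l 2 2); rewrite -(subnKC n_gt3).
  - by move: X'y; rewrite !inE groupMl ?cycle_id // => /andP[-> Sy]; rewrite groupM.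
  rewrite u2 expgS expg1 -mulgA (mulgA y x y).
  have -> : y * x * y = x ^ y.
    by rewrite conjgE mulgA; congr (_ * _ * _); apply: (mulgI y); rewrite mulgV.
  by rewrite xy -expgS prednK ?expn_gt0.
case/quaternion_classP=> n n_gt2 isoS.
have [[x y] genS [oy y2 xy]] := generators_quaternion n_gt2 isoS.
have [_ sXS iX ou u2] := facts _ _ _ genS; have [_ _ _ X'y] := genS.
have [[_ _ inv] _ _ _ _] := quaternion_structure n_gt2 genS isoS.
apply: (realizes_extremal_Q8 pS BSf IH sXS iX _ ou _ X'y).
- exact: mem_cycle.
- by move=> z X'z; rewrite inv ?mem_cycle.
by rewrite u2 y2.
Qed.

End ExtremalClasses.

(** A p-group all of whose normal abelian subgroups are cyclic is cyclic or a
    2-group of maximal class. *)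
Lemma Borel_Smith_realizable (R : realType) (p : nat) (gT : finGroupType)
    (S : {group gT}) (f : {group gT} -> int) :
    prime p -> p.-group S -> Borel_Smith S f ->
  exists chi : gT -> R, realizes S f chi.
Proof.
move=> p_pr; have [n] := ubnP #|S|.
elim: n gT S f => // n IHn gT S f leSn pS BSf.
have IH (T K : {group gT}) : T \subset S -> (K <| T)%g -> K :!=: 1%g ->
  exists chi : gT -> R, realizes T (fun H => f (H <*> K)%G) chi.
  move=> sTS nKT ntK; apply: (inflation_realizes nKT).
  have BST := Borel_SmithS BSf sTS.
  apply: (IHn _ (T / K)%G (fun M : {group coset_of K} => f (coset K @*^-1 M)%G)).
  - rewrite -ltnS; apply: leq_trans leSn; rewrite ltnS.
    apply: leq_trans (subset_leq_card sTS).
    by rewrite ltn_quotient ?normal_sub.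
  - by rewrite quotient_pgroup // (pgroupS sTS).
  exact: Borel_Smith_quotient.
have [/existsP[E /and3P[nES abelE /eqP oE]] | noE] :=
    boolP [exists E : {group gT}, [&& E <| S, p.-abelem E & #|E| == (p ^ 2)%N]%g].
  have [sEZ | ncE] := boolP (E \subset 'Z(S))%g.
    exact: (realizes_central p_pr BSf IH abelE oE sEZ).
  exact: (realizes_noncentral p_pr pS BSf IH abelE oE nES ncE).
have rank1 (X : {group gT}) : (X <| S)%g -> abelian X -> cyclic X.
  move=> nXS abX; apply: contraNT noE => ncX.
  have [E [nES abelE oE]] := normal_rank2_exists p_pr pS nXS abX ncX.
  by apply/existsP; exists E; rewrite nES abelE oE eqxx.
have [cycS | ] := normal_rank1_structure pS rank1.
  exact: (realizes_cyclic p_pr pS BSf IH cycS).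
case/and3P=> /eqP p2 ext2 big; rewrite p2 in pS.
apply: (realizes_extremal2 pS BSf IH ext2).
case/orP: big => [/(leq_trans _)-> // | isoQ].
by rewrite (card_isog isoQ) (@card_quaternion 3).
Qed.

(** * Morphisms of a fusion system *)

Section FusionBasics.

Variables (gT : finGroupType) (S : {group gT}) (F : fusion_system S).
Implicit Types (P Q T : {group gT}) (f g : gT -> gT).
Local Open Scope group_scope.

Lemma fs_id P Q : P \subset Q -> Q \subset S -> F P Q id.
Proof.
move=> sPQ sQS; have e1 : {in P, id =1 conjg^~ 1} by move=> x _ /=; rewrite conjg1.
by rewrite (fs_ext F Q e1); apply: fs_conj; rewrite ?conjsg1 // (subset_trans sPQ).
Qed.

Lemma fs_sub P Q T f : Q \subset P -> F P T f -> F Q T f.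
Proof.
move=> sQP Ff; have [sPS _] := fs_obj Ff.
exact: fs_comp (fs_id sQP sPS) Ff.
Qed.

Lemma fs_img P Q T f : F P Q f -> f @: P \subset T -> T \subset S -> F P T f.
Proof.
move=> Ff sfT sTS; have [Ff' _] := fs_factor Ff.
by apply: fs_comp Ff' (fs_id _ sTS); rewrite (fimgE Ff).
Qed.

Lemma fs_onto P Q f : F P Q f -> #|P| = #|Q| ->
  f @: P = Q /\ exists2 g, F Q P g & {in P, cancel f g} /\ {in Q, cancel g f}.
Proof.
move=> Ff oPQ; have [fM fI sfQ] := fs_inj Ff.
have fPQ : f @: P = Q by apply/eqP; rewrite eqEcard sfQ card_in_imset // oPQ leqnn.
split=> //; have [_ [g fK Fg]] := fs_factor Ff.
have -> : Q = fimg f P by apply: group_inj; rewrite (fimgE Ff).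
exists g => //; split=> // y; rewrite (fimgE Ff) => /imsetP[x Px ->].
by rewrite fK.
Qed.

Lemma fs_isoP P Q f : F P S f -> f @: P = Q -> fs_iso F P Q f.
Proof.
move=> Ff fPQ; have [_ fI _] := fs_inj Ff.
have sQS : Q \subset S by rewrite -fPQ; have [_ _] := fs_inj Ff.
have FQ : F P Q f by apply: fs_img Ff _ sQS; rewrite fPQ.
have oPQ : #|P| = #|Q| by rewrite -fPQ card_in_imset.
by have [_ [g Fg [fK gK]]] := fs_onto FQ oPQ; split=> //; exists g.
Qed.

Lemma fs_inverse P Q f : F P Q f ->
  exists g, [/\ F (fimg f P) P g, {in P, cancel f g}
              & {in fimg f P, cancel g f}].
Proof.
move=> Ff; have [Ff' [g fK Fg]] := fs_factor Ff; exists g; split=> //.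
by move=> y; rewrite (fimgE Ff) => /imsetP[x Px ->]; rewrite fK.
Qed.

Lemma fs_morph1 P Q f : F P Q f -> f 1 = 1.
Proof.
by case/fs_inj=> fM _ _; apply: (mulgI (f 1)); rewrite mulg1 -fM ?mulg1.
Qed.

Lemma fs_morphV P Q f x : F P Q f -> x \in P -> f x^-1 = (f x)^-1.
Proof.
move=> Ff Px; have [fM _ _] := fs_inj Ff.
by apply: (mulgI (f x)); rewrite -fM ?groupV // !mulgV (fs_morph1 Ff).
Qed.

Lemma fs_morphX P Q f x k : F P Q f -> x \in P -> f (x ^+ k) = f x ^+ k.
Proof.
move=> Ff Px; have [fM _ _] := fs_inj Ff.
elim: k => [|k IHk]; first by rewrite (fs_morph1 Ff).
by rewrite !expgS fM ?groupX // IHk.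
Qed.

Lemma fs_morphJ P Q f x y :
  F P Q f -> x \in P -> y \in P -> f (x ^ y) = f x ^ f y.
Proof.
move=> Ff Px Py; have [fM _ _] := fs_inj Ff.
by rewrite !conjgE !fM ?groupM ?groupV // (fs_morphV Ff).
Qed.

Lemma fs_cycle Q f x : F <[x]>%G Q f -> f @: <[x]> = <[f x]>.
Proof.
move=> Ff; apply/setP=> y; apply/imsetP/cycleP=> [[_ /cycleP[k ->] ->] | [k ->]].
  by exists k; rewrite (fs_morphX _ Ff) ?cycle_id.
by exists (x ^+ k); rewrite ?mem_cycle // (fs_morphX _ Ff) ?cycle_id.
Qed.

End FusionBasics.

Section AutPerm.

Variables (gT : finGroupType) (G : {group gT}).
Local Open Scope group_scope.

Lemma exists_Aut (h : gT -> gT) :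
    {in G &, {morph h : x y / x * y}} -> {in G &, injective h} ->
    {in G, forall x, h x \in G} ->
  exists2 a : {perm gT}, a \in Aut G & {in G, a =1 h}.
Proof.
move=> hM hI hG; have shG : h @: G \subset G.
  by apply/subsetP=> _ /imsetP[x Gx ->]; apply: hG.
exists (perm_in hI shG); last by move=> x Gx; rewrite perm_inE.
rewrite inE perm_in_on /=; apply/morphicP=> x y Gx Gy.
by rewrite !perm_inE ?groupM ?hM.
Qed.

End AutPerm.

Section GaussianPeriods.

Variables (R : realType) (gT : finGroupType) (Z : {group gT}) (p d : nat).
Hypotheses (p_pr : prime p) (oZ : #|Z| = p).
Local Open Scope group_scope.

(** The period eta is half of the sum of the rotation characters rho (a x), for a
    in the group A0 of automorphisms with a ^ d = 1. For odd p, inversion j lies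
    in A0 and preserves rho, so keeping one automorphism from each pair a, j a
    yields half of the sum without denominators. As rho sums to 0 over Z, the sum
    of eta over the nontrivial elements is minus the order e of A0, and e divides
    d because Aut Z is cyclic. *)
Lemma gaussian_period : (odd p -> 2 %| d)%N -> exists (eta : gT -> R) (e : nat),
  [/\ (e %| d)%N, (0 < e)%N, vchar Z eta,
      forall b : {perm gT}, b \in Aut Z -> b ^+ d = 1 ->
        {in Z, forall x, eta (b x) = eta x}
    & (\sum_(x in Z^#) eta x = - e%:R)%R].
Proof.
move=> d_even; have [p2 | p_odd] := even_prime p_pr.
  exists (fun=> -1)%R, 1%N; split=> //; rewrite ?dvd1n //.
    exact: vcharN (vchar1 R Z).
  rewrite sumr_const (_ : #|Z^#| = 1%N); first by [].
  by have := cardsD1 1 Z; rewrite group1 oZ p2 => -[].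
have [z Zz] : exists z, Z = <[z]>%G.
  have /cyclicP[z Zz] : cyclic Z by rewrite prime_cyclic ?oZ.
  by exists z; apply: group_inj.
have [rho [rrho rho1 rhoV rho0 _]] := rotation_char R z.
have Zs : <[z]> = Z by rewrite Zz.
rewrite -Zz in rrho; rewrite Zs in rhoV rho0.
have cycA : cyclic (Aut Z) by apply: Aut_prime_cyclic; rewrite oZ.
have cA : abelian (Aut Z) := cyclic_abelian cycA.
have cZ : abelian Z by rewrite cyclic_abelian // prime_cyclic // oZ.
have [A0 A0P] : exists A0 : {group {perm gT}},
    forall a, (a \in A0) = (a \in Aut Z) && (a ^+ d == 1).
  by exists (Group (group_Ldiv d cA)) => a; rewrite !inE.
have e_dvd : (#|A0| %| d)%N.
  have /cyclicP[b A0b] : cyclic A0.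
    by apply: cyclicS cycA; apply/subsetP=> a; rewrite A0P => /andP[].
  rewrite A0b -orderE order_dvdn.
  by have := cycle_id b; rewrite -A0b A0P => /andP[].
have [j Aj jV] : exists2 j : {perm gT}, j \in Aut Z & {in Z, j =1 invg}.
  apply: exists_Aut => [x y Zx Zy|x y _ _|x Zx]; rewrite ?groupV //.
    by rewrite invMg; apply: (centsP cZ); rewrite groupV.
  exact: invg_inj.
have AutZ a x : a \in Aut Z -> x \in Z -> a x \in Z.
  by rewrite inE => /andP[ona _] Zx; rewrite (perm_closed _ ona).
have AutM a : a \in Aut Z -> {in Z &, {morph a : x y / x * y}}.
  by rewrite inE => /andP[_ /morphicP].
have A0j : j \in A0.
  rewrite A0P Aj; have /dvdnP[k ->] := d_even p_odd; rewrite mulnC expgM.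
  rewrite (_ : j ^+ 2 = 1) ?expg1n ?eqxx //.
  apply: (eq_Aut (groupX 2 Aj) (group1 _)) => x Zx.
  by rewrite permM perm1 !jV ?invgK ?groupV.
have rho_j a x : a \in A0 -> x \in Z -> rho ((j * a) x) = rho (a x).
  rewrite A0P => /andP[Aa _] Zx; rewrite permM jV //.
  have aV : a x^-1 = (a x)^-1.
    have a1 : a 1 = 1 by apply: (mulgI (a 1)); rewrite -AutM ?mulg1.
    by apply: (mulgI (a x)); rewrite -AutM ?groupV // !mulgV a1.
  by rewrite aV rhoV // AutZ.
have j1 : j != 1.
  have Zz1 : z \in Z by rewrite -Zs cycle_id.
  apply: contraTneq (odd_prime_gt2 p_odd p_pr) => j1; rewrite -leqNgt.
  apply: dvdn_leq => //; rewrite -oZ -Zs -orderE order_dvdn.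
  by rewrite expgS -{1}(perm1 z) -j1 jV // mulVg.
(* The enumeration of permutations serves to choose one of a and j * a. *)
pose half (a : {perm gT}) := (enum_rank a < enum_rank (j * a)%g)%N.
pose eta x : R := (\sum_(a in A0 | half a) rho (a x))%R.
have eta2 x : x \in Z -> (eta x * 2 = \sum_(a in A0) rho (a x))%R.
  move=> Zx; rewrite (bigID half) /= mulr_natr mulr2n; congr (_ + _)%R.
  rewrite /eta (reindex_inj (mulgI j)) /=; apply: eq_big => [a|a]; last first.
    by rewrite groupMl // => /andP[A0a _]; rewrite rho_j.
  rewrite groupMl //; apply: andb_id2l => A0a; rewrite /half mulgA.
  have -> : j * j = 1.
    apply: (eq_Aut (groupM Aj Aj) (group1 _)) => y Zy.
    by rewrite permM perm1 !jV ?invgK ?groupV.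
  rewrite mul1g ltn_neqAle leqNgt; case: ltnP => [_|_]; rewrite ?andbF ?andbT //.
  rewrite (inj_eq (@ord_inj _)) (inj_eq enum_rank_inj).
  by apply/eqP=> ja; case/eqP: j1; apply: (mulIg a); rewrite mul1g.
exists eta, #|A0|; split=> //.
- apply: vchar_sum => a /andP[]; rewrite A0P => /andP[Aa _] _.
  apply: (vchar_morph (f := a)); last exact: rchar_vchar rrho.
    exact: AutM.
  by apply/subsetP=> _ /imsetP[x Zx ->]; apply: AutZ.
- move=> b Ab bd x Zx; have A0b : b \in A0 by rewrite A0P Ab bd eqxx.
  apply: (mulIf (_ : 2 != 0)%R); first by rewrite pnatr_eq0.
  rewrite !eta2 ?AutZ // [RHS](reindex_inj (mulgI b)) /=.
  by apply: eq_big => [a|a _]; rewrite ?groupMl // permM.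
apply: (mulIf (_ : 2 != 0)%R); first by rewrite pnatr_eq0.
rewrite mulr_suml (eq_bigr (fun x => \sum_(a in A0) rho (a x))%R); last first.
  by move=> x /setD1P[_ Zx]; apply: eta2.
rewrite exchange_big /= (eq_bigr (fun=> - 2)%R).
  by rewrite sumr_const -[(_ *+ _)%R]mulr_natr; ring.
move=> a; rewrite A0P => /andP[Aa _].
have sumZ : (\sum_(x in Z) rho x = 0)%R.
  have ntZ : Z :!=: 1 by rewrite trivg_card1 oZ; case: (p) (prime_gt1 p_pr) => [|[]].
  have /eqP := rho0 Z (subxx _) ntZ.
  by rewrite mulf_eq0 invr_eq0 (negPf (natrG_neq0 R Z)) => /eqP.
transitivity (\sum_(x in Z^#) rho x)%R.
  rewrite [RHS](reindex_inj (@perm_inj _ a)) /=; apply: eq_bigl => x.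
  have a1 : a 1 = 1 by apply: (mulgI (a 1)); rewrite -AutM ?mulg1.
  move: Aa; rewrite inE => /andP[ona _].
  by rewrite !inE (perm_closed _ ona) -{2}a1 (inj_eq perm_inj).
by move: sumZ; rewrite (big_setD1 1) ?group1 //= rho1 => /eqP; rewrite addrC addr_eq0 => /eqP.
Qed.

End GaussianPeriods.

(** * Sums over the generators of cyclic subgroups *)

Section GeneratorSums.

Variables (R : realType) (gT : finGroupType).
Implicit Types (H C D L : {group gT}) (chi : gT -> R).
Local Open Scope group_scope.

Definition gsum chi D : R := (\sum_(x | generator D x) chi x)%R.

(** Each element of H generates exactly one subgroup of H. *)
Lemma fixdim_gsum chi H :
  fixdim chi H = (#|H|%:R^-1 * \sum_(D : {group gT} | D \subset H) gsum chi D)%R.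
Proof.
congr (_ * _)%R; rewrite (partition_big (fun x => <[x]>%G) (fun D => D \subset H)).
  apply: eq_bigr => D sDH; apply: eq_bigl => x; rewrite /generator eq_sym.
  rewrite -val_eqE /=; case: eqP => [DE | //]; rewrite ?andbF //.
  by rewrite andbT -cycle_subG -DE.
by move=> x Hx; rewrite cycle_subG.
Qed.

Lemma eq_fixdim_gsum (S H : {group gT}) chi psi :
    H \subset S ->
    (forall D, D \subset S -> cyclic D -> gsum chi D = gsum psi D) ->
  fixdim chi H = fixdim psi H.
Proof.
move=> sHS eqg; rewrite !fixdim_gsum; congr (_ * _)%R; apply: eq_bigr => D sDH.
have [cycD | ncD] := boolP (cyclic D); first by rewrite eqg ?(subset_trans sDH).
by rewrite /gsum !big_pred0 // => x; apply: contraNF ncD => /eqP->; apply: cycle_cyclic.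
Qed.

Lemma gsum1 chi (C : {group gT}) : C :=: 1 -> gsum chi C = chi 1.
Proof.
move=> C1; rewrite /gsum (big_pred1 1) // => x.
by rewrite /generator C1 eq_sym cycle_eq1.
Qed.

Variable p : nat.
Hypothesis p_pr : prime p.

Section Cyclic.

Variables C L : {group gT}.
Hypotheses (cycC : cyclic C) (pC : p.-group C) (sLC : L \subset C).
Hypothesis iL : #|C : L| = p.

(** The subgroups of C form a chain, whose last step is L. *)
Lemma cyclic_generatorE x : generator C x = (x \in C) && (x \notin L).
Proof.
have [Cx | C'x] := boolP (x \in C); last first.
  by apply: contraNF C'x => /eqP->; apply: cycle_id.
rewrite /= -cycle_subG; have sxC : <[x]> \subset C by rewrite cycle_subG.
rewrite -(cardSg_cyclic cycC) // /generator eq_sym eqEcard sxC /= leqNgt.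
have oC : #|C| = (#|L| * p)%N by rewrite -iL Lagrange.
congr (~~ _); apply/idP/idP=> [ltxC | /dvdn_leq lexL]; last first.
  apply: leq_ltn_trans (lexL (cardG_gt0 L)) _.
  by rewrite oC ltn_Pmulr ?prime_gt1 ?cardG_gt0.
have [n oCn] := p_natP pC.
have := cardSg sxC; rewrite oCn => /(dvdn_pfactor _ _ p_pr)[m _ oxm].
have := cardSg sLC; rewrite oCn => /(dvdn_pfactor _ _ p_pr)[k _ oLk].
rewrite oLk oxm dvdn_exp2l //; move: ltxC.
by rewrite oC oLk oxm -expnSr ltn_exp2l ?prime_gt1.
Qed.

Lemma gsum_cyclic chi :
  gsum chi C = (#|C|%:R * fixdim chi C - #|L|%:R * fixdim chi L)%R.
Proof.
rewrite /fixdim !mulVKf ?natrG_neq0 //.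
rewrite (big_setID L) /= (setIidPr sLC) addrC addrK.
by apply: eq_bigl => x; rewrite cyclic_generatorE inE andbC.
Qed.

End Cyclic.

Lemma exists_index_p C :
  p.-group C -> C :!=: 1 -> exists2 L : {group gT}, L <| C & #|C : L| = p.
Proof.
move=> pC ntC; have [n oC] := p_natP pC.
have n_gt0 : (0 < n)%N by move: ntC; rewrite trivg_card1 oC; case: (n).
have len : (n.-1 <= logn p #|C|)%N by rewrite oC pfactorK ?leq_pred.
have [L [sLC nLC oL]] := normal_pgroup pC (normal_refl C) len; exists L => //.
by rewrite -divgS // oC oL -(prednK n_gt0) expnS mulnK ?expn_gt0 ?prime_gt0.
Qed.

(** Artin's induction theorem: the characters induced from the cyclic groups D by
    |D| Psi, restricted to the generators of D, add up to |S| Psi, since every s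
    in S contributes Psi x through the group D generated by x ^ s. *)
Lemma vchar_artin (S : {group gT}) (Psi : gT -> R) :
    {in S &, forall x y, Psi (x ^ y) = Psi x} ->
    (forall D, D \subset S -> cyclic D ->
       vchar D (fun x => #|D|%:R * (if generator D x then Psi x else 0))%R) ->
  vchar S (fun x => #|S|%:R * Psi x)%R.
Proof.
move=> cPsi vPsi.
pose psi D x : R := (#|D|%:R * (if generator D x then Psi x else 0))%R.
apply: (@eq_vchar _ _ _ (fun x => \sum_(D : {group gT} | (D \subset S) && cyclic D)
   ind_char S D (psi D) x)%R) => [x Sx|]; last first.
  by apply: vchar_sum => D /andP[sDS cycD]; apply: vchar_ind => //; apply: vPsi.
transitivity (\sum_(s in S) Psi x)%R; last by rewrite sumr_const mulr_natl.
rewrite /ind_char (eq_bigr (fun D : {group gT} =>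
   \sum_(s in S) (if <[x ^ s]>%G == D then Psi x else 0)))%R.
  rewrite exchange_big; apply: eq_bigr => s Ss /=.
  have sxS : <[x ^ s]> \subset S by rewrite cycle_subG groupJ.
  rewrite (bigD1 <[x ^ s]>%G) /= ?sxS ?cycle_cyclic // eqxx big1 ?addr0 //.
  by move=> D /andP[_]; rewrite eq_sym => /negPf->.
move=> D /andP[sDS cycD]; rewrite big_mkcondr mulr_sumr.
apply: eq_bigr => s Ss; rewrite /psi /generator.
have -> : (<[x ^ s]>%G == D) = (gval D == <[x ^ s]>) by rewrite eq_sym -val_eqE.
have [DE | _] := eqVneq (gval D) <[x ^ s]>; last by case: ifP; rewrite ?mulr0.
have -> : x ^ s \in D by rewrite DE cycle_id.
by rewrite mulKf ?natrG_neq0 // cPsi.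
Qed.

End GeneratorSums.

(** * Pieces supported on the generators of one cyclic subgroup *)

Section CyclicPieces.

Variables (R : realType) (gT : finGroupType) (p : nat) (S : {group gT}).
Variables (F : fusion_system S) (f : {group gT} -> int) (chi : gT -> R).
Hypotheses (p_pr : prime p) (pS : (p.-group S)%g) (Cf : Cba p F f).
Hypothesis chiE : realizes S f chi.
Implicit Types (C D L : {group gT}).
Local Open Scope group_scope.

Lemma isog_cyclic_Zp (hT : finGroupType) (H : {group hT}) :
  cyclic H -> H \isog Zp #|H|.
Proof. by case/cyclicP=> x ->; rewrite -orderE isog_sym Zp_isog. Qed.

Section NonTrivial.

Variables C L : {group gT}.
Hypotheses (sCS : C \subset S) (cycC : cyclic C) (nLC : L <| C) (iL : #|C : L| = p).

Let pC : p.-group C := pgroupS sCS pS.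
Let sLC : L \subset C := normal_sub nLC.
Let oCL : #|C / L| = p. Proof. by rewrite card_quotient ?normal_norm. Qed.
Let oC : #|C| = (#|L| * p)%N. Proof. by rewrite -iL Lagrange. Qed.

(** The order of b divides p - 1, the order of Aut (C / L), and it divides
    f L - f C by the Artin congruence. *)
Let induced_Aut a : F C C a -> exists b : {perm coset_of L},
  [/\ b \in Aut (C / L), {in C, forall x, b (coset L x) = coset L (a x)}
    & b ^+ (gcdn p.-1 (absz (f L - f C)%R)) = 1].
Proof.
move=> Fa; have [aM aI saC] := fs_inj Fa.
have aC x : x \in C -> a x \in C by move=> Cx; rewrite (subsetP saC) ?imset_f.
have [a' Aa' a'E] := exists_Aut aM aI aC.
have Fa' : F C C a' by rewrite (fs_ext F C a'E).
have a'L : a' @: L = L.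
  have FaL : F L C a' by apply: fs_sub sLC Fa'.
  have [_ a'I sa'L] := fs_inj FaL.
  apply/eqP; rewrite -(fimgE FaL) (eq_subG_cyclic cycC) //.
    by rewrite (fimgE FaL) card_in_imset.
  by rewrite (fimgE FaL).
have nLx x : x \in C -> x \in 'N(L) by apply: (subsetP (normal_norm nLC)).
have [x Cx] := cyclicP cycC; have xC : x \in C by rewrite Cx cycle_id.
have [k axk] : exists k, a x = x ^+ k by apply/cycleP; rewrite -Cx aC.
have cosk y : y \in C -> coset L (a y) = coset L y ^+ k.
  move=> Cy; rewrite -morphX ?nLx //; congr coset; move: Cy; rewrite Cx.
  by case/cycleP=> i ->; rewrite (fs_morphX _ Fa xC) axk -!expgM mulnC.
have cop : coprime #|C / L| k.
  rewrite oCL prime_coprime //; apply/negP=> /dvdnP[l kl].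
  have gx : generator C (a x).
    have Fx : F <[x]>%G C a by rewrite -(group_inj Cx : C = <[x]>%G).
    by rewrite /generator -(fs_cycle Fx) -Cx (fs_onto Fa erefl).1.
  have /negP[] : a x \notin L.
    by move: gx; rewrite (cyclic_generatorE p_pr cycC pC sLC iL) => /andP[].
  apply: coset_idr; first by rewrite nLx ?aC.
  rewrite cosk // kl mulnC expgM -oCL expg_cardG ?expg1n //.
  by apply: mem_quotient.
have bM : {in C / L &, {morph expgn^~ k : z t / z * t}}.
  move=> z t Cz Ct; apply: expgMn; apply: (centsP _) Cz _ Ct.
  by apply: cyclic_abelian; apply: quotient_cyclic.
have bI : {in C / L &, injective (expgn^~ k)} := can_in_inj (expgK cop).
have [b Ab bE] : exists2 b : {perm coset_of L}, b \in Aut (C / L) & {in C / L, b =1 expgn^~ k}.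
  by apply: exists_Aut => // z Cz; rewrite groupX.
have bcos : {in C, forall y, b (coset L y) = coset L (a y)}.
  by move=> y Cy; rewrite bE ?mem_quotient // cosk.
exists b; split=> //; apply/eqP; rewrite -order_dvdn dvdn_gcd; apply/andP; split.
  rewrite -(totient_prime p_pr) -oCL -card_Aut_cyclic ?quotient_cyclic //.
  exact: order_dvdG.
have iso : C / L \isog Zp p by rewrite -oCL isog_cyclic_Zp ?quotient_cyclic.
have := Cba_artin Cf nLC sCS iso _ a'L Ab; rewrite inE Aa' Fa'.
move=> /(_ isT) art; have /eqP : (f L = f C %[mod #[b]])%Z.
  by apply: art => y Cy; rewrite bcos // a'E.
by rewrite eqz_mod_dvd /dvdz.
Qed.

(** The order e of the group of automorphisms behind the Gaussian period divides
    p - 1 and f L - f C, hence also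
    p * f C - f L = (p - 1) * f C - (f L - f C). *)
Let period_exists : exists (eta : coset_of L -> R) (k : int),
  [/\ vchar (C / L)%G eta,
      forall a, F C C a -> {in C, forall x, eta (coset L (a x)) = eta (coset L x)}
    & (k%:~R * \sum_(z in ((C / L)^#)%g) eta z = p%:R * (f C)%:~R - (f L)%:~R)%R].
Proof.
have d_even : odd p -> (2 %| gcdn p.-1 (absz (f L - f C)%R))%N.
  move=> p_odd; rewrite dvdn_gcd; apply/andP; split.
    by rewrite dvdn2 -oddS prednK ?prime_gt0.
  apply: (BS_odd (Cba_Borel_Smith Cf) nLC sCS p_pr p_odd).
  by rewrite -oCL isog_cyclic_Zp ?quotient_cyclic.
have [eta [e [e_dvd e_gt0 veta etaI sum_eta]]] := gaussian_period R p_pr oCL d_even.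
have e_dvdp : (e%:Z %| p%:Z * f C - f L)%Z%R.
  move: e_dvd; rewrite dvdn_gcd => /andP[e_p1 e_f].
  have -> : (p%:Z * f C - f L = - (f L - f C) + p.-1%:Z * f C)%R.
    rewrite -{1}(prednK (prime_gt0 p_pr)) -addn1 PoszD; ring.
  have e_fz : (e%:Z %| (f L - f C)%R)%Z by exact: e_f.
  by apply: rpredD; [rewrite rpredN | apply: dvdz_mulr].
have [k kE] := dvdz_real R e_dvdp.
exists eta, (- k)%R; split=> // [a Fa x Cx|].
  by have [b [Ab bE b1]] := induced_Aut Fa; rewrite -bE // etaI ?mem_quotient.
by rewrite sum_eta rmorphN mulrNN kE rmorphB rmorphM.
Qed.

(** Inflate the period from C / L. Since p - Ind_L^C 1 is p on the generators of C
    and 0 elsewhere, |C| theta 1_gen is |L| times an integral multiple of its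
    product with the period. *)
Lemma nontrivial_piece : exists theta : gT -> R,
  [/\ vchar C (fun x => #|C|%:R * (if generator C x then theta x else 0))%R,
      forall a, F C C a -> forall x, generator C x -> theta (a x) = theta x
    & gsum theta C = gsum chi C].
Proof.
have [vchi chiD] := chiE.
have [eta [k [veta etaI sum_eta]]] := period_exists.
exists (fun x => k%:~R * eta (coset L x))%R; split.
- have vq : vchar C (fun x => eta (coset L x)).
    apply: (vchar_morph (f := coset L)) veta => [x y Cx Cy|].
      by rewrite morphM // (subsetP (normal_norm nLC)).
    by rewrite /= /quotient morphimEsub ?normal_norm.
  have vi := vchar_ind sLC (vchar1 R L).
  apply: eq_vchar (vcharZ (#|L|%:Z * k)%R
    (vcharM (vcharB (vcharZ p%:Z (vchar1 R C)) vi) vq)) => x Cx.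
  have -> : ind_char C L (fun=> 1%R : R) x = (if x \in L then p%:R else 0)%R.
    rewrite /ind_char (eq_bigl (fun s => (s \in C) && (x \in L))); last first.
      move=> s; apply: andb_id2l => Cs.
      by rewrite memJ_norm // (subsetP (normal_norm nLC)).
    case: ifP => Lx; last by rewrite big_pred0 ?mulr0 // => s; rewrite andbF.
    rewrite (eq_bigl (mem C)) => [|s]; last by rewrite andbT.
    by rewrite sumr_const oC natrM mulKf ?natrG_neq0.
  rewrite (cyclic_generatorE p_pr cycC pC sLC iL) Cx oC natrM intrM mulr1 -!pmulrn.
  by case: (x \in L) => /=; ring.
- move=> a Fa x; rewrite (cyclic_generatorE p_pr cycC pC sLC iL) => /andP[Cx _].
  by rewrite etaI.
rewrite (gsum_cyclic p_pr cycC pC sLC iL chi) !chiD ?(subset_trans sLC) //.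
rewrite (gsum_cyclic p_pr cycC pC sLC iL) !fixdimZ.
have -> : fixdim (fun x => eta (coset L x)) L = eta 1.
  rewrite (@eq_fixdim _ _ _ (fun=> eta 1%g * 1)%R) ?fixdimZ ?fixdim1 ?mulr1 //.
  by move=> x Lx /=; rewrite coset_id.
have -> : fixdim (fun x => eta (coset L x)) C = fixdim eta (C / L)%G.
  apply: (fixdim_morph (f := coset L)) => [x y Cx Cy|].
    by rewrite morphM // (subsetP (normal_norm nLC)).
  by rewrite /= /quotient morphimEsub ?normal_norm.
rewrite /fixdim /= oCL oC natrM (big_setD1 1) ?group1 //=.
have p0 : (p%:R != 0 :> R)%R by rewrite pnatr_eq0 -lt0n prime_gt0.
transitivity (#|L|%:R * (k%:~R * \sum_(z in ((C / L)^#)%g) eta z))%R; first by field.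
by rewrite sum_eta; ring.
Qed.

End NonTrivial.

Lemma cyclic_piece C : C \subset S -> cyclic C -> exists theta : gT -> R,
  [/\ vchar C (fun x => #|C|%:R * (if generator C x then theta x else 0))%R,
      forall a, F C C a -> forall x, generator C x -> theta (a x) = theta x
    & gsum theta C = gsum chi C].
Proof.
move=> sCS cycC; have [C1 | ntC] := eqVneq (gval C) 1.
  have [vchi chiD] := chiE.
  exists (fun=> (f C)%:~R)%R; split=> //; last first.
    by rewrite !gsum1 // -chiD // fixdim_trivg.
  apply: eq_vchar (vcharZ (f C) (vchar1 R C)) => x; rewrite C1 => /set1P->.
  by rewrite cards1 /generator eq_sym cycle_eq1 eqxx mulr1 mul1r.
have [L nLC iL] := exists_index_p p_pr (pgroupS sCS pS) ntC.
exact: nontrivial_piece nLC iL.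
Qed.

End CyclicPieces.

(** * A stable class function with the sums of a given character *)

Section StablePieces.

Variables (R : realType) (gT : finGroupType) (p : nat) (S : {group gT}).
Variables (F : fusion_system S) (f : {group gT} -> int) (chi : gT -> R).
Hypotheses (p_pr : prime p) (pS : (p.-group S)%g) (Cf : Cba p F f).
Hypothesis chiE : realizes S f chi.
Implicit Types (C D L : {group gT}).
Local Open Scope group_scope.

Lemma fs_conjugate_refl D : D \subset S -> fs_conjugate F D D.
Proof.
by move=> sDS; exists id; split; [|exists id; split=> //]; apply: fs_id.
Qed.

Lemma fs_conjugate_sym C D : fs_conjugate F C D -> fs_conjugate F D C.
Proof. by case=> a [Fa [b [Fb aK bK]]]; exists b; split=> //; exists a. Qed.

Lemma fs_iso_comp B C D a b :
  fs_iso F B C a -> fs_iso F C D b -> fs_iso F B D (b \o a).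
Proof.
case=> [Fa [a' [Fa' aK a'K]]] [Fb [b' [Fb' bK b'K]]].
split; first exact: fs_comp Fa Fb.
have [_ _ /subsetP saC] := fs_inj Fa; have [_ _ /subsetP sbC] := fs_inj Fb'.
exists (a' \o b'); split; first exact: fs_comp Fb' Fa'.
  by move=> x Bx /=; rewrite bK ?aK // saC ?imset_f.
by move=> x Dx /=; rewrite a'K ?b'K // sbC ?imset_f.
Qed.

Lemma fs_conjugate_trans B C D :
  fs_conjugate F B C -> fs_conjugate F C D -> fs_conjugate F B D.
Proof. by case=> a ia [b ib]; exists (b \o a); apply: fs_iso_comp ia ib. Qed.

Lemma fs_iso_im C D a : fs_iso F C D a -> a @: C = D /\ #|C| = #|D|.
Proof.
case=> [Fa [b [Fb aK bK]]]; have [_ aI saD] := fs_inj Fa.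
have [_ _ /subsetP sbC] := fs_inj Fb.
have aCD : a @: C = D.
  apply/eqP; rewrite eqEsubset saD; apply/subsetP=> x Dx.
  by rewrite -(bK x Dx) imset_f // sbC ?imset_f.
by split=> //; rewrite -aCD card_in_imset.
Qed.

Lemma fs_iso_generator C D a x : fs_iso F C D a ->
  x \in C -> generator D (a x) = generator C x.
Proof.
move=> ia Cx; have [aCD _] := fs_iso_im ia; case: ia => [Fa [b [Fb aK bK]]].
have [_ aI _] := fs_inj Fa.
have sxC : <[x]> \subset C by rewrite cycle_subG.
have Fx : F <[x]>%G D a by apply: fs_sub sxC Fa.
rewrite /generator -aCD -(fs_cycle Fx); apply/eqP/eqP=> [e | <- //].
apply/eqP; rewrite eqEsubset sxC andbT; apply/subsetP=> y Cy.
have : a y \in a @: <[x]> by rewrite -e imset_f.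
by case/imsetP=> z xz /aI-> //; apply: subsetP xz.
Qed.

Lemma gsum_iso (psi : gT -> R) C D a : fs_iso F C D a ->
  gsum psi D = (\sum_(x | generator C x) psi (a x))%R.
Proof.
move=> ia; have [Fa [b [Fb aK bK]]] := ia; have [_ _ /subsetP sbC] := fs_inj Fb.
have genD z : generator D z -> z \in D by move=> /eqP->; apply: cycle_id.
rewrite /gsum [LHS](reindex_onto a b) => [|z /genD Dz]; last by rewrite bK.
apply: eq_bigl => y; apply/andP/idP => [[gz /eqP <-] | gy].
  rewrite -(fs_iso_generator ia) ?bK ?genD //; apply: sbC.
  by rewrite imset_f ?genD.
have Cy : y \in C by rewrite (eqP gy) cycle_id.
by rewrite (fs_iso_generator ia) ?gy ?aK.
Qed.

(** Both sums are determined by the values of f at C and at its subgroup of index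
    p. *)
Lemma gsum_conjugate C D : cyclic C -> C \subset S ->
  fs_conjugate F C D -> gsum chi C = gsum chi D.
Proof.
move=> cycC sCS cCD; have [vchi chiD] := chiE.
have eqf := Cba_conjugate Cf cCD.
case: cCD => a ia; have [aCD oCD] := fs_iso_im ia; case: ia => [Fa _].
have [_ sDS] : C \subset S /\ D \subset S by have [sC sD] := fs_obj Fa.
have [C1 | ntC] := eqVneq (gval C) 1.
  by rewrite !gsum1 //; apply/eqP; rewrite trivg_card1 -oCD C1 cards1.
have [L nLC iL] := exists_index_p p_pr (pgroupS sCS pS) ntC.
have sLC := normal_sub nLC.
have [x Cx] := cyclicP cycC.
have cycD : cyclic D.
  have Fx : F <[x]>%G D a by rewrite -(group_inj Cx : C = <[x]>%G).
  by rewrite -aCD Cx (fs_cycle Fx) cycle_cyclic.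
have FL : F L D a := fs_sub sLC Fa.
pose L' := fimg a L; have L'E : L' = a @: L :> {set gT} := fimgE FL.
have [_ aI sL'D] := fs_inj FL.
have oL' : #|L'| = #|L| by rewrite L'E card_in_imset.
have sL'D' : L' \subset D by rewrite L'E.
have iL' : #|D : L'| = p by rewrite -divgS // -oCD oL' divgS.
rewrite (gsum_cyclic p_pr cycC (pgroupS sCS pS) sLC iL).
rewrite (gsum_cyclic p_pr cycD (pgroupS sDS pS) sL'D' iL').
rewrite !chiD ?(subset_trans sLC) ?(subset_trans sL'D') // oCD oL' eqf.
congr (_ - _ * _%:~R)%R; apply: (Cba_conjugate Cf).
exists a; apply: fs_isoP; last by rewrite L'E.
by apply: fs_img FL _ _; rewrite // -L'E (subset_trans sL'D').
Qed.

Definition fs_rep D : {group gT} :=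
  odflt D [pick C | `[< fs_conjugate F D C >]].

Lemma fs_repP D : D \subset S -> fs_conjugate F D (fs_rep D).
Proof.
move=> sDS; rewrite /fs_rep; case: pickP => [C /asboolP // | /(_ D)].
by move/asboolP: (fs_conjugate_refl sDS) => ->.
Qed.

Lemma fs_rep_eq C D : D \subset S -> fs_conjugate F C D -> fs_rep C = fs_rep D.
Proof.
move=> sDS cCD; rewrite /fs_rep.
have -> : [pick B | `[< fs_conjugate F C B >]] = [pick B | `[< fs_conjugate F D B >]].
  apply: eq_pick => B /=; apply/asboolP/asboolP; apply: fs_conjugate_trans => //.
  exact: fs_conjugate_sym.
case: pickP => // /(_ D).
by move/asboolP: (fs_conjugate_refl sDS) => ->.
Qed.

(** Choose theta on one representative of each F-class of cyclic subgroups and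
    transport it to the others. The result does not depend on the isomorphisms
    that are used, since theta is invariant under the F-automorphisms of the
    representative. *)
Lemma stable_pieces : exists Psi : gT -> R,
  [/\ forall P a, F P S a -> {in P, forall x, Psi (a x) = Psi x},
      forall D, D \subset S -> cyclic D ->
        vchar D (fun x => #|D|%:R * (if generator D x then Psi x else 0))%R
    & forall D, D \subset S -> cyclic D -> gsum Psi D = gsum chi D].
Proof.
have /choice[theta thetaP] C : exists theta : gT -> R,
    C \subset S -> cyclic C ->
  [/\ vchar C (fun x => #|C|%:R * (if generator C x then theta x else 0))%R,
      forall a, F C C a -> forall x, generator C x -> theta (a x) = theta x
    & gsum theta C = gsum chi C].
  have [sCS | ] := boolP (C \subset S); last by exists (fun=> 0%R).
  have [cycC | ] := boolP (cyclic C); last by exists (fun=> 0%R).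
  by have [theta thP] := cyclic_piece p_pr pS Cf chiE sCS cycC; exists theta.
have /choice[al alP] D : exists a, D \subset S -> fs_iso F D (fs_rep D) a.
  have [sDS | ] := boolP (D \subset S); last by exists id.
  by have [a ia] := fs_repP sDS; exists a.
pose Psi x := theta (fs_rep <[x]>%G) (al <[x]>%G x).
have PsiE D x : generator D x -> Psi x = theta (fs_rep D) (al D x).
  by move=> /eqP gx; rewrite /Psi -(_ : D = <[x]>%G) //; apply: group_inj.
have rep_sub D : D \subset S -> fs_rep D \subset S.
  by move=> sDS; have [Fa _] := alP D sDS; have [_] := fs_obj Fa.
have rep_cyc D : D \subset S -> cyclic D -> cyclic (fs_rep D).
  move=> sDS /cyclicP[x Dx]; have ia := alP D sDS.
  have : generator (fs_rep D) (al D x).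
    by rewrite (fs_iso_generator ia) ?/generator Dx ?cycle_id.
  by move=> /eqP->; apply: cycle_cyclic.
exists Psi; split.
- move=> P a Fa x Px; have [sPS _] := fs_obj Fa.
  have sxS : <[x]> \subset S by rewrite cycle_subG (subsetP sPS).
  have sxP : <[x]> \subset P by rewrite cycle_subG.
  have Fax := fs_sub sxP Fa.
  have iax : fs_iso F <[x]>%G <[a x]>%G a.
    by apply: (fs_isoP Fax); rewrite (fs_cycle Fax).
  have saxS : <[a x]> \subset S by have [_ ] := fs_obj iax.1.
  have repE := fs_rep_eq saxS (ex_intro _ a iax).
  have ia := alP _ sxS; have iax' := alP _ saxS.
  have [Fal [b [Fb aK bK]]] := ia.
  have Fc := fs_comp (fs_comp Fb iax.1) iax'.1; rewrite -repE in Fc.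
  have cycx := rep_cyc _ sxS (cycle_cyclic x).
  have [_ inv _] := thetaP _ (rep_sub _ sxS) cycx.
  rewrite /Psi -repE -(inv _ Fc (al <[x]>%G x)) /= ?aK ?cycle_id //.
  by rewrite (fs_iso_generator ia) ?cycle_id // /generator.
- move=> D sDS cycD; have ia := alP D sDS; have [aDC oDC] := fs_iso_im ia.
  have [v _ _] := thetaP _ (rep_sub D sDS) (rep_cyc D sDS cycD).
  have [Fa _] := ia; have [aM _ _] := fs_inj Fa.
  apply: eq_vchar (vchar_morph aM _ v) => [x Dx /=|]; last by rewrite aDC.
  by rewrite (fs_iso_generator ia) // -oDC; case: ifP => // /PsiE->.
move=> D sDS cycD; have ia := alP D sDS; have [aDC oDC] := fs_iso_im ia.
have [_ _ gs] := thetaP _ (rep_sub D sDS) (rep_cyc D sDS cycD).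
rewrite (gsum_conjugate cycD sDS (fs_repP sDS)) -gs.
by rewrite /gsum (eq_bigr _ (PsiE D)) -(gsum_iso _ ia).
Qed.

End StablePieces.

(** * Fixed points on cosets *)

Section FixedCosets.

Variables (hT : finGroupType) (G : {group hT}).
Implicit Types (D K N : {group hT}).
Local Open Scope group_scope.

Definition fixc D (K : {set hT}) := #|'Fix_(rcosets D G | 'Rs)(K)|.

(** The coset D g is fixed by K if and only if D contains the conjugate of K by
    g^-1; each fixed coset is counted by its #|D| elements. *)
Lemma fixcE D K : D \subset G -> K \subset G ->
  (#|D| * fixc D K)%N = #|[set g in G | K :^ g \subset D]|.
Proof.
move=> sDG sKG; pose A := [set g in G | K :^ g^-1 \subset D].
have -> : #|[set g in G | K :^ g \subset D]| = #|A|.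
  rewrite -(card_imset _ invg_inj); apply: eq_card => g.
  apply/imsetP/idP=> [[h + ->] | ]; rewrite !inE.
    by rewrite invgK groupV.
  by move=> /andP[Gg sK]; exists g^-1; rewrite ?invgK // inE groupV Gg.
have fixE : 'Fix_(rcosets D G | 'Rs)(K) = [set D :* g | g in A].
  apply/setP=> X; rewrite inE; apply/andP/imsetP.
    case=> /rcosetsP[g Gg ->] /afixP fixX; exists g => //; rewrite inE Gg.
    apply/subsetP=> _ /imsetP[k Kk ->]; have /= := fixX k Kk.
    rewrite rcosetE -rcosetM => /rcoset_eqP; rewrite mem_rcoset.
    by rewrite conjgE invgK mulgA.
  case=> g; rewrite inE => /andP[Gg sK] ->; split.
    by apply/rcosetsP; exists g.
  apply/afixP=> k Kk /=; rewrite rcosetE -rcosetM; apply/rcoset_eqP.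
  rewrite mem_rcoset -mulgA; have := subsetP sK (k ^ g^-1).
  by rewrite memJ_conjg conjgE invgK => /(_ Kk).
rewrite /fixc fixE -[RHS]sum1_card (partition_big_imset (fun g => D :* g)) /=.
rewrite mulnC -sum_nat_const; apply: eq_bigr => _ /imsetP[h + ->].
rewrite inE => /andP[Gh sK]; rewrite sum1dep_card -(card_rcoset D h).
apply: eq_card => g; apply/idP/idP => [/rcosetP[d Dd ->] | ]; last first.
  by rewrite inE => /andP[_ /eqP <-]; apply: rcoset_refl.
have Adh : d * h \in A.
  rewrite inE groupM //=; last exact: subsetP sDG d Dd.
  by rewrite invMg conjsgM -(conjGid (groupVr Dd)) conjSg.
by rewrite inE Adh rcosetM rcoset_id // eqxx.
Qed.

Lemma fixcJ D K g : D \subset G -> K \subset G -> g \in G ->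
  fixc D (K :^ g) = fixc D K.
Proof.
move=> sDG sKG Gg; apply/eqP; rewrite -(eqn_pmul2l (cardG_gt0 D)).
have sKgG : (K :^ g)%G \subset G by rewrite -(normsP (normG G) g Gg) conjSg.
rewrite (fixcE sDG sKG) (fixcE sDG sKgG) -(card_imset _ (mulgI g)).
apply/eqP/eq_card => h; rewrite !inE; apply/imsetP/andP=> [[h' + ->] | [Gh sK]].
  by rewrite inE conjsgM => /andP[Gh' sK]; rewrite groupM.
exists (g^-1 * h); rewrite ?mulKVg // inE groupM ?groupV //.
by rewrite -conjsgM mulKVg.
Qed.

Lemma fixc_sub D K : D \subset G -> K \subset G -> fixc D K != 0%N ->
  exists2 g, g \in G & K :^ g \subset D.
Proof.
move=> sDG sKG nz; have : (0 < #|[set g in G | K :^ g \subset D]|)%N.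
  by rewrite -fixcE // muln_gt0 cardG_gt0 lt0n.
by case/card_gt0P=> g; rewrite inE => /andP[]; exists g.
Qed.

Lemma fixc_id K : K \subset G -> fixc K K = #|'N_G(K) : K|.
Proof.
move=> sKG; apply/eqP; rewrite -(eqn_pmul2l (cardG_gt0 K)) fixcE //.
rewrite Lagrange ?subsetI ?sKG ?normG //; apply/eqP/eq_card => g.
by rewrite !inE.
Qed.

(** Apply orbit counting to the action of N on the fixed points of K: the fixed
    points of n among them are the fixed points of K and n together. *)
Lemma fixc_Burnside D K N : N \subset G -> K <| N ->
  (#|N| %| \sum_(n in N) fixc D (K <*> <[n]>))%N.
Proof.
move=> sNG nKN; pose X := 'Fix_(rcosets D G | 'Rs)(K).
have sKN := normal_sub nKN.
have actN : [acts N, on X | 'Rs].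
  apply: subset_trans (astabsI _ _ _); rewrite subsetI; apply/andP; split.
    exact: subset_trans sNG (actsRs_rcosets D G).
  exact: acts_fix_norm (normal_norm nKN).
have <- : (\sum_(n in N) #|'Fix_(X | 'Rs)[n]| = \sum_(n in N) fixc D (K <*> <[n]>))%N.
  apply: eq_bigr => n Nn; rewrite /fixc /X -setIA; congr #|pred_of_set (_ :&: _)|.
  by rewrite afix_gen afixU afix_cycle.
by rewrite (Frobenius_Cauchy actN) dvdn_mull.
Qed.

End FixedCosets.

(** * Receptive morphisms *)

Section Receptive.

Variables (gT : finGroupType) (p : nat) (S : {group gT}) (F : fusion_system S).
Hypotheses (p_pr : prime p) (pS : (p.-group S)%g) (satF : saturated F p).
Implicit Types (P Q : {group gT}).
Local Open Scope group_scope.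

Lemma fully_normalized_exists Q : Q \subset S ->
  exists2 P, fs_conjugate F Q P & fully_normalized F P.
Proof.
move=> sQS; have QQ : `[< fs_conjugate F Q Q >] by apply/asboolP/fs_conjugate_refl.
case: (@arg_maxnP _ Q (fun P => `[< fs_conjugate F Q P >]) (fun P => #|'N_S(P)|) QQ).
move=> P /asboolP QP maxP; exists P => //; split.
  by case: QP => a [/fs_obj[]].
move=> T PT; apply: maxP; apply/asboolP; exact: fs_conjugate_trans QP PT.
Qed.

(** Carry Q to a fully normalized conjugate P by some t. This takes Aut_S(Q) to a
    p-subgroup W of Aut_F(P), in which Aut_S(P) is a Sylow subgroup; correct t by
    an automorphism that conjugates W into it. *)
Lemma receptive_exists Q : Q \subset S -> exists (P : {group gT}) (t : gT -> gT),
  [/\ F Q S t, t @: Q = P, fully_centralized F P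
    & forall v, v \in 'N_S(Q) -> exists2 y, y \in 'N_S(P)
        & {in Q, forall u, t (u ^ v) = t u ^ y}].
Proof.
move=> sQS; have [P [t it] fnP] := fully_normalized_exists sQS.
have [/(_ P fnP)[fcP sylP] _] := satF.
have [Ft [s [Fs tK sK]]] := it; have [tQP oQP] := fs_iso_im it.
have [sPS _] := fcP; have [tM tI _] := fs_inj Ft.
have tP u : u \in Q -> t u \in P by move=> Qu; rewrite -tQP imset_f.
have sQ x : x \in P -> s x \in Q.
  have [_ _ /subsetP sPQ] := fs_inj Fs.
  by move=> Px; rewrite sPQ ?imset_f.
have [G GE] : exists G : {group {perm gT}}, fs_Aut F P = G.
  by exists (Group (fs_Aut_group_set F sPS)).
have GP a : (a \in G) = (a \in Aut P) && (F P P a) by rewrite -GE inE.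
rewrite GE in sylP.
have gW : group_set [set a in G | [exists v in 'N_S(Q),
                       [forall u in Q, a (t u) == t (u ^ v)]]].
  apply/group_setP; split.
    rewrite inE group1; apply/exists_inP; exists 1; rewrite ?group1 //.
    by apply/forall_inP=> u _; rewrite perm1 conjg1.
  move=> a b; rewrite !inE => /andP[Ga /exists_inP[v Nv /forall_inP av]].
  move=> /andP[Gb /exists_inP[w Nw /forall_inP bw]]; rewrite groupM //.
  apply/exists_inP; exists (v * w); rewrite ?groupM //.
  apply/forall_inP=> u Qu; rewrite permM (eqP (av u Qu)) conjgM.
  have [_ nQv] := setIP Nv; have Quv : u ^ v \in Q by rewrite memJ_norm.
  by rewrite (eqP (bw _ Quv)).
pose W := Group gW.
have WP a : a \in W -> a \in G /\ exists2 v, v \in 'N_S(Q)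
     & {in Q, forall u, a (t u) = t (u ^ v)}.
  rewrite inE => /andP[Ga /exists_inP[v Nv /forall_inP av]]; split=> //.
  by exists v => // u /av/eqP.
have sWG : W \subset G by apply/subsetP=> a /WP[].
have pW : p.-group W.
  apply/pgroupP=> q q_pr /(Cauchy q_pr)[a Wa oa].
  have [Ga [v Nv av]] := WP a Wa.
  have aX n : {in Q, forall u, (a ^+ n) (t u) = t (u ^ (v ^+ n))}.
    have [_ nQv] := setIP Nv.
    elim: n => [|n IHn] u Qu; first by rewrite perm1 conjg1.
    by rewrite expgSr permM IHn // av ?memJ_norm ?groupX // -conjgM -expgSr.
  have : a ^+ #|S| = 1.
    move: Ga; rewrite GP => /andP[Aa _].
    apply: (eq_Aut (groupX _ Aa) (group1 _)) => x Px.
    rewrite perm1 -(sK x Px) aX ?sQ // expg_cardG ?conjg1 //.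
    by have [] := setIP Nv.
  by move/eqP; rewrite -order_dvdn oa => q_dvd; apply: (pgroupP pS).
have [a Ga sWa] := Sylow_subJ sylP sWG pW.
have [Aa Fa] : a \in Aut P /\ F P P a by apply/andP; rewrite -GP.
have Fa' : F P P (a^-1)%g.
  by have := groupVr Ga; rewrite GP => /andP[].
exists P, (a^-1%g \o t).
have Fat : F Q P (a^-1%g \o t) := fs_comp Ft Fa'.
have imat : (a^-1%g \o t) @: Q = P by have [] := fs_onto Fat oQP.
split=> //; first by apply: fs_img Fat _ (subxx S); rewrite imat.
move=> v Nv; have [Sv nQv] := setIP Nv.
pose h x := t (s x ^ v).
have nQuv u : u \in Q -> u ^ v \in Q by move=> Qu; rewrite memJ_norm.
have Fh : F P P h.
  apply: (@fs_comp _ _ _ _ Q _ (fun x => s x ^ v) t) => //.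
  apply: (@fs_comp _ _ _ _ Q _ s (conjg^~ v)) => //.
  by apply: fs_conj => //; rewrite (normP nQv).
have [hM hI /subsetP hP] := fs_inj Fh.
have [w Aw wE] : exists2 w : {perm gT}, w \in Aut P & {in P, w =1 h}.
  by apply: exists_Aut => // x Px; rewrite hP ?imset_f.
have Ww : w \in W.
  rewrite inE GP Aw (fs_ext F P wE) Fh /=.
  apply/exists_inP; exists v => //; apply/forall_inP=> u Qu.
  by rewrite wE ?tP // /h tK.
have /imsetP[c] := subsetP sWa w Ww.
case/morphimP=> y nPy Ny -> wc.
exists y => // u Qu /=.
have -> : t (u ^ v) = w (t u) by rewrite wE ?tP // /h tK.
rewrite wc conjgE !permM permK.
have Pau : a^-1 (t u) \in P.
  have [_ _ /subsetP sa'] := fs_inj Fa'.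
  by apply: sa'; apply: imset_f; apply: tP.
by rewrite norm_conj_autE.
Qed.

End Receptive.

(** * Marks of twisted diagonals *)

Section TwistedDiagonals.

Variables (gT : finGroupType) (p : nat) (S : {group gT}) (F : fusion_system S).
Hypotheses (p_pr : prime p) (pS : (p.-group S)%g) (satF : saturated F p).
Implicit Types (P Q : {group gT}) (D E K N : {group gT * gT}) (t : gT -> gT).
Implicit Types (c : {group gT * gT} -> int).
Local Open Scope group_scope.

Let SS := setX_group S S.

(** The first coordinate of E lies in the image of t, and the second one in the
    source: with this convention the transitive biset (S x S) / E has its source
    on the right, and stability is tested by moving the first coordinate. *)
Definition twisted E Q t :=
  F Q S t /\ E = [set (t u, u) | u in Q] :> {set gT * gT}.

Lemma twisted_mem E Q t x u :
  twisted E Q t -> ((x, u) \in E) = (u \in Q) && (x == t u).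
Proof.
case=> _ ->; apply/imsetP/andP=> [[v Qv [-> ->]] | [Qu /eqP->]]; last by exists u.
by rewrite Qv eqxx.
Qed.

Lemma twisted_exists Q t : F Q S t -> exists E, twisted E Q t.
Proof.
move=> Ft; have [tM _ _] := fs_inj Ft.
have gE : group_set [set (t u, u) | u in Q].
  apply/group_setP; split.
    by apply/imsetP; exists 1; rewrite ?group1 // (fs_morph1 Ft).
  move=> _ _ /imsetP[u Qu ->] /imsetP[v Qv ->]; apply/imsetP.
  by exists (u * v); rewrite ?groupM // tM.
by exists (Group gE).
Qed.

Lemma twisted_sub E Q t : twisted E Q t -> E \subset SS.
Proof.
move=> tE; have [Ft _] := tE; have [sQS _] := fs_obj Ft.
have [_ _ /subsetP stS] := fs_inj Ft.
apply/subsetP=> -[x u]; rewrite (twisted_mem _ _ tE) => /andP[Qu /eqP->].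
by rewrite inE /= stS ?imset_f // (subsetP sQS).
Qed.

Lemma twisted_card E Q t : twisted E Q t -> #|E| = #|Q|.
Proof. by case=> _ ->; rewrite card_imset // => u v []. Qed.

Lemma twisted_eq E E' Q t t' : twisted E Q t -> twisted E' Q t' ->
  {in Q, t =1 t'} -> E = E'.
Proof.
move=> [_ EE] [_ E'E] eqt; apply: group_inj; rewrite EE E'E.
by apply: eq_in_imset => u Qu /=; rewrite eqt.
Qed.

Lemma twisted_subgroup E K Q t : twisted E Q t -> K \subset E ->
  exists2 Q' : {group gT}, Q' \subset Q & twisted K Q' t.
Proof.
move=> tE sKE; have [Ft _] := tE; have [tM _ _] := fs_inj Ft.
have gQ : group_set [set u in Q | (t u, u) \in K].
  apply/group_setP; split; first by rewrite inE group1 (fs_morph1 Ft) group1.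
  move=> u v /setIdP[Qu Ku] /setIdP[Qv Kv]; rewrite inE groupM // tM //=.
  exact: (groupM Ku Kv).
have sQ : Group gQ \subset Q by apply/subsetP=> u /setIdP[].
exists (Group gQ) => //; split; first exact: fs_sub sQ Ft.
apply/setP=> -[x u]; apply/idP/imsetP=> [Kxu | [v /setIdP[_ Kv] ->] //].
have := subsetP sKE _ Kxu; rewrite (twisted_mem _ _ tE) => /andP[Qu /eqP xt].
by exists u; rewrite ?inE -xt // Qu.
Qed.

Lemma twistedJ E Q t g : twisted E Q t -> g \in SS ->
  twisted (E :^ g)%G (Q :^ g.2)%G (fun u => t (u ^ g.2^-1) ^ g.1).
Proof.
case: g => s v tE /setXP[/= Ss Sv]; have [Ft EE] := tE.
have [sQS _] := fs_obj Ft; have [_ _ stS] := fs_inj Ft.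
have sQvS : Q :^ v \subset S by rewrite -(normsP (normG S) v Sv) conjSg.
split; last first.
  rewrite /= EE; apply/setP=> z; apply/imsetP/imsetP=> [[_ /imsetP[u Qu ->] ->] | [w]].
    exists (u ^ v); first by rewrite memJ_conjg.
    by rewrite conjgK !conjgE.
  case/imsetP=> u Qu -> ->; exists (t u, u); first by rewrite imset_f.
  by rewrite conjgK !conjgE.
apply: (fs_comp (Q := S) (f := fun u => t (u ^ v^-1)) (g := conjg^~ s)); last first.
  by apply: fs_conj; rewrite ?conjGid.
apply: fs_comp (_ : F _ Q (conjg^~ v^-1)) Ft.
by apply: fs_conj; rewrite ?groupV // -conjsgM mulgV conjsg1.
Qed.

(** The number of fixed points of K on the virtual S x S-set that contains the
    transitive set (S x S) / D with multiplicity c D. *)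
Definition marks c (K : {set gT * gT}) : int :=
  (\sum_(D : {group gT * gT}) c D * (fixc SS D K)%:Z)%R.

Definition admissible c := forall D, c D != 0%R -> exists Q t, twisted D Q t.

(** A set is stable under F on its first side when its marks at the twisted
    diagonals over Q do not depend on the twist. *)
Definition stable_at c Q := forall E E' t t',
  twisted E Q t -> twisted E' Q t' -> marks c E = marks c E'.

Section Marks.

Variable c : {group gT * gT} -> int.
Hypothesis adm_c : admissible c.

Lemma adm_sub D : c D != 0%R -> D \subset SS.
Proof. by case/adm_c=> Q [t tD]; apply: twisted_sub tD. Qed.

Lemma marksJ K g : K \subset SS -> g \in SS -> marks c (K :^ g) = marks c K.
Proof.
move=> sKS Sg; apply: eq_bigr => D _; have [-> | cD] := eqVneq (c D) 0%R.
  by rewrite !mul0r.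
by rewrite fixcJ // adm_sub.
Qed.

(** A subgroup that has fixed points is conjugate to a subgroup of some twisted
    diagonal D. *)
Lemma marks_twisted K : K \subset SS -> marks c K != 0%R ->
  exists Q t, twisted K Q t.
Proof.
move=> sKS nz; have [D cD fixD] : exists2 D, c D != 0%R & fixc SS D K != 0%N.
  have /existsP[D] : [exists D, (c D * (fixc SS D K)%:Z)%R != 0%R].
    rewrite -negb_forall; apply: contraNN nz => /forallP all0.
    by apply/eqP; apply: big1 => D _; apply/eqP.
  by rewrite mulf_eq0 negb_or => /andP[cD fD]; exists D.
have [Q [t tD]] := adm_c cD.
have [g Sg sKgD] := fixc_sub (twisted_sub tD) sKS fixD.
have [Q' _ tKg] := twisted_subgroup (K := (K :^ g)%G) tD sKgD.
have := twistedJ tKg (groupVr Sg); set Q2 := (Q' :^ _)%G; set t2 := fun _ => _.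
have -> : ((K :^ g) :^ g^-1)%G = K by apply: group_inj; rewrite /= -conjsgM mulgV conjsg1.
by exists Q2, t2.
Qed.

Lemma marks_Burnside K N : N \subset SS -> K <| N ->
  (#|N| %| (\sum_(n in N) marks c (K <*> <[n]>))%R)%Z.
Proof.
move=> sNS nKN; rewrite exchange_big /=; apply: rpred_sum => D _.
rewrite -mulr_sumr; apply: dvdz_mull.
have -> : (\sum_(n in N) (fixc SS D (K <*> <[n]>))%:Z =
  (\sum_(n in N) fixc SS D (K <*> <[n]>))%N%:Z)%R.
  by rewrite (big_morph Posz PoszD (erefl _)).
exact: fixc_Burnside.
Qed.

End Marks.
Section Congruence.

Variables (c : {group gT * gT} -> int) (Q : {group gT}).
Hypotheses (adm_c : admissible c) (sQS : Q \subset S).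
Hypothesis stab_c : forall Q' : {group gT}, (#|Q| < #|Q'|)%N -> stable_at c Q'.

(** Moving first coordinates by beta, an extension of t0 t^-1, maps the normalizer
    N of E isomorphically onto a subgroup that normalizes E0. *)
Section Extension.

Variables (E E0 : {group gT * gT}) (t t0 : gT -> gT).
Hypotheses (tE : twisted E Q t) (tE0 : twisted E0 Q t0).
Variables (dom : {group gT}) (beta : gT -> gT).
Hypotheses (Fbeta : F dom S beta) (beta_t : {in Q, forall u, beta (t u) = t0 u}).

Let N := 'N_SS(E)%G.
Hypothesis domN : forall z, z \in N -> z.1 \in dom.

Let gam (z : gT * gT) := (beta z.1, z.2).

Let gamM : {in N &, {morph gam : x y / x * y}}.
Proof.
have [bM _ _] := fs_inj Fbeta.
by move=> x y Nx Ny; congr (_, _); rewrite bM ?domN.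
Qed.

Let gamI : {in N &, injective gam}.
Proof.
have [_ bI _] := fs_inj Fbeta.
move=> [x1 x2] [y1 y2] Nx Ny [e1 ->]; congr (_, _).
by apply: bI e1; apply: (domN Nx) || apply: (domN Ny).
Qed.

Let gm := Morphism gamM.

Let gam_sub (K : {group gT * gT}) : K \subset N -> gm @* K \subset SS.
Proof.
move=> sKN; apply/subsetP=> _ /morphimP[[x v] Nz _ ->] /=.
have [/setXP[_ Sz] _] := setIP Nz.
have [_ _ /subsetP sbS] := fs_inj Fbeta.
by rewrite /gam inE /= Sz andbT sbS // imset_f // (domN Nz).
Qed.

Let sEN : E \subset N.
Proof. by rewrite subsetI (twisted_sub tE) normG. Qed.

Let gamE : gm @* E = E0.
Proof.
have [_ EE] := tE; have [_ E0E] := tE0.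
rewrite morphimEsub // EE E0E; apply/setP=> z; apply/imsetP/imsetP.
  by case=> _ /imsetP[u Qu ->] ->; exists u; rewrite // /= /gam /= beta_t.
case=> u Qu ->; exists (t u, u); first by rewrite imset_f.
by rewrite /= /gam /= beta_t.
Qed.

Let marks_gam (K : {group gT * gT}) : K \subset N -> (#|Q| < #|K|)%N ->
  marks c (gm @* K) = marks c K.
Proof.
move=> sKN ltQK; have sKS : K \subset SS by apply: subset_trans sKN (subsetIl _ _).
have sgK := gam_sub sKN.
have gK x u : (x, u) \in K -> (beta x, u) \in gm @* K.
  by move=> Kxu; apply: (mem_morphim gm (subsetP sKN _ Kxu) Kxu).
have Kg y u : (y, u) \in gm @* K -> exists2 x, (x, u) \in K & y = beta x.
  by case/morphimP=> -[x v] Nxv Kxv [-> ->]; exists x.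
have dK x u : (x, u) \in K -> x \in dom by move=> Kxu; apply: (domN (subsetP sKN _ Kxu)).
have twK Q' t' : twisted K Q' t' -> twisted (gm @* K)%G Q' (beta \o t').
  move=> tK; have [Ft' _] := tK; split.
    apply: (fs_comp (Q := dom)) Fbeta; have [sdS _] := fs_obj Fbeta.
    apply: fs_img Ft' _ sdS; apply/subsetP=> _ /imsetP[u Qu ->].
    by apply: (dK _ u); rewrite (twisted_mem _ _ tK) Qu eqxx.
  apply/setP=> -[y u]; apply/idP/imsetP => [/Kg[x Kxu ->] | [v Qv [-> ->]]].
    by move: Kxu; rewrite (twisted_mem _ _ tK) => /andP[Qu /eqP->]; exists u.
  by apply: gK; rewrite (twisted_mem _ _ tK) Qv eqxx.
have twgK Q' t' : twisted (gm @* K)%G Q' t' -> exists t'', twisted K Q' t''.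
  move=> tg; have [b' [Fb bK b'K]] := fs_inverse Fbeta.
  have [Ft' _] := tg; have [sdS _] := fs_obj Fbeta.
  have tb u : u \in Q' -> exists2 x, (x, u) \in K & t' u = beta x.
    by move=> Qu; apply: Kg; rewrite (twisted_mem _ _ tg) Qu eqxx.
  exists (b' \o t'); split.
    apply: fs_img (fs_comp (Q := fimg beta dom) _ Fb) _ (subxx S).
      apply: fs_img Ft' _ _; last by have [_] := fs_obj (fs_factor Fbeta).1.
      apply/subsetP=> _ /imsetP[u /tb[x Kxu ->] ->]; rewrite (fimgE Fbeta) imset_f //.
      exact: dK Kxu.
    apply/subsetP=> _ /imsetP[u /tb[x Kxu tu] ->] /=.
    by rewrite tu bK ?(dK _ _ Kxu) // (subsetP sdS) ?(dK _ _ Kxu).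
  apply/setP=> -[x u]; apply/idP/imsetP => [Kxu | [v /tb[y Kyv tv] [-> ->]] /=].
    have := gK _ _ Kxu; rewrite (twisted_mem _ _ tg) => /andP[Qu /eqP bx].
    by exists u; rewrite //= -bx bK ?(dK _ _ Kxu).
  by rewrite tv bK ?(dK _ _ Kyv).
have [m0 | nz] := eqVneq (marks c K) 0%R; last first.
  have [Q' [t' tK]] := marks_twisted adm_c sKS nz.
  have tg := twK _ _ tK; apply: (stab_c _ tg tK).
  by rewrite -(twisted_card tK).
rewrite m0; apply/eqP; apply/negPn/negP=> nz; case/negP: (nz); apply/eqP.
have [Q' [t' tg]] := marks_twisted (K := (gm @* K)%G) adm_c sgK nz.
have [t'' tK] := twgK _ _ tg; rewrite -m0; apply: (stab_c _ tg tK).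
by rewrite -(twisted_card tK).
Qed.

(** The Burnside congruences for E < N and for the images of both under beta have
    the same terms, except those of the elements of E, since the other terms are
    marks of larger subgroups, where c is stable. The difference of the two is
    therefore #|E| times the difference of the marks, and divisible by #|N|. *)
Lemma extension_congruence :
  (#|'N_SS(E) : E| %| (marks c E0 - marks c E)%R)%Z.
Proof.
have nEN : E <| N by rewrite /normal sEN subsetIr.
have sNS : N \subset SS := subsetIl _ _.
have oN : #|gm @* N| = #|N| by rewrite morphimEdom card_in_imset.
have B1 := marks_Burnside c sNS nEN.
have B2 : (#|N| %| (\sum_(n in N) marks c (gm @* (E <*> <[n]>)))%R)%Z.
  have nE0 : E0 <| gm @* N by rewrite -gamE morphim_normal.
  have := marks_Burnside c (gam_sub (subxx N)) nE0; rewrite oN.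
  have eN n : (n \in (gm @* N)%G) = (n \in gam @: N) by rewrite /= morphimEdom.
  rewrite (eq_bigl _ _ eN) big_imset //=; congr (_ %| _)%Z; apply: eq_bigr => n Nn.
  by rewrite morphimY ?cycle_subG // gamE morphim_cycle.
have key : (\sum_(n in N) marks c (gm @* (E <*> <[n]>)) -
   \sum_(n in N) marks c (E <*> <[n]>) = #|E|%:Z * (marks c E0 - marks c E))%R.
  rewrite -sumrB (big_setID E) /= (setIidPr sEN) [X in (_ + X)%R]big1 ?addr0.
    rewrite (eq_bigr (fun=> marks c E0 - marks c E)%R).
      by rewrite sumr_const -mulr_natl natz.
    by move=> n En; rewrite (joing_idPl _) ?cycle_subG // gamE.
  move=> n /setDP[Nn E'n]; apply/eqP; rewrite subr_eq0.
  rewrite (marks_gam (K := (E <*> <[n]>)%G)) ?join_subG ?sEN ?cycle_subG //.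
  rewrite -(twisted_card tE) proper_card // properE joing_subl /=.
  by rewrite join_subG subxx cycle_subG.
have := rpredB B2 B1; rewrite key -(Lagrange sEN) PoszM.
by rewrite dvdz_mul2l // -lt0n.
Qed.

End Extension.

(** For E0 take the graph of the receptive morphism t0. The first coordinate of an
    element of the normalizer of E normalizes the image of t and acts on it as
    the second one acts on Q, hence is in the domain to which t0 t^-1 extends by
    saturation. *)
Lemma twisted_congruence : exists E0 t0, twisted E0 Q t0 /\
  forall E t, twisted E Q t -> (#|'N_SS(E) : E| %| (marks c E0 - marks c E)%R)%Z.
Proof.
have [P [t0 [Ft0 t0Q fcP recept]]] := receptive_exists pS satF sQS.
have [E0 tE0] := twisted_exists Ft0; exists E0, t0; split=> // E t tE.
have [Ft EE] := tE; have [s [Fs tK sK]] := fs_inverse Ft.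
pose T := fimg t Q; have TE : T = t @: Q :> {set gT} := fimgE Ft.
pose chi := t0 \o s.
have Fchi : F T S chi := fs_comp Fs Ft0.
have imchi : fimg chi T = P.
  apply: group_inj; rewrite (fimgE Fchi) TE -t0Q; apply/setP=> y.
  apply/imsetP/imsetP=> [[_ /imsetP[u Qu ->] ->] | [u Qu ->]].
    by exists u; rewrite // /chi /= tK.
  by exists (t u); rewrite ?imset_f // /chi /= tK.
have [|beta Fbeta betaE] := satF.2 T chi Fchi; first by rewrite imchi.
apply: (extension_congruence tE tE0 Fbeta) => [u Qu | z].
  by rewrite betaE ?TE ?imset_f // /chi /= tK.
case: z => x v /setIP[/setXP[/= Sx Sv] /normP nEz].
have act u : u \in Q -> (u ^ v \in Q) /\ (t u) ^ x = t (u ^ v).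
  move=> Qu; have : (t u, u) ^ (x, v) \in E.
    by rewrite -nEz memJ_conjg (twisted_mem _ _ tE) Qu eqxx.
  have -> : (t u, u) ^ (x, v) = ((t u) ^ x, u ^ v) by rewrite !conjgE.
  by rewrite (twisted_mem _ _ tE) => /andP[? /eqP].
have nQv : v \in 'N(Q).
  by rewrite inE; apply/subsetP=> _ /imsetP[u Qu ->]; have [] := act u Qu.
have [y Ny yE] := recept v (introT setIP (conj Sv nQv)).
rewrite inE; apply/andP; split.
  rewrite inE Sx inE; apply/subsetP=> _ /imsetP[w + ->].
  rewrite TE => /imsetP[u Qu ->]; have [Quv ->] := act u Qu.
  by rewrite imset_f.
apply/exists_inP; exists y; first by rewrite imchi.
apply/forall_inP=> w; rewrite TE => /imsetP[u Qu ->].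
by have [Quv ->] := act u Qu; rewrite /chi /= !tK // yE.
Qed.

End Congruence.

End TwistedDiagonals.

(** * A stable virtual biset *)

Section StableBiset.

Variables (gT : finGroupType) (p : nat) (S : {group gT}) (F : fusion_system S).
Hypotheses (p_pr : prime p) (pS : (p.-group S)%g) (satF : saturated F p).
Implicit Types (P Q : {group gT}) (D E K N : {group gT * gT}) (t : gT -> gT).
Implicit Types (c : {group gT * gT} -> int).
Local Open Scope group_scope.

Let SS := setX_group S S.

(** The number of orbits of the second factor S, which acts freely. *)
Definition weight c : int := (\sum_(D : {group gT * gT}) c D * (#|S| %/ #|D|)%:Z)%R.

(** The graphs of the automorphisms in a transversal T of Aut_S(S) in Aut_F(S)
    represent the S x S-classes of twisted diagonals over S. The set with one
    orbit for each of them has weight #|A : B|, prime to p by the Sylow axiom,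
    and the mark #|'Z(S)| at every twisted diagonal over S. *)
Section Base.

Let A : {group {perm gT}} := Group (fs_Aut_group_set F (subxx S)).
Let B := [group of S_Aut S S].

Let AP a : (a \in A) = (a \in Aut S) && F S S a.
Proof. by rewrite inE. Qed.

Let sylB : p.-Sylow(A) B.
Proof.
have fnS : fully_normalized F S.
  by split=> // Q _; rewrite (setIidPl (normG S)) subset_leq_card ?subsetIl.
by have [_] := satF.1 S fnS.
Qed.

Let BE x : x \in S -> conj_aut S x \in B.
Proof.
move=> Sx; have Nx := subsetP (normG S) x Sx.
by apply: mem_morphim => //; apply/setIP.
Qed.

(* The generated group only serves to have a group at hand. *)
Let graph (a : {perm gT}) := [group of <<[set (a u, u) | u in S]>>].

Let graphP a : a \in A -> twisted F (graph a) S a.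
Proof.
rewrite AP => /andP[_ Fa]; split=> //=.
by have [E [_ EE]] := twisted_exists Fa; rewrite -EE genGid.
Qed.

Let graph_inj : {in A &, injective graph}.
Proof.
move=> a b Aa Ab eqg; move: (Aa) (Ab); rewrite !AP => /andP[Sa _] /andP[Sb _].
apply: eq_Aut Sa Sb _ => u Su; apply/eqP.
by rewrite -[_ == _]andTb -Su -(twisted_mem _ _ (graphP Ab)) -eqg
           (twisted_mem _ _ (graphP Aa)) Su eqxx.
Qed.

Let T := [set repr (a *: B) | a in A].

Let sTA : T \subset A.
Proof.
apply/subsetP=> _ /imsetP[a Aa ->].
have /lcosetP[b Bb ->] := mem_repr a (lcoset_refl B a).
by rewrite groupM // (subsetP (pHall_sub sylB)).
Qed.

Let memT a b : a \in A -> b \in B -> (a * b \in T) = (b == a^-1 * repr (a *: B)).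
Proof.
move=> Aa Bb; apply/imsetP/eqP=> [[d Ad abE] | ->]; last by exists a; rewrite ?mulKVg.
have : d *: B = a *: B.
  have := mem_repr d (lcoset_refl B d); rewrite -abE => /lcoset_eqP <-.
  by rewrite lcosetM lcoset_id.
by move=> <-; rewrite -abE mulKg.
Qed.

Let cardT : #|T| = #|A : B|.
Proof.
rewrite -card_lcosets -(card_in_imset (f := repr) (D := lcosets B A)); last first.
  move=> _ _ /lcosetsP[a Aa ->] /lcosetsP[b Ab ->] eqr.
  have := mem_repr a (lcoset_refl B a); rewrite eqr => /lcoset_eqP <-.
  exact/lcoset_eqP/(mem_repr b)/lcoset_refl.
apply: eq_card => d; apply/imsetP/imsetP=> [[a Aa ->] | [_ /lcosetsP[a Aa ->] ->]].
  by exists (a *: B) => //; apply/lcosetsP; exists a.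
by exists a.
Qed.

(** Exactly one element of the coset b B is in T, and conjugation by x is the
    corresponding element of B for x in one coset of the centre. *)
Let transl b : b \in A -> #|[set x in S | b * conj_aut S x \in T]| = #|'Z(S)|.
Proof.
move=> Ab; have /lcosetP[s Bs rE] := mem_repr b (lcoset_refl B b).
have [w Sw sE] : exists2 w, w \in S & s = conj_aut S w.
  by case/morphimP: Bs => w _ /setIP[Sw _] ->; exists w.
have -> : [set x in S | b * conj_aut S x \in T] = 'Z(S) :* w; last exact: card_rcoset.
apply/setP=> x; rewrite inE mem_rcoset inE groupMr ?groupV //.
have [Sx | //] := boolP (x \in S); rewrite memT ?BE // rE mulKg sE /=.
have nS := subsetP (normG S).
rewrite -mem_rcoset -(ker_conj_aut S).
by apply/eqP/rcoset_kerP; rewrite ?nS.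
Qed.

Let reps := [set graph a | a in T].
Let base D : int := (D \in reps)%:Z.

Let twisted_graph D t : twisted F D S t -> exists2 a, a \in A & D = graph a.
Proof.
move=> tD; have [Ft _] := tD; have [tM tI stS] := fs_inj Ft.
have [a Sa aE] : exists2 a : {perm gT}, a \in Aut S & {in S, a =1 t}.
  by apply: exists_Aut => // x Sx; rewrite (subsetP stS) ?imset_f.
have Aa : a \in A by rewrite AP Sa (fs_ext F S aE).
by exists a => //; apply: twisted_eq tD (graphP Aa) _ => u Su; rewrite aE.
Qed.

Let graphJ a x v : a \in A -> x \in S -> v \in S ->
  (graph a :^ ((a v * x)%g, v))%G = graph (a * conj_aut S x).
Proof.
move=> Aa Sx Sv; move: (Aa); rewrite AP => /andP[Sa Fa].
have [aM _ /subsetP saS] := fs_inj Fa.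
have Sav u : u \in S -> a u \in S by move=> Su; rewrite saS ?imset_f.
have Aax : a * conj_aut S x \in A.
  by rewrite groupM // (subsetP (pHall_sub sylB)) ?BE.
have gSS : (a v * x, v) \in SS by rewrite inE /= groupM ?Sav.
have := twistedJ (graphP Aa) gSS; set t := fun _ => _.
have -> : (S :^ v)%G = S by apply: group_inj; rewrite /= conjGid.
move=> tgJ; apply: twisted_eq tgJ (graphP Aax) _ => u Su.
rewrite /t /= permM norm_conj_autE ?Sav ?(subsetP (normG S)) //.
by rewrite conjgM -(fs_morphJ Fa) ?conjgKV // memJ_norm ?groupV ?(subsetP (normG S)).
Qed.

Let base_marks a : a \in A -> marks S base (graph a) = #|'Z(S)|%:Z.
Proof.
move=> Aa; have sgr d : d \in A -> graph d \subset SS.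
  by move=> Ad; apply: twisted_sub (graphP Ad).
have ogr d : d \in A -> #|graph d| = #|S| by move=> Ad; apply: twisted_card (graphP Ad).
have repsA D : D \in reps -> exists2 d, d \in A & D = graph d.
  by case/imsetP=> d Td ->; exists d; rewrite ?(subsetP sTA).
have saS v : v \in S -> a v \in S.
  have := Aa; rewrite AP => /andP[_ /fs_inj[_ _ /subsetP sa]] Sv.
  by rewrite sa ?imset_f.
have -> : marks S base (graph a) = (\sum_(D in reps) fixc SS D (graph a))%N%:Z.
  rewrite (big_morph Posz PoszD (erefl _)) [RHS]big_mkcond; apply: eq_bigr => D _.
  by rewrite /base; case: (D \in reps); rewrite ?mul1r ?mul0r.
congr Posz; apply/eqP; rewrite -(eqn_pmul2l (cardG_gt0 S)); apply/eqP.
rewrite big_distrr /=.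
have in_reps g : g \in SS ->
    (\sum_(D in reps) (graph a :^ g \subset D))%N = ((graph a :^ g)%G \in reps).
  move=> SSg; rewrite (eq_bigr (fun D => (D == (graph a :^ g)%G) : nat)).
    have [rg | nrg] := boolP (_ \in reps).
      rewrite (bigD1 _ rg) /= eqxx big1 // => D /andP[_ /negPf->//].
    by rewrite big1 // => D rD; case: eqP => // DE; rewrite -DE rD in nrg.
  move=> D /repsA[d Ad ->]; rewrite -val_eqE /= eq_sym eqEcard cardJg.
  by rewrite !ogr // leqnn andbT.
transitivity (\sum_(g in SS) ((graph a :^ g)%G \in reps))%N.
  rewrite (eq_bigr (fun D : {group gT * gT} => \sum_(g in SS) (graph a :^ g \subset D)))%N.
    by rewrite exchange_big; apply: eq_bigr => g /in_reps.
  move=> _ /repsA[d Ad ->]; rewrite -{1}(ogr d Ad) fixcE ?sgr //.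
  by rewrite -sum1dep_card big_mkcondr; apply: eq_bigr => g _; case: ifP.
transitivity (\sum_(v in S) \sum_(x in S) ((graph a :^ (x, v))%G \in reps))%N.
  rewrite exchange_big pair_big /=.
  by apply: eq_big => [[x v] | [x v] _] //; rewrite inE.
rewrite -sum_nat_const; apply: eq_bigr => v Sv.
rewrite (reindex_inj (mulgI (a v))) /= -(transl Aa) -sum1dep_card big_mkcondr /=.
apply: eq_big => [x | x]; rewrite groupMl ?saS // => Sx.
have Aax : a * conj_aut S x \in A.
  by rewrite groupM // (subsetP (pHall_sub sylB)) ?BE.
rewrite graphJ // (_ : (_ \in reps) = (a * conj_aut S x \in T)); first by case: ifP.
apply/imsetP/idP=> [[d Td eqg] | Tax]; last by exists (a * conj_aut S x).
by rewrite (graph_inj Aax (subsetP sTA d Td) eqg).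
Qed.

Lemma base_biset : exists c, [/\ admissible F c,
    forall Q, (#|S| <= #|Q|)%N -> stable_at F c Q & ~~ (p %| weight c)%Z].
Proof.
exists base; split.
- move=> D; rewrite /base; have [/imsetP[a Ta ->] _ | //] := boolP (D \in reps).
  by exists S, a; apply: graphP; apply: (subsetP sTA).
- move=> Q leSQ E E' t t' tE tE'.
  have QS : Q = S.
    apply/group_inj/eqP; rewrite eqEcard leSQ andbT.
    by have [/fs_obj[]] := tE.
  rewrite QS in tE tE' => {Q QS leSQ}.
  have [a Aa ->] := twisted_graph tE; have [b Ab ->] := twisted_graph tE'.
  by rewrite !base_marks.
have -> : weight base = #|A : B|%:Z.
  rewrite -cardT -(card_in_imset (f := graph) (D := T)); last first.
    by apply: sub_in2 graph_inj; apply/subsetP.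
  rewrite -sum1_card (big_morph Posz PoszD (erefl _)) [RHS]big_mkcond.
  apply: eq_bigr => D _; rewrite /base.
  have [/imsetP[a Ta ->] | _] := boolP (D \in reps); last by rewrite mul0r.
  rewrite (twisted_card (graphP _)) ?(subsetP sTA) //.
  by rewrite divnn cardG_gt0 mul1r.
rewrite dvdzE /=; have /and3P[_ _] := sylB.
by rewrite p'natE ?indexg_gt0.
Qed.

End Base.

(** Adding orbits of types D over subgroups of order k leaves the marks at larger
    subgroups unchanged. To give them the values tg at order k, correct the
    multiplicity of one representative of each conjugacy class by the quotient of
    the defect by the mark #|'N(D) : D| of (S x S) / D at D. *)
Section Step.

Variables (c : {group gT * gT} -> int) (k : nat) (tg : {group gT * gT} -> int).
Hypothesis adm_c : admissible F c.
Hypothesis tgJ : forall E g, E \subset SS -> g \in SS -> tg (E :^ g)%G = tg E.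
Hypothesis tg_dvd : forall E Q t, twisted F E Q t -> #|Q| = k ->
  (#|'N_SS(E) : E| %| (tg E - marks S c E)%R)%Z.

Let rep E := odflt E [pick D : {group gT * gT} | E :^: SS == D :^: SS].

Let repP E : exists2 g, g \in SS & rep E = (E :^ g)%G.
Proof.
rewrite /rep; case: pickP => [D /eqP eqED | _] /=; last first.
  by exists 1 => //; apply: group_inj; rewrite /= conjsg1.
have : (D : {set _}) \in E :^: SS.
  by rewrite eqED; apply/imsetP; exists 1; rewrite ?conjsg1.
by case/imsetP=> g SSg DE; exists g => //; apply: group_inj.
Qed.

Let repJ E g : g \in SS -> rep (E :^ g)%G = rep E.
Proof.
move=> SSg; have eqo : (E :^ g) :^: SS = E :^: SS.
  apply/setP=> X; apply/imsetP/imsetP=> -[h SSh ->].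
    by exists (g * h); rewrite ?groupM // conjsgM.
  by exists (g^-1 * h); rewrite ?groupM ?groupV // -conjsgM mulKVg.
rewrite /rep /= eqo; case: pickP => // /(_ E) /=; by rewrite eqxx.
Qed.

Let good D := `[< exists Q t, twisted F D Q t /\ #|Q| = k >] && (D == rep D).

Let corr D : int :=
  if good D then ((tg D - marks S c D) %/ #|'N_SS(D) : D|)%Z else 0%R.

Let c' D := (c D + corr D)%R.

Let corrP D : corr D != 0%R -> exists Q t, twisted F D Q t /\ #|Q| = k.
Proof. by rewrite /corr /good; case: asboolP => //=; rewrite eqxx. Qed.

Let adm_c' : admissible F c'.
Proof.
move=> D; have [d0 | /corrP[Q [t [tD _]]] _] := eqVneq (corr D) 0%R.
  by rewrite /c' d0 addr0; apply: adm_c.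
by exists Q, t.
Qed.

Let marks_c' E : marks S c' E = (marks S c E + marks S corr E)%R.
Proof. by rewrite -big_split; apply: eq_bigr => D _; rewrite /= -mulrDl. Qed.

Let marks_big E Q t : twisted F E Q t -> (k < #|Q|)%N -> marks S c' E = marks S c E.
Proof.
move=> tE ltkQ; rewrite marks_c' [X in (_ + X)%R]big1 ?addr0 // => D _.
have [-> | /corrP[Q' [t' [tD oQ']]]] := eqVneq (corr D) 0%R; first by rewrite mul0r.
have [-> | fx] := eqVneq (fixc SS D E) 0%N; first by rewrite mulr0.
have [g _ /subset_leq_card] := fixc_sub (twisted_sub tD) (twisted_sub tE) fx.
by rewrite cardJg (twisted_card tE) (twisted_card tD) oQ' leqNgt ltkQ.
Qed.

Let marks_eq E Q t : twisted F E Q t -> #|Q| = k -> marks S c' E = tg E.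
Proof.
move=> tE oQ; have sES := twisted_sub tE; have [g SSg repE] := repP E.
have tJ := twistedJ tE SSg; rewrite -repE in tJ.
have oQg : #|(Q :^ g.2)%G| = k by rewrite cardJg.
have srS := twisted_sub tJ.
rewrite -(tgJ sES SSg) -repE marks_c' -(marksJ adm_c sES SSg).
rewrite -[_ :^ g]/(gval (E :^ g)%G) -repE.
rewrite {2}/marks (bigD1 (rep E)) //= big1 ?addr0 => [|D neqD].
  have -> : fixc SS (rep E) E = #|'N_SS(rep E) : rep E|.
    by rewrite -(fixcJ srS sES SSg) -[_ :^ g]/(gval (E :^ g)%G) -repE fixc_id.
  have gd : good (rep E).
    apply/andP; split; first by apply/asboolP; exists (Q :^ g.2)%G; eexists; split; first exact: tJ.
    by rewrite {2}repE repJ.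
  by rewrite /corr gd (divzK (tg_dvd tJ oQg)) addrC subrK.
have [-> | nzd] := eqVneq (corr D) 0%R; first by rewrite mul0r.
have [Q' [t' [tD oQ']]] := corrP nzd.
have [-> | fx] := eqVneq (fixc SS D E) 0%N; first by rewrite mulr0.
have [h SSh sEhD] := fixc_sub (twisted_sub tD) sES fx.
have DE : D = (E :^ h)%G.
  apply/group_inj/esym/eqP; rewrite eqEcard sEhD cardJg.
  by rewrite (twisted_card tE) (twisted_card tD) oQ' oQ leqnn.
case/negP: neqD; rewrite DE; move: nzd; rewrite /corr.
by case: ifP; rewrite ?eqxx // => /andP[_ /eqP DD] _; rewrite -DE DD DE repJ.
Qed.

Let weight_c' : (k < #|S|)%N -> (p %| (weight c' - weight c)%R)%Z.
Proof.
move=> ltkS; rewrite /weight -sumrB; apply: rpred_sum => D _.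
rewrite -mulrBl /c' [(c D + _)%R]addrC addrK.
have [-> | /corrP[Q [t [tD oQ]]]] := eqVneq (corr D) 0%R; first by rewrite mul0r dvdz0.
apply: dvdz_mull; rewrite dvdzE /= (twisted_card tD).
have sQS : Q \subset S by have [/fs_obj[]] := tD.
rewrite divgS //; have [[|j] ij] := p_natP (pnat_dvd (dvdn_indexg S Q) pS).
  by move: ltkS; rewrite -oQ -(Lagrange sQS) ij muln1 ltnn.
by rewrite ij expnS dvdn_mulr.
Qed.

Lemma step_biset : (k < #|S|)%N -> exists c2,
  [/\ admissible F c2,
      forall E Q t, twisted F E Q t -> (k < #|Q|)%N -> marks S c2 E = marks S c E,
      forall E Q t, twisted F E Q t -> #|Q| = k -> marks S c2 E = tg E
    & (p %| (weight c2 - weight c)%R)%Z].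
Proof. by move=> ltkS; exists c'; split=> //; apply: weight_c'. Qed.

End Step.

(** Stabilize the base at the subgroups of order k, for k going down from #|S|.
    At each order, the marks of the twisted diagonals over Q are brought to the
    mark of the one over Q that [twisted_congruence] provides; the quotients are
    then integers. Each step changes the weight by multiples of the indices
    #|S| / k, and hence of p. *)
Lemma stable_biset : exists c, [/\ admissible F c,
    forall Q, stable_at F c Q & ~~ (p %| weight c)%Z].
Proof.
suff /(_ #|S|)[c [adm_c stab_c w_c]] : forall m, exists c, [/\ admissible F c,
    forall Q, (#|S| - m <= #|Q|)%N -> stable_at F c Q & ~~ (p %| weight c)%Z].
  by exists c; split=> // Q; apply: stab_c; rewrite subnn.
elim=> [|m [c [adm_c stab_c w_c]]].
  by rewrite subn0; apply: base_biset.
have [leSm | ltmS] := leqP #|S| m.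
  exists c; split=> // Q _; apply: stab_c.
  by move: leSm; rewrite -subn_eq0 => /eqP->.
set k := (#|S| - m.+1)%N.
have kS : (k.+1 = #|S| - m)%N by rewrite /k -subSn // subSS.
have ltkS : (k < #|S|)%N by rewrite kS leq_subr.
have stab Q' : (k < #|Q'|)%N -> stable_at F c Q' by rewrite kS => /stab_c.
pose ok (Q : {group gT}) (z : int) := Q \subset S -> #|Q| = k ->
  forall E t, twisted F E Q t -> (#|'N_SS(E) : E| %| (z - marks S c E)%R)%Z.
have [Q | mf mfP] := @choice _ _ ok.
  have [[sQS oQ] | nQ] := pselect (Q \subset S /\ #|Q| = k).
    have [|E0 [t0 [_ E0P]]] := @twisted_congruence _ _ _ _ pS satF c Q adm_c sQS.
      by rewrite oQ.
    by exists (marks S c E0) => _ _; exact: E0P.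
  by exists 0%R => sQS oQ; case: nQ.
have snd_tw E Q t : twisted F E Q t -> [set z.2 | z in E] = Q.
  case=> _ ->; apply/setP=> u; apply/imsetP/idP=> [[_ /imsetP[v Qv ->] ->] // | Qu].
  by exists (t u, u); rewrite ?imset_f.
have classJ (X : {set gT}) y : y \in S -> (X :^ y) :^: S = X :^: S.
  move=> Sy; apply/setP=> Y; apply/imsetP/imsetP=> -[h Sh ->].
    by exists (y * h); rewrite ?groupM // conjsgM.
  by exists (y^-1 * h); rewrite ?groupM ?groupV // -conjsgM mulKVg.
(* The target has to be the same for conjugate subgroups: use one subgroup Q of
   the S-class of the second projection of E. *)
pose tg (E : {group gT * gT}) :=
  mf (odflt 1%G [pick Q : {group gT} | Q :^: S == [set z.2 | z in E] :^: S]).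
have tgJ E g : E \subset SS -> g \in SS -> tg (E :^ g)%G = tg E.
  case: g => s v sES /setXP[Ss Sv]; rewrite /tg.
  have -> : [set z.2 | z in (E :^ (s, v))%G] = [set z.2 | z in E] :^ v.
    apply/setP=> u; apply/imsetP/imsetP=> [[_ /imsetP[z Ez ->] ->] | [_ /imsetP[z Ez ->] ->]].
      by exists z.2; rewrite ?imset_f.
    by exists (z ^ (s, v)); rewrite ?memJ_conjg.
  by rewrite classJ.
have tg_dvd E Q t : twisted F E Q t -> #|Q| = k ->
    (#|'N_SS(E) : E| %| (tg E - marks S c E)%R)%Z.
  move=> tE oQ; rewrite /tg (snd_tw _ _ _ tE).
  case: pickP => [P /eqP PQ | /(_ Q)]; last by rewrite eqxx.
  have [v Sv PE] : exists2 v, v \in S & P = (Q :^ v)%G.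
    have : (P : {set gT}) \in Q :^: S.
      by rewrite -PQ; apply/imsetP; exists 1; rewrite ?conjsg1.
    by case/imsetP=> v Sv ?; exists v => //; apply: group_inj.
  have SSg : (1, v) \in SS by rewrite inE /= group1.
  have sES := twisted_sub tE; have tJ := twistedJ tE SSg.
  have sPS : P \subset S by rewrite PE; have [/fs_obj[]] := tJ.
  have := mfP P sPS; rewrite {1 2}PE cardJg => /(_ oQ _ _ tJ).
  rewrite (marksJ adm_c sES SSg).
  have -> : #|'N_SS(E :^ (1, v)) : E :^ (1, v)| = #|'N_SS(E) : E|; last by [].
  have -> : 'N_SS(E :^ (1, v)) = 'N_SS(E) :^ (1, v).
    by rewrite conjIg normJ (conjGid SSg).
  by rewrite indexJg.
have [c2 [adm2 big2 eq2 w2]] := step_biset adm_c tgJ tg_dvd ltkS.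
exists c2; split=> // [Q | ].
  rewrite leq_eqVlt => /orP[/eqP oQ | ltkQ] E E' t t' tE tE'; last first.
    by rewrite (big2 _ _ _ tE ltkQ) (big2 _ _ _ tE' ltkQ) (stab Q ltkQ _ _ _ _ tE tE').
  rewrite (eq2 _ _ _ tE (esym oQ)) (eq2 _ _ _ tE' (esym oQ)) /tg.
  by rewrite (snd_tw _ _ _ tE) (snd_tw _ _ _ tE').
apply: contra w_c => w_c2; rewrite -[weight c](subKr (weight c2)).
by rewrite rpredB // -opprB rpredN.
Qed.

End StableBiset.

(** * Transfer along the stable biset *)

Section Transfer.

Variables (R : realType) (gT : finGroupType) (p : nat) (S : {group gT}).
Variables (F : fusion_system S) (c : {group gT * gT} -> int).
Hypotheses (pS : (p.-group S)%g) (adm_c : admissible F c).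
Hypothesis stab_c : forall Q, stable_at F c Q.
Implicit Types (C P Q : {group gT}) (D : {group gT * gT}) (chi : gT -> R).
Local Open Scope group_scope.

Let SS := setX_group S S.

(** The generated group only serves to have a group at hand: for a twisted
    diagonal D, the left projection is the image of the twist. *)
Definition lproj D : {group gT} := [group of <<[set z.1 | z in D]>>].

(** The combination with coefficients c D of the characters that chi, pulled back
    along the inverse of the twist of D, induces from the left projection. *)
Definition transfer chi x : R := (\sum_(D : {group gT * gT}) (c D)%:~R *
  (#|D|%:R^-1 * \sum_(s in S) \sum_(v | ((x ^ s)%g, v) \in D) chi v))%R.

(** The transfer of the trivial character. *)
Definition augmentation x : int :=
  (\sum_(D : {group gT * gT}) c D * (fixc S (lproj D) <[x]>)%:Z)%R.

Lemma lproj_twisted D Q t : twisted F D Q t ->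
  exists2 s, fs_iso F (lproj D) Q s & forall chi x,
  (\sum_(v | (x, v) \in D) chi v)%R = if x \in lproj D then chi (s x) else 0%R.
Proof.
move=> tD; have [Ft DE] := tD; have [_ tI _] := fs_inj Ft.
have lE : lproj D = fimg t Q.
  apply: group_inj; rewrite /= DE; congr <<_>>; apply/setP=> x.
  apply/imsetP/imsetP=> [[_ /imsetP[u Qu ->] ->] | [u Qu ->]]; first by exists u.
  by exists (t u, u); rewrite ?imset_f.
have [s [Fs tK sK]] := fs_inverse Ft; have [Ft' _] := fs_factor Ft.
exists s; first by rewrite lE; split=> //; exists t.
move=> chi x; rewrite lE; have [xtQ | x'tQ] := boolP (x \in fimg t Q); last first.
  rewrite big_pred0 // => v; rewrite (twisted_mem _ _ tD).
  apply: contraNF x'tQ => /andP[Qv /eqP->].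
  by rewrite (fimgE Ft) imset_f.
move: xtQ; rewrite (fimgE Ft) => /imsetP[u Qu ->]; rewrite tK //.
rewrite (big_pred1 u) // => v; rewrite (twisted_mem _ _ tD) /= [RHS]eq_sym.
by apply/andP/eqP=> [[Qv /eqP/tI->] | <-].
Qed.

Lemma lproj_sub D Q t : twisted F D Q t -> lproj D \subset S.
Proof. by case/lproj_twisted=> s [/fs_obj[]]. Qed.

Lemma lproj_card D Q t : twisted F D Q t -> #|lproj D| = #|D|.
Proof.
by move=> tD; have [s /fs_iso_im[_ ->] _] := lproj_twisted tD; rewrite (twisted_card tD).
Qed.

Lemma transfer_vchar chi : vchar S chi -> vchar S (transfer chi).
Proof.
move=> vchi; apply: vchar_sum => D _.
have [-> | /adm_c[Q [t tD]]] := eqVneq (c D) 0%R.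
  by apply: eq_vchar (vchar0 R S) => x _; rewrite mul0r.
apply: vcharZ.
have [s iso_s sumE] := lproj_twisted tD.
have [[Fs _] [sQ _]] := (iso_s, fs_iso_im iso_s).
have [sM _ _] := fs_inj Fs; have [_ sQS] := fs_obj Fs.
have vs : vchar (lproj D) (chi \o s).
  by apply: vchar_morph sM _ vchi; rewrite sQ.
apply: eq_vchar (vchar_ind (lproj_sub tD) vs) => x Sx.
rewrite /ind_char (lproj_card tD) big_mkcondr; congr (_ * _)%R.
by apply: eq_bigr => w _; rewrite sumE.
Qed.

(** After this exchange of summations, the transfer depends on x through the marks
    of cyclic subgroups generated by pairs (x, y) only. *)
Lemma transfer_marks chi x :
    {in S &, forall y w, chi (y ^ w) = chi y} -> x \in S ->
  (#|S|%:R * transfer chi x = \sum_(y in S) chi y * (marks S c <[(x, y)]>)%:~R)%R.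
Proof.
move=> cchi Sx.
rewrite (eq_bigr (fun y => \sum_(D : {group gT * gT})
    (c D)%:~R * (chi y * (fixc SS D <[(x, y)]>)%:R)))%R; last first.
  move=> y _; rewrite /marks rmorph_sum mulr_sumr; apply: eq_bigr => D _.
  by rewrite rmorphM /= mulrCA.
rewrite exchange_big mulr_sumr; apply: eq_bigr => D _.
have [-> | cD] := eqVneq (c D) 0%R.
  by rewrite mulr0z mul0r mulr0 big1 // => y _; rewrite mul0r.
rewrite mulrCA -mulr_sumr; congr (_ * _)%R.
have sDS := adm_sub adm_c cD.
rewrite mulrCA; apply: (mulfI (natrG_neq0 R D)); rewrite mulVKf ?natrG_neq0 // !mulr_sumr.
rewrite [RHS](eq_bigr (fun y => \sum_(s in S) \sum_(w in S)
    if ((x ^ s)%g, (y ^ w)%g) \in D then chi y else 0))%R; last first.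
  move=> y Sy; have sxy : <[(x, y)]> \subset SS by rewrite cycle_subG inE Sx.
  rewrite mulrCA -natrM fixcE // -sum1_card natr_sum mulr_sumr.
  rewrite pair_big /= big_mkcond [RHS]big_mkcond; apply: eq_bigr => -[s w] _.
  rewrite !inE /= -cycleJ cycle_subG.
  have -> : (x, y) ^ (s, w) = (x ^ s, y ^ w) by rewrite !conjgE.
  by case: (s \in S) => //=; case: (w \in S) => //=; case: ifP => //; rewrite mulr1.
rewrite [RHS]exchange_big; apply: eq_bigr => s Ss /=.
rewrite [RHS]exchange_big /= mulr_natl -sumr_const; apply: eq_bigr => w Sw.
rewrite [LHS](reindex_inj (conjg_inj w)) /= [RHS]big_mkcond [LHS]big_mkcond /=.
apply: eq_bigr => y _; have [Dxy | _] := ifP; last by case: ifP.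
have /setXP[_] := subsetP sDS _ Dxy; rewrite /= groupJr // => Sy.
by rewrite Sy cchi.
Qed.

Lemma expgn_pair (a b : gT) n : (a, b) ^+ n = (a ^+ n, b ^+ n).
Proof. by elim: n => // n IHn; rewrite !expgS IHn. Qed.

(** Composition with f transforms twists for the group generated by (x, y) into
    twists for the one generated by (f x, y), and conversely; without twists, the
    marks are zero. *)
Lemma marks_F_stable P f x y : F P S f -> x \in P -> y \in S ->
  marks S c <[(f x, y)]> = marks S c <[(x, y)]>.
Proof.
have twK P' g a b Q t : F P' S g -> a \in P' ->
    twisted F <[(a, b)]>%G Q t -> twisted F <[(g a, b)]>%G Q (g \o t).
  move=> Fg Pa tab; have [Ft tabE] := tab.
  have mem u : u \in Q -> exists n, t u = a ^+ n /\ u = b ^+ n.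
    move=> Qu; have : (t u, u) \in <[(a, b)]> by rewrite (twisted_mem _ _ tab) Qu eqxx.
    by case/cycleP=> n; rewrite expgn_pair => -[-> ->]; exists n.
  have [sP'S _] := fs_obj Fg; split.
    apply: fs_comp Fg; apply: fs_img Ft _ sP'S.
    by apply/subsetP=> _ /imsetP[u /mem[n [-> _]] ->]; rewrite groupX.
  apply/setP=> z; apply/idP/imsetP=> [/cycleP[n ->] | [u /mem[n [tu un]] ->]].
    have : (a, b) ^+ n \in <[(a, b)]> by rewrite mem_cycle.
    rewrite expgn_pair (twisted_mem _ _ tab) => /andP[Qb /eqP tb].
    by exists (b ^+ n); rewrite //= -tb (fs_morphX _ Fg) // expgn_pair.
  rewrite /= tu un (fs_morphX _ Fg) //; apply/cycleP; exists n.
  by rewrite expgn_pair.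
have sub a b : a \in S -> b \in S -> <[(a, b)]> \subset SS.
  by move=> Sa Sb; rewrite cycle_subG inE Sa.
move=> Ff Px Sy; have [sPS _] := fs_obj Ff; have [_ _ /subsetP sfP] := fs_inj Ff.
have Sfx : f x \in S by rewrite sfP ?imset_f.
have Sx := subsetP sPS x Px.
have [m0 | nz] := eqVneq (marks S c <[(x, y)]>) 0%R; last first.
  have [Q [t tK]] := marks_twisted adm_c (sub x y Sx Sy) nz.
  exact: stab_c (twK _ _ _ _ _ _ Ff Px tK) tK.
rewrite m0; apply/eqP; apply/negPn/negP=> nz; case/negP: (nz); apply/eqP.
have [Q [t tK]] := marks_twisted adm_c (sub _ y Sfx Sy) nz.
have [g [Fg fK _]] := fs_inverse Ff.
have Fg' : F (fimg f P) S g := fs_comp Fg (fs_id F sPS (subxx S)).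
have fPx : f x \in fimg f P by rewrite (fimgE Ff) imset_f.
have := twK _ _ _ _ _ _ Fg' fPx tK; rewrite fK // => tK'.
by rewrite -m0; apply: stab_c tK tK'.
Qed.

Lemma transfer_F_stable chi P f x :
    {in S &, forall y w, chi (y ^ w) = chi y} -> F P S f -> x \in P ->
  transfer chi (f x) = transfer chi x.
Proof.
move=> cchi Ff Px; have [sPS _] := fs_obj Ff; have [_ _ /subsetP sfP] := fs_inj Ff.
have Sfx : f x \in S by rewrite sfP ?imset_f.
apply: (mulfI (natrG_neq0 R S)); rewrite !transfer_marks ?(subsetP sPS x Px) //.
by apply: eq_bigr => y Sy; rewrite (marks_F_stable Ff).
Qed.

(** In the term of D, each s such that C ^ s is in the left projection of D
    contributes the sum of chi over the generators of an F-conjugate of C, which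
    is always the same; the augmentation counts these s. *)
Lemma transfer_gsum chi C x :
    (forall P, fs_conjugate F C P -> gsum chi C = gsum chi P) ->
    C \subset S -> generator C x ->
  gsum (transfer chi) C = ((augmentation x)%:~R * gsum chi C)%R.
Proof.
move=> conj_chi sCS /eqP Cx; rewrite /gsum exchange_big rmorph_sum mulr_suml.
apply: eq_bigr => D _; rewrite -mulr_sumr rmorphM /= -!mulrA.
have [-> | /adm_c[Q [t tD]]] := eqVneq (c D) 0%R; first by rewrite !mul0r.
congr (_ * _)%R; rewrite -mulr_sumr -Cx.
apply: (mulfI (natrG_neq0 R D)); rewrite mulVKf ?natrG_neq0 // mulrA -natrM.
rewrite -(lproj_card tD) fixcE ?(lproj_sub tD) // -sum1_card natr_sum mulr_suml.
have [s iso_s sumE] := lproj_twisted tD.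
rewrite exchange_big [RHS]big_mkcond [LHS]big_mkcond; apply: eq_bigr => w _ /=.
rewrite !inE; have [Sw | //] := boolP (w \in S); rewrite /=.
have gmem y : generator C y -> (y ^ w \in lproj D) = (C :^ w \subset lproj D).
  by move=> /eqP->; rewrite -cycleJ cycle_subG.
have [sCwD | nsCwD] := ifPn; last first.
  by rewrite big1 // => y gy; rewrite sumE gmem // (negPf nsCwD).
have Fw : F C (lproj D) (conjg^~ w) by apply: fs_conj => //; apply: lproj_sub tD.
have [Fs _] := iso_s; have Fh := fs_comp Fw Fs; have [_ sQS] := fs_obj Fs.
have Fh' : F C (fimg (s \o conjg^~ w) C) (s \o conjg^~ w) := (fs_factor Fh).1.
have iso_h : fs_iso F C (fimg (s \o conjg^~ w) C) (s \o conjg^~ w).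
  by apply: fs_isoP; rewrite ?(fimgE Fh) //; apply: fs_comp Fh (fs_id F sQS (subxx S)).
rewrite mul1r -/(gsum chi C) (conj_chi _ (ex_intro _ _ iso_h)) (gsum_iso _ iso_h).
by apply: eq_bigr => y gy; rewrite sumE gmem // sCwD.
Qed.

Lemma transfer1 x : x \in S -> transfer (fun=> 1%R) x = (augmentation x)%:~R%R.
Proof.
move=> Sx; rewrite rmorph_sum; apply: eq_bigr => D _; rewrite rmorphM /=.
have [-> | /adm_c[Q [t tD]]] := eqVneq (c D) 0%R; first by rewrite !mul0r.
have sxS : <[x]> \subset S by rewrite cycle_subG.
congr (_ * _)%R; apply: (mulfI (natrG_neq0 R D)); rewrite mulVKf ?natrG_neq0 //.
rewrite -natrM -(lproj_card tD) fixcE ?(lproj_sub tD) // -sum1_card natr_sum.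
have [s _ sumE] := lproj_twisted tD.
rewrite [RHS]big_mkcond [LHS]big_mkcond; apply: eq_bigr => w _ /=.
by rewrite !inE -cycleJ cycle_subG sumE; case: (w \in S).
Qed.

(** The p-group generated by x has, modulo p, as many fixed cosets as there are
    cosets. *)
Lemma augmentation_mod x : x \in S -> (p %| (augmentation x - weight S c)%R)%Z.
Proof.
move=> Sx; rewrite /augmentation /weight -sumrB; apply: rpred_sum => D _.
rewrite -mulrBr; have [-> | /adm_c[Q [t tD]]] := eqVneq (c D) 0%R.
  by rewrite mul0r dvdz0.
apply: dvdz_mull; rewrite -(lproj_card tD) divgS ?(lproj_sub tD) //.
have sxS : <[x]> \subset S by rewrite cycle_subG.
have := pgroup_fix_mod (pgroupS sxS pS) (subset_trans sxS (actsRs_rcosets (lproj D) S)).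
move=> eqm; rewrite -eqz_mod_dvd; apply/eqP.
by rewrite !modz_nat eqm.
Qed.

End Transfer.

(** * Realization of Artin functions *)

Lemma Euler_expz (n : nat) (a : int) :
  coprimez a n -> (n %| (a ^+ totient n - 1)%R)%Z.
Proof.
have [-> | n_gt0] := posnP n; first by rewrite expr0 subrr dvdz0.
move=> co_an; rewrite -eqz_mod_dvd -modzXm.
have [r rE] : exists r : nat, (a %% n)%Z = r.
  by exists (absz (a %% n)%Z); rewrite gez0_abs // modz_ge0 // eqz_nat -lt0n.
have co_rn : coprime r n.
  by move: co_an; rewrite /coprimez -gcdz_modl rE.
by rewrite rE -(natz r) -natrX natz !modz_nat Euler_exp_totient.
Qed.

Theorem theoremA (R : realType) (gT : finGroupType) (p : nat) (S : {group gT})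
    (F : fusion_system S) (p_prime : prime p) (pS : pgroup p S)
    (satF : saturated F p) (f : {group gT} -> int) (Cf : Cba p F f) :
  exists X : virtual_repr R S,
    F_stable F X /\ (forall H : {group gT}, H \subset S -> Dim X H = f H).
Proof.
have [chi chiE] := Borel_Smith_realizable R p_prime pS (Cba_Borel_Smith Cf).
have [vchi fixchi] := chiE.
have [Psi [Psi_stable Psi_pieces Psi_gsum]] := stable_pieces p_prime pS Cf chiE.
have [c [adm_c stab_c w_c]] := stable_biset p_prime pS satF.
pose T := @transfer R _ S c; pose A x := augmentation S c x.
have class_chi := vchar_class vchi.
have T1 x : x \in S -> T (fun=> 1) x = (A x)%:~R.
  by move=> Sx; rewrite /T (transfer1 R adm_c).
have T_stable phi : {in S &, forall x y, phi (x ^ y)%g = phi x} ->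
    forall P a, F P S a -> {in P, forall x, T phi (a x) = T phi x}.
  by move=> cphi P a Fa x Px; apply: transfer_F_stable adm_c stab_c _ _ _ _ cphi Fa Px.
have A_stable P a x : F P S a -> x \in P -> A (a x) = A x.
  move=> Fa Px; have [sPS _] := fs_obj Fa; have [_ _ /subsetP saP] := fs_inj Fa.
  have Sax : a x \in S by rewrite saP ?imset_f.
  apply: (@intr_inj R); rewrite -!T1 ?(subsetP sPS x Px) //.
  by rewrite (T_stable (fun=> 1) _ _ _ Fa).
(* Conjugations by elements of S are morphisms of F, so that F-invariant functions
   are class functions. *)
have conjF y : y \in S -> F S S (conjg^~ y).
  by move=> Sy; apply: fs_conj; rewrite ?conjGid.
have A_gen x y : <[x]>%g = <[y]>%g -> A x = A y by rewrite /A /augmentation => ->.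
pose n := totient #|S|; have n_gt0 : (0 < n)%N by rewrite totient_gt0 cardG_gt0.
pose h x : int := ((A x ^+ n - 1) %/ #|S|)%Z.
have hE x : x \in S -> #|S|%:R * (h x)%:~R = (A x)%:~R ^+ n - 1 :> R.
  move=> Sx; have co_A : coprimez (A x) #|S|.
    have [m oS] := p_natP pS; rewrite coprimezE /= oS coprime_sym.
    rewrite coprimeXl // prime_coprime //; apply: contra w_c => p_A.
    rewrite -(subKr (A x) (weight S c)) rpredB //.
    exact: (augmentation_mod R pS adm_c Sx).
  have := Euler_expz co_A; rewrite dvdz_eq => /eqP hA.
  rewrite pmulrn -intrM mulrC /h hA.
  by rewrite rmorphB rmorphXn.
pose hPsi x := (h x)%:~R * Psi x.
have hPsi_stable P a : F P S a -> {in P, forall x, hPsi (a x) = hPsi x}.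
  by move=> Fa x Px; rewrite /hPsi /h (A_stable _ _ _ Fa Px) (Psi_stable P a Fa).
(* The power n.-1 completes the factor A that T puts on the sums of chi to
   A ^ n, whose excess over 1 is removed by the multiple of Psi. *)
pose psi x := T chi x * T (fun=> 1) x ^+ n.-1 - #|S|%:R * hPsi x.
have [X XE] : vchar S psi.
  apply: vcharB.
    apply: vcharM; first exact: (transfer_vchar adm_c).
    by apply: vcharX; apply: (transfer_vchar adm_c); apply: vchar1.
  apply: vchar_artin => [x y Sx Sy | D sDS cycD].
    exact: hPsi_stable (conjF y Sy) x Sx.
  have [z Dz] := cyclicP cycD.
  apply: eq_vchar (vcharZ (h z) (Psi_pieces D sDS cycD)) => x Dx.
  rewrite mulrCA; congr (_ * _); case: ifP => [/eqP gx | _]; last by rewrite mulr0.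
  by rewrite /hPsi /h (A_gen x z) // -gx.
exists X; split.
  apply: vchar_F_stable XE _ => P a Fa x Px.
  rewrite /psi (T_stable _ class_chi _ _ Fa) // (hPsi_stable _ _ Fa) //.
  by rewrite (T_stable (fun=> 1) _ _ _ Fa).
move=> H sHS; apply: (@intr_inj R); rewrite (Dim_fixdim XE sHS) -fixchi //.
apply: (eq_fixdim_gsum sHS) => C sCS cycC.
have [z Cz] := cyclicP cycC; have gz : generator C z by rewrite /generator Cz.
have Sgen x : generator C x -> x \in S.
  by move=> /eqP gx; rewrite -cycle_subG -gx.
have A_C x : generator C x -> A x = A z by move=> /eqP gx; apply: A_gen; rewrite -gx.
have gsum_chi P : fs_conjugate F C P -> gsum chi C = gsum chi P.
  exact: (gsum_conjugate p_prime pS Cf chiE cycC sCS).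
have gsum_T := transfer_gsum adm_c gsum_chi sCS gz.
transitivity ((A z)%:~R ^+ n.-1 * gsum (T chi) C - #|S|%:R * (h z)%:~R * gsum Psi C).
  rewrite /gsum !mulr_sumr -sumrB; apply: eq_bigr => x gx.
  by rewrite /psi T1 ?Sgen // /hPsi /h A_C // mulrA [_ * T chi x]mulrC.
rewrite /T gsum_T Psi_gsum // hE; last exact: Sgen.
rewrite mulrA -exprSr prednK // mulrBl mul1r opprB addrCA subrr addr0 //.
Qed.
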